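(* There exist a finite set $\mathcal S\subset\mathbb R^2$ and four sets $\mathcal C_1,\mathcal C_2,\mathcal C_3,\mathcal C_4\subset\mathbb R^2$, where $\mathcal C_1$ and $\mathcal C_2$ are connected closed curves and $\mathcal C_3$ and $\mathcal C_4$ are disconnected finite unions of pairwise disjoint closed curves, such that $\mathcal S$ is a $0.72$-sample of each $\mathcal C_i$ and $G_{\mathcal C_i}(\mathcal S)\ne G_{\mathcal C_j}(\mathcal S)$ for all $i\ne j$.
   Context: A closed curve is the image of an injective continuous map $S^1\to\mathbb R^2$. For a finite union $\mathcal C$ of pairwise disjoint closed curves, the medial axis $\mathcal M$ is the set of points of $\mathbb R^2$ without a unique closest point in $\mathcal C$, $\mathrm{lfs}(p)=d(p,\mathcal M)$, and a finite $\mathcal S\subset\mathcal C$ is an $\epsilon$-sample of $\mathcal C$ if $d(p,\mathcal S)<\epsilon\,\mathrm{lfs}(p)$ for all $p\in\mathcal C$. For sample points, $a\to b$ means: for some orientation of the component of $\mathcal C$ containing $a,b$, moving from $a$ along the orientation, the next sample point met is $b$; $a,b$ are consecutive if $a\to b$ or $b\to a$. $G_{\mathcal C}(\mathcal S)$ is the graph on $\mathcal S$ with an edge $\{a,b\}$ iff $a,b$ are consecutive. *)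

(* Defs.v *)
From Stdlib Require Import Reals List.
From Coquelicot Require Import Coquelicot.
Import ListNotations.
Open Scope R_scope.

Definition point : Type := (R * R)%type.

Definition edist (p q : point) : R :=
  sqrt ((fst p - fst q) ^ 2 + (snd p - snd q) ^ 2).

(* Distance from a point to a set, as an extended real infimum
   (= +oo for the empty set). *)
Definition dist_set (p : point) (A : point -> Prop) : Rbar :=
  Glb_Rbar (fun r => exists q, A q /\ r = edist p q).

(* A parametrization of a closed curve K: the map t |-> (g1 t, g2 t) is
   continuous, 1-periodic (i.e. a continuous map on S^1 = R/Z), injective on
   one period [0,1), with image exactly K. *)
Definition curve_param (K : point -> Prop) (g1 g2 : R -> R) : Prop :=
  (forall t, continuous g1 t) /\ (forall t, continuous g2 t) /\
  (forall t, g1 (t + 1) = g1 t /\ g2 (t + 1) = g2 t) /\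
  (forall s t, 0 <= s < 1 -> 0 <= t < 1 ->
     (g1 s, g2 s) = (g1 t, g2 t) -> s = t) /\
  (forall p, K p <-> exists t, 0 <= t < 1 /\ p = (g1 t, g2 t)).

Definition closed_curve (K : point -> Prop) : Prop :=
  exists g1 g2, curve_param K g1 g2.

(* A finite family of pairwise disjoint closed curves (its members are the
   components of the union). *)
Definition disjoint_curves (cs : list (point -> Prop)) : Prop :=
  (forall K, In K cs -> closed_curve K) /\
  (forall i j, (i < length cs)%nat -> (j < length cs)%nat -> i <> j ->
     forall p, ~ (nth i cs (fun _ => False) p /\ nth j cs (fun _ => False) p)).

Definition union_of (cs : list (point -> Prop)) (p : point) : Prop :=
  exists K, In K cs /\ K p.

Definition open2 (U : point -> Prop) : Prop :=
  forall p, U p -> exists r, 0 < r /\ forall q, edist p q < r -> U q.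

Definition disconnected (C : point -> Prop) : Prop :=
  exists U V, open2 U /\ open2 V /\
    (forall p, C p -> U p \/ V p) /\
    (exists p, C p /\ U p) /\ (exists p, C p /\ V p) /\
    (forall p, C p -> ~ (U p /\ V p)).

Definition closest (C : point -> Prop) (p x : point) : Prop :=
  C x /\ forall y, C y -> edist p x <= edist p y.

Definition medial_axis (C : point -> Prop) (p : point) : Prop :=
  ~ (exists! x, closest C p x).

Definition lfs (C : point -> Prop) (p : point) : Rbar :=
  dist_set p (medial_axis C).

Definition eps_sample (eps : R) (C : point -> Prop) (S : list point) : Prop :=
  (forall s, In s S -> C s) /\
  (forall p, C p ->
     Rbar_lt (dist_set p (fun q => In q S)) (Rbar_mult (Finite eps) (lfs C p))).

(* a -> b : for some orientation (i.e. some parametrization, possibly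
   reversed) of the component K containing a and b, moving from a the next
   sample point met is b (after a parameter increment t in (0,1]). *)
Definition next_sample (cs : list (point -> Prop)) (S : list point)
    (a b : point) : Prop :=
  exists K, In K cs /\ K a /\ K b /\
  exists g1 g2, curve_param K g1 g2 /\
  exists s t, (g1 s, g2 s) = a /\ 0 < t <= 1 /\
    (g1 (s + t), g2 (s + t)) = b /\
    (forall u, 0 < u < t -> ~ In (g1 (s + u), g2 (s + u)) S).

Definition consecutive (cs : list (point -> Prop)) (S : list point)
    (a b : point) : Prop :=
  next_sample cs S a b \/ next_sample cs S b a.

(* The graph G_C(S): vertex set S, edge {a,b} iff a, b consecutive;
   represented by its (symmetric) adjacency relation on S. *)
Definition sample_graph (cs : list (point -> Prop)) (S : list point)
    (a b : point) : Prop :=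
  In a S /\ In b S /\ consecutive cs S a b.

(* Main.v *)
Require Import Defs.
From Stdlib Require Import ZArith Reals List Lra Lia Classical ClassicalEpsilon.
From Coquelicot Require Import Coquelicot.
Import ListNotations.
Open Scope R_scope.
Set Bullet Behavior "Strict Subproofs".

(** A switch is a planar configuration with 8 rays at angles 22.5 + 45 k degrees.
    In state H neighbouring rays are joined by strands across the coordinate axes,
    in state V across the diagonals; the two states are exchanged by the reflection
    [rho] about a ray, and both pass through common sample points on the rays.
    Two mirror-image switches are joined by 8 links: the states HV and VH give a
    single closed curve, the states HH and VV give four, and the state of a switch
    is visible in the sample graph.

    Each state is invariant under a dihedral group of order 8, so folding the plane
    onto a wedge reduces closest points to those of a single half strand [sigma], a
    chain of circular arcs and segments.  If the derivative of the distance to m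
    along the chain never changes sign from positive to negative, m has a unique
    closest point; otherwise m lies in one of four cones with apex at a centre of an
    arc, or beyond the edge of the wedge.  The distance from the strand to these sets
    exceeds 1/0.719 times the distance to the nearest of three samples.  Off the
    strands both states coincide, the local feature size is positive at each point,
    and compactness provides enough samples. *)

(** * Distances and closest points *)

(** A sample shared by both states of a switch must lie on a ray, the line fixed by the reflection
    exchanging them, so the middle [P0] of a strand can carry none. An arc turning onto the ray
    tangentially would first meet it too far from [P0]; the half strand therefore cuts the ray at
    [N2], overshoots, cuts it again at [J2] and only then becomes tangent to it at [J4]. Radii 65,
    65/2, 26 and the triples (33, 56, 65) and (5, 12, 13) make all tangencies exact, with rational
    coordinates except at [P0] and [J1], where the angle PI/8 enters. Using 0.719 instead of 0.72
    leaves room for the strict inequality. Near a core only distances up to 64 matter, which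
    confines closest points to the disc of radius 400, where only one switch is present. This
    separates two regimes: explicit estimates on the cores, and on rays and links mere positivity of
    the local feature size, so that the links may be any convenient curves. They are taken from one
    pencil of circles, which makes them disjoint. *)

Definition d2 (p q : point) : R := (fst p - fst q) ^ 2 + (snd p - snd q) ^ 2.

Lemma d2_ge0 p q : 0 <= d2 p q.
Proof. unfold d2; apply Rplus_le_le_0_compat; apply pow2_ge_0. Qed.

Lemma d2_sym p q : d2 p q = d2 q p.
Proof. unfold d2; ring. Qed.

Lemma d2_eq0 p q : d2 p q = 0 -> p = q.
Proof.
destruct p as [a b], q as [a' b']; unfold d2; simpl; intros H.
assert (A := pow2_ge_0 (a - a')); assert (B := pow2_ge_0 (b - b')).
assert (A' : (a - a') ^ 2 = 0) by lra; assert (B' : (b - b') ^ 2 = 0) by lra.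
rewrite <- Rsqr_pow2 in A', B'; apply Rsqr_0_uniq in A'; apply Rsqr_0_uniq in B'.
f_equal; lra.
Qed.

Lemma edist_d2 p q : edist p q = sqrt (d2 p q).
Proof. reflexivity. Qed.

Lemma edist_ge0 p q : 0 <= edist p q.
Proof. apply sqrt_pos. Qed.

Lemma edist_sqr p q : edist p q * edist p q = d2 p q.
Proof. rewrite edist_d2; apply sqrt_sqrt, d2_ge0. Qed.

Lemma edist_sym p q : edist p q = edist q p.
Proof. rewrite !edist_d2, d2_sym; reflexivity. Qed.

Lemma edist_eq0 p q : edist p q = 0 -> p = q.
Proof. intros H; apply d2_eq0; rewrite <- edist_sqr, H; ring. Qed.

Lemma edist_le p q p' q' : d2 p q <= d2 p' q' <-> edist p q <= edist p' q'.
Proof.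
split; intros H.
- rewrite !edist_d2; apply sqrt_le_1; auto using d2_ge0.
- rewrite <- (edist_sqr p q), <- (edist_sqr p' q').
  apply Rmult_le_compat; auto using edist_ge0.
Qed.

Lemma edist_triangle p q r : edist p r <= edist p q + edist q r.
Proof.
assert (H := triangle (fst p) (snd p) (fst r) (snd r) (fst q) (snd q)).
unfold dist_euc, Rsqr in H; unfold edist; simpl.
rewrite !Rmult_1_r; exact H.
Qed.

Lemma edist_fst p q : Rabs (fst p - fst q) <= edist p q.
Proof.
apply Rsqr_incr_0_var; [|apply edist_ge0].
rewrite <- Rsqr_abs; unfold Rsqr; rewrite edist_sqr; unfold d2.
assert (H := pow2_ge_0 (snd p - snd q)); nra.
Qed.

Lemma edist_lt_sqr p q r : 0 < r -> d2 p q < r * r -> edist p q < r.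
Proof.
intros Hr H; rewrite <- edist_sqr in H.
assert (H0 := edist_ge0 p q); nra.
Qed.

Lemma sqr_lt_edist p q r : edist p q < r -> d2 p q < r * r.
Proof. intros H; rewrite <- edist_sqr; assert (H0 := edist_ge0 p q); nra. Qed.

(** Plays the role of closedness: it passes to finite unions and gives a positive distance to every
    point outside. *)
Definition proximinal (K : point -> Prop) : Prop :=
  forall m, exists x, closest K m x.

Definition separated (K : point -> Prop) (p : point) : Prop :=
  exists d, 0 < d /\ forall q, K q -> d <= edist p q.

Lemma proximinal_union (K1 K2 : point -> Prop) :
  proximinal K1 -> proximinal K2 -> proximinal (fun q => K1 q \/ K2 q).
Proof.
intros H1 H2 m; destruct (H1 m) as [x [Kx Hx]], (H2 m) as [y [Ky Hy]].
destruct (Rle_dec (edist m x) (edist m y)) as [h|h].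
- exists x; split; auto; intros z [Kz|Kz]; auto.
  apply Rle_trans with (edist m y); auto.
- exists y; split; auto; intros z [Kz|Kz]; auto.
  apply Rle_trans with (edist m x); auto; lra.
Qed.

Lemma proximinal_ext (K K' : point -> Prop) :
  (forall q, K q <-> K' q) -> proximinal K -> proximinal K'.
Proof.
intros E H m; destruct (H m) as [x [Kx Hx]]; exists x; split.
- apply E; auto.
- intros y Ky; apply Hx, E; auto.
Qed.

Lemma proximinal_separated K p : proximinal K -> ~ K p -> separated K p.
Proof.
intros H Np; destruct (H p) as [x [Kx Hx]]; exists (edist p x); split; auto.
assert (H0 := edist_ge0 p x).
destruct (Req_dec (edist p x) 0) as [h|h]; [|lra].
apply edist_eq0 in h; subst; contradiction.
Qed.

Lemma separated_union (K1 K2 : point -> Prop) p :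
  separated K1 p -> separated K2 p -> separated (fun q => K1 q \/ K2 q) p.
Proof.
intros [a [Ha Ka]] [b [Hb Kb]]; exists (Rmin a b); split.
- apply Rmin_pos; auto.
- intros q [h|h]; [apply Rle_trans with a|apply Rle_trans with b]; auto.
  apply Rmin_l. apply Rmin_r.
Qed.

Lemma separated_sub (K K' : point -> Prop) p :
  (forall q, K q -> K' q) -> separated K' p -> separated K p.
Proof. intros E [d [Hd H]]; exists d; split; auto. Qed.

Lemma separated_bool (K : bool -> point -> Prop) p :
  (forall b, separated (K b) p) -> separated (fun q => exists b, K b q) p.
Proof.
intros H; apply separated_sub with (fun q => K true q \/ K false q).
- intros q [[] h]; auto.
- apply separated_union; auto.
Qed.

Lemma proximinal_bool (K : bool -> point -> Prop) :
  (forall b, proximinal (K b)) -> proximinal (fun q => exists b, K b q).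
Proof.
intros H; apply proximinal_ext with (fun q => K true q \/ K false q).
- intros q; split.
  + intros [h|h]; eauto.
  + intros [[] h]; auto.
- apply proximinal_union; auto.
Qed.

(** Turns a real lower bound [r] on the distance to the medial axis into the sample condition. When
    the medial axis is empty, [lfs] is infinite, and so is its product with [eps], which is
    positive. *)
Lemma eps_sample_point (eps r : R) (C : point -> Prop) (S : list point) (p s : point) :
  0 < eps -> In s S -> edist p s < eps * r ->
  (forall m, medial_axis C m -> r <= edist p m) ->
  Rbar_lt (dist_set p (fun q => In q S)) (Rbar_mult (Finite eps) (lfs C p)).
Proof.
intros He Hs Hd Hm.
assert (H1 : Rbar_le (dist_set p (fun q => In q S)) (Finite (edist p s))).
{ unfold dist_set; apply (proj1 (Glb_Rbar_correct _)); exists s; auto. }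
assert (H2 : Rbar_le (Finite r) (lfs C p)).
{ unfold lfs, dist_set; apply (proj2 (Glb_Rbar_correct _)).
  intros x [q [Hq ->]]; simpl; auto. }
apply Rbar_le_lt_trans with (1 := H1).
destruct (lfs C p) as [l| |]; simpl in H2; try contradiction.
- simpl; nra.
- unfold Rbar_mult, Rbar_mult'.
  destruct (Rle_dec 0 eps) as [h|h]; [|lra].
  destruct (Rle_lt_or_eq_dec 0 eps h); simpl; auto; lra.
Qed.

(** The medial axis negates unique existence, so it would also contain points without any closest
    point; proximinality removes that case. *)
Lemma not_medial (C : point -> Prop) m :
  proximinal C ->
  (forall x y, closest C m x -> closest C m y -> x = y) -> ~ medial_axis C m.
Proof.
intros H U M; apply M; destruct (H m) as [x Hx]; exists x; split; auto.
Qed.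

(** If [m] is nearer to [p] than a third of the gap [d], its closest points in [C] are within two
    thirds of [d] from [p], hence in [G]. Only the shape of [C] around [p] then matters. *)
Lemma lfs_pos_of_local_uniqueness (C G : point -> Prop) (p : point) (rho : R) :
  proximinal C -> C p ->
  (forall q, G q -> C q) ->
  separated (fun q => C q /\ ~ G q) p ->
  0 < rho ->
  (forall m, edist p m < rho -> forall x y,
     closest G m x -> closest G m y -> x = y) ->
  exists r, 0 < r /\ forall m, medial_axis C m -> r <= edist p m.
Proof.
intros HC Cp HG [d [Hd Hs]] Hrho HU.
exists (Rmin rho (d / 3)); split; [apply Rmin_pos; lra|].
intros m Mm; destruct (Rle_dec (Rmin rho (d / 3)) (edist p m)) as [h|h]; auto.
exfalso; apply Rnot_le_lt in h.
assert (h1 := Rlt_le_trans _ _ _ h (Rmin_l _ _)).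
assert (h2 := Rlt_le_trans _ _ _ h (Rmin_r _ _)).
assert (A : forall x, closest C m x -> closest G m x).
{ intros x [Cx Hx]; split.
  - apply NNPP; intros Gx.
    assert (B := Hs x (conj Cx Gx)).
    assert (T := edist_triangle p m x).
    assert (Hx' := Hx p Cp); rewrite (edist_sym m p) in Hx'; lra.
  - intros y Gy; auto. }
apply (not_medial C m HC); auto.
intros x y Hx Hy; apply (HU m h1); auto.
Qed.

(** * Simple arcs and closed curves *)

(** The parametrization is continuous on the whole line so that it can be composed with clamps; its
    values outside [0, 1] are arbitrary. *)
Definition is_arc (K : point -> Prop) (a b : point) : Prop :=
  exists g1 g2 : R -> R,
    (forall t, continuous g1 t) /\ (forall t, continuous g2 t) /\
    (g1 0, g2 0) = a /\ (g1 1, g2 1) = b /\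
    (forall s t, 0 <= s <= 1 -> 0 <= t <= 1 ->
       (g1 s, g2 s) = (g1 t, g2 t) -> s = t) /\
    (forall p, K p <-> exists t, 0 <= t <= 1 /\ p = (g1 t, g2 t)).

Lemma continuous_Rmin_comp (f g : R -> R) x :
  continuous f x -> continuous g x -> continuous (fun t => Rmin (f t) (g t)) x.
Proof.
intros Hf Hg.
apply continuous_ext with
  (fun t => / 2 * (plus (plus (f t) (g t)) (opp (Rabs (plus (f t) (opp (g t))))))).
- intros t; unfold plus, opp; simpl; unfold Rmin.
  destruct (Rle_dec (f t) (g t)) as [h|h].
  + rewrite Rabs_left1; lra.
  + rewrite Rabs_right; lra.
- apply (continuous_mult (fun _ => / 2)); [apply continuous_const|].
  apply (continuous_plus (V := R_NormedModule)).
  + apply (continuous_plus (V := R_NormedModule)); auto.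
  + apply (continuous_opp (V := R_NormedModule)), continuous_Rabs_comp.
    apply (continuous_plus (V := R_NormedModule)); auto.
    apply (continuous_opp (V := R_NormedModule)); auto.
Qed.

Lemma continuous_Rmax_comp (f g : R -> R) x :
  continuous f x -> continuous g x -> continuous (fun t => Rmax (f t) (g t)) x.
Proof.
intros Hf Hg.
apply continuous_ext with (fun t => opp (Rmin (opp (f t)) (opp (g t)))).
- intros t; unfold opp; simpl; rewrite <- Ropp_Rmax; lra.
- apply (continuous_opp (V := R_NormedModule)), continuous_Rmin_comp;
    apply (continuous_opp (V := R_NormedModule)); auto.
Qed.

Lemma continuous_affine a b x : continuous (fun t : R => a * t + b) x.
Proof.
apply (continuous_plus (V := R_NormedModule)); [|apply continuous_const].
apply (continuous_mult (fun _ => a)); [apply continuous_const|apply continuous_id].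
Qed.

Lemma continuous_lin2 a b e (f g : R -> R) x :
  continuous f x -> continuous g x -> continuous (fun t => a * f t + b * g t + e) x.
Proof.
intros Hf Hg.
apply (continuous_plus (V := R_NormedModule)); [|apply continuous_const].
apply (continuous_plus (V := R_NormedModule)).
- apply (continuous_mult (fun _ => a) f); auto; apply continuous_const.
- apply (continuous_mult (fun _ => b) g); auto; apply continuous_const.
Qed.

Lemma continuous_d2 (m : point) (g1 g2 : R -> R) x :
  continuous g1 x -> continuous g2 x ->
  continuous (fun t => d2 m (g1 t, g2 t)) x.
Proof.
intros H1 H2.
apply continuous_ext with
  (fun t => plus ((-1 * g1 t + 0 * g2 t + fst m) * (-1 * g1 t + 0 * g2 t + fst m))
                 ((-1 * g2 t + 0 * g2 t + snd m) * (-1 * g2 t + 0 * g2 t + snd m))).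
- intros t; unfold plus, d2; simpl; ring.
- apply (continuous_plus (V := R_NormedModule)).
  + apply (continuous_mult (fun t => -1 * g1 t + 0 * g2 t + fst m)
             (fun t => -1 * g1 t + 0 * g2 t + fst m)); apply continuous_lin2; auto.
  + apply (continuous_mult (fun t => -1 * g2 t + 0 * g2 t + snd m)
             (fun t => -1 * g2 t + 0 * g2 t + snd m)); apply continuous_lin2; auto.
Qed.

Lemma continuous_continuity (f : R -> R) :
  (forall t, continuous f t) -> continuity f.
Proof. intros H t; apply continuity_pt_filterlim, H. Qed.

Lemma continuous_epsilon (f : R -> R) x :
  continuous f x -> forall e, 0 < e ->
  exists d, 0 < d /\ forall y, Rabs (y - x) < d -> Rabs (f y - f x) < e.
Proof.
intros H e He.
destruct (H (fun y => Rabs (y - f x) < e)) as [d Hd].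
- exists (mkposreal e He); intros y Hy; exact Hy.
- exists d; split; [apply cond_pos|]; intros y Hy; apply Hd; exact Hy.
Qed.

Lemma image_proximinal (g1 g2 : R -> R) (K : point -> Prop) :
  (forall t, continuous g1 t) -> (forall t, continuous g2 t) ->
  (forall p, K p <-> exists t, 0 <= t <= 1 /\ p = (g1 t, g2 t)) -> proximinal K.
Proof.
intros C1 C2 HK m.
destruct (continuity_ab_min (fun t => d2 m (g1 t, g2 t)) 0 1) as [t [Ht It]].
- lra.
- intros c _; apply continuity_pt_filterlim, continuous_d2; auto.
- exists (g1 t, g2 t); split.
  + apply HK; eauto.
  + intros y Ky; apply HK in Ky; destruct Ky as [u [Iu ->]].
    apply edist_le, Ht; auto.
Qed.

Lemma arc_proximinal K a b : is_arc K a b -> proximinal K.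
Proof.
intros (g1 & g2 & C1 & C2 & _ & _ & _ & HK); apply (image_proximinal g1 g2); auto.
Qed.

Lemma closed_curve_proximinal K : closed_curve K -> proximinal K.
Proof.
intros (g1 & g2 & C1 & C2 & Per & _ & HK); apply (image_proximinal g1 g2); auto.
intros p; rewrite HK; split; intros [t [Ht ->]].
- exists t; split; [lra|auto].
- destruct (Req_dec t 1) as [->|h].
  + exists 0; split; [lra|].
    destruct (Per 0) as [E1 E2]; rewrite Rplus_0_l in E1, E2; congruence.
  + exists t; split; [lra|auto].
Qed.

Lemma arc_start K a b : is_arc K a b -> K a.
Proof.
intros (g1 & g2 & C1 & C2 & A & B & I & HK); apply HK; exists 0; split; [lra|auto].
Qed.

Lemma arc_end K a b : is_arc K a b -> K b.
Proof.
intros (g1 & g2 & C1 & C2 & A & B & I & HK); apply HK; exists 1; split; [lra|auto].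
Qed.

Lemma arc_rev K a b : is_arc K a b -> is_arc K b a.
Proof.
intros (g1 & g2 & C1 & C2 & A & B & I & HK).
exists (fun t => g1 (-1 * t + 1)), (fun t => g2 (-1 * t + 1)).
repeat split.
- intros t; apply (continuous_comp (fun t => -1 * t + 1) g1);
    [apply continuous_affine|apply C1].
- intros t; apply (continuous_comp (fun t => -1 * t + 1) g2);
    [apply continuous_affine|apply C2].
- replace (-1 * 0 + 1) with 1 by ring; auto.
- replace (-1 * 1 + 1) with 0 by ring; auto.
- intros s t Hs Ht E; assert (-1 * s + 1 = -1 * t + 1); [|lra].
  apply I; auto; lra.
- intros Kp; apply HK in Kp; destruct Kp as [t [Ht ->]].
  exists (1 - t); split; [lra|]; replace (-1 * (1 - t) + 1) with t by ring; auto.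
- intros [t [Ht ->]]; apply HK; exists (-1 * t + 1); split; [lra|auto].
Qed.

Lemma arc_concat K1 K2 a b c :
  is_arc K1 a b -> is_arc K2 b c -> (forall q, K1 q -> K2 q -> q = b) ->
  is_arc (fun q => K1 q \/ K2 q) a c.
Proof.
intros (f1 & f2 & C1 & C2 & A & B & I & HK) (g1 & g2 & C1' & C2' & A' & B' & I' & HK') D.
(* With both parameters clamped, the concatenation is a single formula, the sum of the two paths
   minus the common point [b], and is continuous without a case distinction. *)
set (u := fun t : R => Rmin (2 * t + 0) 1); set (v := fun t => Rmax (2 * t + - 1) 0).
assert (Cu : forall t, continuous u t).
{ intros t; apply continuous_Rmin_comp; [apply continuous_affine|apply continuous_const]. }
assert (Cv : forall t, continuous v t).
{ intros t; apply continuous_Rmax_comp; [apply continuous_affine|apply continuous_const]. }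
assert (Hb : (f1 1, f2 1) = (g1 0, g2 0)) by congruence.
injection Hb as Hb1 Hb2.
set (h1 := fun t => 1 * f1 (u t) + 1 * g1 (v t) + - f1 1).
set (h2 := fun t => 1 * f2 (u t) + 1 * g2 (v t) + - f2 1).
assert (L : forall t, t <= / 2 -> h1 t = f1 (2 * t) /\ h2 t = f2 (2 * t)).
{ intros t Ht; unfold h1, h2, u, v.
  rewrite Rmin_left, Rmax_right by lra; rewrite !Rplus_0_r, <- Hb1, <- Hb2; split; ring. }
assert (R' : forall t, / 2 <= t -> h1 t = g1 (2 * t - 1) /\ h2 t = g2 (2 * t - 1)).
{ intros t Ht; unfold h1, h2, u, v.
  rewrite Rmin_right, Rmax_left by lra; replace (2 * t - 1) with (2 * t + -1) by ring; split; ring. }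
assert (X : forall s t, 0 <= s <= / 2 -> / 2 < t <= 1 ->
              (h1 s, h2 s) = (h1 t, h2 t) -> False).
{ intros s t Hs Ht E.
  destruct (L s) as [E1 E2]; [lra|]; destruct (R' t) as [E3 E4]; [lra|].
  rewrite E1, E2, E3, E4 in E.
  assert (Eb : (f1 (2 * s), f2 (2 * s)) = b).
  { apply D; [apply HK; exists (2 * s); split; [lra|auto]|].
    rewrite E; apply HK'; exists (2 * t - 1); split; [lra|auto]. }
  assert (2 * t - 1 = 0); [|lra].
  apply I'; [lra|lra|]; congruence. }
exists h1, h2; repeat split.
- intros t; apply continuous_lin2; apply (continuous_comp _ _ t); auto.
- intros t; apply continuous_lin2; apply (continuous_comp _ _ t); auto.
- destruct (L 0) as [-> ->]; [lra|]; rewrite Rmult_0_r; auto.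
- destruct (R' 1) as [-> ->]; [lra|]; replace (2 * 1 - 1) with 1 by ring; auto.
- intros s t Hs Ht E.
  destruct (Rle_lt_dec s (/ 2)) as [h|h], (Rle_lt_dec t (/ 2)) as [h'|h'].
  + destruct (L s h) as [E1 E2], (L t h') as [E3 E4].
    rewrite E1, E2, E3, E4 in E; apply I in E; lra.
  + exfalso; apply (X s t); auto; lra.
  + exfalso; apply (X t s); auto; lra.
  + destruct (R' s) as [E1 E2]; [lra|]; destruct (R' t) as [E3 E4]; [lra|].
    rewrite E1, E2, E3, E4 in E; apply I' in E; lra.
- intros [Kp|Kp]; [apply HK in Kp|apply HK' in Kp]; destruct Kp as [t [Ht ->]].
  + exists (t / 2); split; [lra|].
    destruct (L (t / 2)) as [-> ->]; [lra|].
    replace (2 * (t / 2)) with t by field; auto.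
  + exists ((t + 1) / 2); split; [lra|].
    destruct (R' ((t + 1) / 2)) as [-> ->]; [lra|].
    replace (2 * ((t + 1) / 2) - 1) with t by field; auto.
- intros [t [Ht ->]]; destruct (Rle_lt_dec t (/ 2)) as [h|h].
  + left; apply HK; exists (2 * t); split; [lra|].
    destruct (L t h) as [-> ->]; auto.
  + right; apply HK'; exists (2 * t - 1); split; [lra|].
    destruct (R' t) as [-> ->]; [lra|auto].
Qed.

Definition periodize (h : R -> R) (t : R) : R := h (t - IZR (Int_part t)).

Lemma periodize_unit h t : 0 <= t < 1 -> periodize h t = h t.
Proof.
intros Ht; unfold periodize; rewrite <- (Int_part_spec t 0) by lra.
rewrite Rminus_0_r; auto.
Qed.

Lemma periodize_plus1 h t : periodize h (t + 1) = periodize h t.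
Proof.
unfold periodize; destruct (base_Int_part t) as [A B].
rewrite <- (Int_part_spec (t + 1) (Int_part t + 1)).
- rewrite plus_IZR; f_equal; ring.
- rewrite plus_IZR; lra.
Qed.

Lemma continuous_periodize h :
  (forall t, continuous h t) -> h 0 = h 1 -> forall t, continuous (periodize h) t.
Proof.
intros C E t.
set (n := Int_part t); destruct (base_Int_part t) as [A B]; fold n in A, B.
(* On |u - n| < 1 the periodization is a sum of two clamped copies of h. *)
apply continuous_ext_loc with
  (fun u => 1 * h (Rmax (1 * u + - IZR n) 0)
            + 1 * h (Rmin (1 * u + (1 - IZR n)) 1) + - h 0).
- assert (Hd : 0 < Rmin (t - IZR n + 1) (IZR n + 1 - t)) by (apply Rmin_pos; lra).
  exists (mkposreal _ Hd); intros u Hu; change (Rabs (u - t) < Rmin (t - IZR n + 1) (IZR n + 1 - t)) in Hu.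
  assert (H1 := Rlt_le_trans _ _ _ Hu (Rmin_l _ _)).
  assert (H2 := Rlt_le_trans _ _ _ Hu (Rmin_r _ _)).
  apply Rabs_def2 in H1; apply Rabs_def2 in H2.
  unfold periodize; destruct (Rle_lt_dec (IZR n) u) as [h1|h1].
  + rewrite <- (Int_part_spec u n) by lra.
    rewrite Rmax_left, Rmin_right by lra; rewrite <- E.
    replace (1 * u + - IZR n) with (u - IZR n) by ring.
    match goal with |- _ ?a ?b => change (@eq R a b) end; ring.
  + rewrite <- (Int_part_spec u (n - 1)) by (rewrite minus_IZR; lra).
    rewrite Rmax_right, Rmin_left by lra; rewrite minus_IZR.
    replace (1 * u + (1 - IZR n)) with (u - (IZR n - 1)) by ring.
    match goal with |- _ ?a ?b => change (@eq R a b) end; ring.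
- apply continuous_lin2.
  + apply (continuous_comp (fun u => Rmax (1 * u + - IZR n) 0) h); auto.
    apply continuous_Rmax_comp; [apply continuous_affine|apply continuous_const].
  + apply (continuous_comp (fun u => Rmin (1 * u + (1 - IZR n)) 1) h); auto.
    apply continuous_Rmin_comp; [apply continuous_affine|apply continuous_const].
Qed.

(** Besides closing the curve, the parametrization is arranged to run through [K1] during the first
    half period, the form in which [next_sample] asks for it. *)
Lemma close_arcs K1 K2 a b :
  is_arc K1 a b -> is_arc K2 b a ->
  (forall q, K1 q -> K2 q -> q = a \/ q = b) ->
  exists g1 g2, curve_param (fun q => K1 q \/ K2 q) g1 g2 /\
    (g1 0, g2 0) = a /\ (g1 (/ 2), g2 (/ 2)) = b /\
    forall u, 0 < u < / 2 ->
      K1 (g1 u, g2 u) /\ (g1 u, g2 u) <> a /\ (g1 u, g2 u) <> b.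
Proof.
intros (f1 & f2 & C1 & C2 & A & B & I & HK) (g1 & g2 & C1' & C2' & A' & B' & I' & HK') D.
set (u := fun t : R => Rmin (2 * t + 0) 1); set (v := fun t => Rmax (2 * t + - 1) 0).
assert (Cu : forall t, continuous u t).
{ intros t; apply continuous_Rmin_comp; [apply continuous_affine|apply continuous_const]. }
assert (Cv : forall t, continuous v t).
{ intros t; apply continuous_Rmax_comp; [apply continuous_affine|apply continuous_const]. }
assert (Hb : (f1 1, f2 1) = (g1 0, g2 0)) by congruence.
injection Hb as Hb1 Hb2.
set (h1 := fun t => 1 * f1 (u t) + 1 * g1 (v t) + - f1 1).
set (h2 := fun t => 1 * f2 (u t) + 1 * g2 (v t) + - f2 1).
assert (L : forall t, t <= / 2 -> h1 t = f1 (2 * t) /\ h2 t = f2 (2 * t)).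
{ intros t Ht; unfold h1, h2, u, v.
  rewrite Rmin_left, Rmax_right by lra; rewrite !Rplus_0_r, <- Hb1, <- Hb2; split; ring. }
assert (R' : forall t, / 2 <= t -> h1 t = g1 (2 * t - 1) /\ h2 t = g2 (2 * t - 1)).
{ intros t Ht; unfold h1, h2, u, v.
  rewrite Rmin_right, Rmax_left by lra; replace (2 * t - 1) with (2 * t + -1) by ring; split; ring. }
assert (Ch1 : forall t, continuous h1 t).
{ intros t; apply continuous_lin2; apply (continuous_comp _ _ t); auto. }
assert (Ch2 : forall t, continuous h2 t).
{ intros t; apply continuous_lin2; apply (continuous_comp _ _ t); auto. }
assert (Hh : (h1 0, h2 0) = (h1 1, h2 1)).
{ destruct (L 0) as [-> ->]; [lra|]; destruct (R' 1) as [-> ->]; [lra|].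
  replace (2 * 0) with 0 by ring; replace (2 * 1 - 1) with 1 by ring; congruence. }
injection Hh as Hh1 Hh2.
assert (X : forall s t, 0 <= s <= / 2 -> / 2 < t < 1 ->
              (h1 s, h2 s) = (h1 t, h2 t) -> False).
{ intros s t Hs Ht E.
  destruct (L s) as [E1 E2]; [lra|]; destruct (R' t) as [E3 E4]; [lra|].
  rewrite E1, E2, E3, E4 in E.
  destruct (D (f1 (2 * s), f2 (2 * s))) as [Eb|Eb].
  - apply HK; exists (2 * s); split; [lra|auto].
  - rewrite E; apply HK'; exists (2 * t - 1); split; [lra|auto].
  - assert (2 * t - 1 = 1); [|lra].
    apply I'; [lra|lra|]; congruence.
  - assert (2 * t - 1 = 0); [|lra].
    apply I'; [lra|lra|]; congruence. }
exists (periodize h1), (periodize h2).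
split; [|split; [|split]].
- split; [|split; [|split; [|split]]].
  + apply continuous_periodize; auto.
  + apply continuous_periodize; auto.
  + intros t; split; apply periodize_plus1.
  + intros s t Hs Ht; rewrite !periodize_unit by lra; intros E.
    destruct (Rle_lt_dec s (/ 2)) as [h|h], (Rle_lt_dec t (/ 2)) as [h'|h'].
    * destruct (L s h) as [E1 E2], (L t h') as [E3 E4].
      rewrite E1, E2, E3, E4 in E; apply I in E; lra.
    * exfalso; apply (X s t); auto; lra.
    * exfalso; apply (X t s); auto; lra.
    * destruct (R' s) as [E1 E2]; [lra|]; destruct (R' t) as [E3 E4]; [lra|].
      rewrite E1, E2, E3, E4 in E; apply I' in E; lra.
  + intros p; split.
    * intros [Kp|Kp]; [apply HK in Kp|apply HK' in Kp]; destruct Kp as [t [Ht ->]].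
      { exists (t / 2); split; [lra|]; rewrite !periodize_unit by lra.
        destruct (L (t / 2)) as [-> ->]; [lra|].
        replace (2 * (t / 2)) with t by field; auto. }
      { destruct (Req_dec t 1) as [->|n1].
        - exists 0; split; [lra|]; rewrite !periodize_unit by lra.
          destruct (L 0) as [-> ->]; [lra|]; rewrite Rmult_0_r; congruence.
        - exists ((t + 1) / 2); split; [lra|]; rewrite !periodize_unit by lra.
          destruct (R' ((t + 1) / 2)) as [-> ->]; [lra|].
          replace (2 * ((t + 1) / 2) - 1) with t by field; auto. }
    * intros [t [Ht ->]]; rewrite !periodize_unit by lra.
      destruct (Rle_lt_dec t (/ 2)) as [h|h].
      { left; apply HK; exists (2 * t); split; [lra|].
        destruct (L t h) as [-> ->]; auto. }
      { right; apply HK'; exists (2 * t - 1); split; [lra|].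
        destruct (R' t) as [-> ->]; [lra|auto]. }
- rewrite !periodize_unit by lra; destruct (L 0) as [-> ->]; [lra|].
  rewrite Rmult_0_r; auto.
- rewrite !periodize_unit by lra; destruct (L (/ 2)) as [-> ->]; [lra|].
  replace (2 * / 2) with 1 by field; auto.
- intros t Ht; rewrite !periodize_unit by lra; destruct (L t) as [-> ->]; [lra|].
  split; [|split].
  + apply HK; exists (2 * t); split; [lra|auto].
  + intros E; assert (2 * t = 0); [|lra]; apply I; [lra|lra|congruence].
  + intros E; assert (2 * t = 1); [|lra]; apply I; [lra|lra|congruence].
Qed.

Lemma closed_curve_ext K K' :
  (forall q, K q <-> K' q) -> closed_curve K -> closed_curve K'.
Proof.
intros E (g1 & g2 & A & B & P & I & H); exists g1, g2.
repeat (split; [assumption|]); intros p; rewrite <- E; auto.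
Qed.

Lemma arcs_closed_curve K1 K2 a b :
  is_arc K1 a b -> is_arc K2 b a ->
  (forall q, K1 q -> K2 q -> q = a \/ q = b) ->
  closed_curve (fun q => K1 q \/ K2 q).
Proof.
intros H1 H2 D; destruct (close_arcs K1 K2 a b H1 H2 D) as (g1 & g2 & H & _).
exists g1, g2; auto.
Qed.

(** Reduces an edge of the sample graph to cutting the component at [a] and [b] into two arcs, one
    of them free of other samples. *)
Lemma arcs_next_sample (cs : list (point -> Prop)) S K K1 K2 a b :
  In K cs -> (forall q, K q <-> K1 q \/ K2 q) ->
  is_arc K1 a b -> is_arc K2 b a ->
  (forall q, K1 q -> K2 q -> q = a \/ q = b) ->
  (forall q, K1 q -> In q S -> q = a \/ q = b) ->
  next_sample cs S a b.
Proof.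
intros HK E H1 H2 D HS.
destruct (close_arcs K1 K2 a b H1 H2 D) as (g1 & g2 & (A & B & P & I & H) & Ha & Hb & N).
exists K; split; [auto|]; split; [apply E; left; eapply arc_start; eauto|].
split; [apply E; left; eapply arc_end; eauto|].
exists g1, g2; split.
- repeat (split; [assumption|]); intros p; rewrite E; auto.
- exists 0, (/ 2); repeat split; auto; try lra.
  + rewrite Rplus_0_l; auto.
  + intros u Hu; rewrite Rplus_0_l; intros Hi.
    destruct (N u Hu) as (N1 & N2 & N3).
    destruct (HS _ N1 Hi); contradiction.
Qed.

(** * Affine isometries *)

Definition affine (F : point -> point) : Prop :=
  exists a b e a' b' e', forall q,
    F q = (a * fst q + b * snd q + e, a' * fst q + b' * snd q + e').

Lemma affine_comp F G : affine F -> affine G -> affine (fun q => F (G q)).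
Proof.
intros (a & b & e & a' & b' & e' & HF) (c & d & f & c' & d' & f' & HG).
exists (a * c + b * c'), (a * d + b * d'), (a * f + b * f' + e),
       (a' * c + b' * c'), (a' * d + b' * d'), (a' * f + b' * f' + e').
intros q; rewrite HF, HG; simpl; f_equal; ring.
Qed.

Lemma arc_map (F G : point -> point) K a b :
  affine F -> (forall q, G (F q) = q) -> (forall q, F (G q) = q) ->
  is_arc K a b -> is_arc (fun q => K (G q)) (F a) (F b).
Proof.
intros (c & d & e & c' & d' & e' & HF) GF FG (g1 & g2 & C1 & C2 & A & B & I & HK).
exists (fun t => c * g1 t + d * g2 t + e), (fun t => c' * g1 t + d' * g2 t + e').
assert (E : forall t, (c * g1 t + d * g2 t + e, c' * g1 t + d' * g2 t + e') = F (g1 t, g2 t)).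
{ intros t; rewrite HF; reflexivity. }
repeat split.
- intros t; apply continuous_lin2; auto.
- intros t; apply continuous_lin2; auto.
- rewrite E, A; auto.
- rewrite E, B; auto.
- intros s t Hs Ht; rewrite !E; intros H; apply I; auto.
  rewrite <- (GF (g1 s, g2 s)), H, GF; auto.
- intros Kp; apply HK in Kp; destruct Kp as [t [Ht Hp]]; exists t; split; auto.
  rewrite E, <- Hp; auto.
- intros [t [Ht ->]]; rewrite E, GF; apply HK; eauto.
Qed.

(** * Segments and minor circular arcs *)

Lemma closest_d2 K m x :
  closest K m x <-> K x /\ forall y, K y -> d2 m x <= d2 m y.
Proof.
split; intros [Kx H]; split; auto; intros y Ky; apply edist_le; auto.
Qed.

Definition seg (A B q : point) : Prop :=
  exists t, 0 <= t <= 1 /\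
    q = (fst A + t * (fst B - fst A), snd A + t * (snd B - snd A)).

(* Arc of the circle of centre O from A to B: the points of the circle in the
   convex cone spanned by A - O and B - O. *)
Definition marc (O A B q : point) : Prop :=
  d2 O q = d2 O A /\
  exists l n, 0 <= l /\ 0 <= n /\
    q = (fst O + l * (fst A - fst O) + n * (fst B - fst O),
         snd O + l * (snd A - snd O) + n * (snd B - snd O)).

Definition cross (O A B : point) : R :=
  (fst A - fst O) * (snd B - snd O) - (snd A - snd O) * (fst B - fst O).

(* R times the inner product of O - m with the counterclockwise unit tangent
   at J of the circle of centre O through J (R its radius). *)
Definition tang (O J m : point) : R :=
  (fst J - fst O) * (snd O - snd m) - (snd J - snd O) * (fst O - fst m).

Lemma seg_arc A B : A <> B -> is_arc (seg A B) A B.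
Proof.
destruct A as [a1 a2], B as [b1 b2]; intros N.
exists (fun t => (b1 - a1) * t + a1), (fun t => (b2 - a2) * t + a2).
repeat split; try (intros t; apply continuous_affine).
- f_equal; ring.
- f_equal; ring.
- intros s t _ _ E; injection E as E1 E2.
  destruct (Req_dec s t) as [h|h]; auto; exfalso; apply N.
  f_equal.
  + apply Rmult_eq_reg_l with (s - t); [|lra]; lra.
  + apply Rmult_eq_reg_l with (s - t); [|lra]; lra.
- intros [t [Ht ->]]; exists t; split; auto; simpl; f_equal; ring.
- intros [t [Ht ->]]; exists t; split; auto; simpl; f_equal; ring.
Qed.

Lemma continuous_sqrt_comp (f : R -> R) x :
  continuous f x -> continuous (fun t => sqrt (f t)) x.
Proof. intros H; apply (continuous_comp f sqrt); auto; apply continuous_sqrt. Qed.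

(** The chord from [A] to [B] is pushed radially onto the circle. It avoids the centre because
    [cross] does not vanish, and for the same reason distinct points of the chord lie on distinct
    rays from the centre. *)
Lemma marc_arc O A B : d2 O A = d2 O B -> cross O A B <> 0 -> is_arc (marc O A B) A B.
Proof.
destruct O as [o1 o2], A as [a1 a2], B as [b1 b2]; unfold cross, d2; simpl.
intros ER Ncr.
set (u1 := a1 - o1) in *; set (u2 := a2 - o2) in *.
set (w1 := b1 - o1) in *; set (w2 := b2 - o2) in *.
set (P := u1 * u1 + u2 * u2).
assert (EP : w1 * w1 + w2 * w2 = P) by (unfold P, u1, u2, w1, w2 in *; lra).
set (n1 := fun t => (w1 - u1) * t + u1); set (n2 := fun t => (w2 - u2) * t + u2).
set (Q := fun t => n1 t * n1 t + n2 t * n2 t).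
assert (HP : 0 < P).
{ unfold P; destruct (Req_dec u1 0) as [h|h]; [|nra].
  destruct (Req_dec u2 0) as [h'|h']; [|nra].
  exfalso; apply Ncr; rewrite h, h'; ring. }
assert (HQ : forall t, 0 < Q t).
{ intros t; unfold Q.
  destruct (Req_dec (n1 t) 0) as [h|h]; [|nra].
  destruct (Req_dec (n2 t) 0) as [h'|h']; [|nra].
  exfalso; apply Ncr.
  assert (h1 : n1 t * w2 - n2 t * w1 = 0) by (rewrite h, h'; ring).
  assert (h2 : u1 * n2 t - u2 * n1 t = 0) by (rewrite h, h'; ring).
  unfold n1, n2 in h1, h2; nra. }
set (k := fun t => sqrt P * / sqrt (Q t)).
assert (Ck : forall t, continuous k t).
{ intros t; apply (continuous_mult (fun _ => sqrt P) (fun t => / sqrt (Q t)));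
    [apply continuous_const|].
  apply continuous_Rinv_comp.
  - apply continuous_sqrt_comp.
    apply (continuous_plus (V := R_NormedModule) (fun t => n1 t * n1 t) (fun t => n2 t * n2 t)).
    + apply (continuous_mult n1 n1); apply continuous_affine.
    + apply (continuous_mult n2 n2); apply continuous_affine.
  - apply Rgt_not_eq, sqrt_lt_R0, HQ. }
assert (Hk : forall t, 0 < k t).
{ intros t; apply Rmult_lt_0_compat; [|apply Rinv_0_lt_compat]; apply sqrt_lt_R0; auto. }
assert (Hk2 : forall t, k t * k t * Q t = P).
{ intros t; unfold k.
  assert (A1 := sqrt_sqrt P (Rlt_le _ _ HP)); assert (A2 := sqrt_sqrt (Q t) (Rlt_le _ _ (HQ t))).
  assert (A3 : sqrt (Q t) <> 0) by apply Rgt_not_eq, sqrt_lt_R0, HQ.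
  rewrite <- A2 at 3; rewrite <- A1 at 3; field; auto. }
assert (K1 : forall t, Q t = P -> k t = 1).
{ intros t Ht; unfold k; rewrite Ht; apply Rinv_r, Rgt_not_eq, sqrt_lt_R0, HP. }
exists (fun t => o1 + k t * n1 t), (fun t => o2 + k t * n2 t).
split; [|split; [|split; [|split; [|split]]]].
- intros t; apply (continuous_plus (V := R_NormedModule) (fun _ => o1) (fun t => k t * n1 t));
    [apply continuous_const|apply (continuous_mult k n1); auto; apply continuous_affine].
- intros t; apply (continuous_plus (V := R_NormedModule) (fun _ => o2) (fun t => k t * n2 t));
    [apply continuous_const|apply (continuous_mult k n2); auto; apply continuous_affine].
- rewrite K1; [|unfold Q, n1, n2, P; ring].
  unfold n1, n2, u1, u2; f_equal; ring.
- rewrite K1; [|rewrite <- EP; unfold Q, n1, n2; ring].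
  unfold n1, n2, w1, w2, u1, u2; f_equal; ring.
- intros s t _ _ E; injection E as E1 E2.
  assert (C : k s * k t * ((t - s) * (u1 * w2 - u2 * w1)) = 0).
  { replace (k s * k t * ((t - s) * (u1 * w2 - u2 * w1)))
      with ((k s * n1 s) * (k t * n2 t) - (k s * n2 s) * (k t * n1 t))
      by (unfold n1, n2; ring).
    replace (k s * n1 s) with (k t * n1 t) by lra.
    replace (k s * n2 s) with (k t * n2 t) by lra; ring. }
  assert (Hs := Hk s); assert (Ht := Hk t).
  apply Rmult_integral in C; destruct C as [C|C]; [nra|].
  apply Rmult_integral in C; destruct C as [C|C]; [lra|contradiction].
- intros p; split.
  + intros [E (l & n & Hl & Hn & ->)]; unfold d2 in E; simpl in E; fold u1 u2 w1 w2 in E.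
    assert (E' : (l * u1 + n * w1) * (l * u1 + n * w1)
                 + (l * u2 + n * w2) * (l * u2 + n * w2) = P).
    { replace ((o1 - (o1 + l * u1 + n * w1)) * ((o1 - (o1 + l * u1 + n * w1)) * 1) +
       (o2 - (o2 + l * u2 + n * w2)) * ((o2 - (o2 + l * u2 + n * w2)) * 1))
       with ((l * u1 + n * w1) * (l * u1 + n * w1)
                 + (l * u2 + n * w2) * (l * u2 + n * w2)) in E by ring.
      rewrite E; unfold P, u1, u2; ring. }
    assert (Hs : 0 < l + n).
    { destruct (Req_dec (l + n) 0) as [h|h]; [|lra].
      assert (l = 0) by lra; assert (n = 0) by lra; subst; lra. }
    (* The ray through the point with cone coordinates [l], [n] meets the chord at this parameter,
       and the radial factor there is [l + n]. *)
    exists (n / (l + n)); split.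
    * split; [apply Rdiv_le_0_compat; lra|].
      apply Rmult_le_reg_r with (l + n); auto; unfold Rdiv.
      rewrite Rmult_assoc, Rinv_l by lra; lra.
    * assert (N1 : n1 (n / (l + n)) = (l * u1 + n * w1) / (l + n))
        by (unfold n1; field; lra).
      assert (N2 : n2 (n / (l + n)) = (l * u2 + n * w2) / (l + n))
        by (unfold n2; field; lra).
      assert (KK : k (n / (l + n)) = l + n).
      { assert (B1 := Hk2 (n / (l + n))); assert (B2 := Hk (n / (l + n))).
        unfold Q in B1; rewrite N1, N2 in B1.
        set (kk := k (n / (l + n))) in *.
        assert (B3 : kk * kk * P = (l + n) * (l + n) * P).
        { rewrite <- B1 at 2; rewrite <- E' at 1; field; lra. }
        apply Rmult_eq_reg_r in B3; [|lra].
        assert (B4 : (kk - (l + n)) * (kk + (l + n)) = 0) by lra.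
        apply Rmult_integral in B4; destruct B4; lra. }
      rewrite KK, N1, N2; simpl; unfold u1, u2, w1, w2; f_equal; field; lra.
  + intros [t [Ht ->]]; split.
    * assert (B1 := Hk2 t); unfold d2; simpl; fold u1 u2.
      unfold Q in B1; fold P; unfold P, u1, u2 in *; nra.
    * exists (k t * (1 - t)), (k t * t); assert (B2 := Hk t).
      split; [nra|]; split; [nra|].
      simpl; unfold n1, n2, u1, u2, w1, w2; f_equal; ring.
Qed.

(** Read [P] as the squared norm of two vectors u, w of equal length, [K] as their inner product,
    and let q = l u + n w lie on the same circle. The conclusions then say that q.w is at least u.w
    and that q.u is at most [P], strictly when q differs from u. *)
Lemma cone_coefficients P K l n :
  0 < P -> - P < K < P -> 0 <= l -> 0 <= n ->
  P * (l * l + n * n) + 2 * K * l * n = P ->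
  0 <= K * (l - 1) + n * P /\ 0 <= P * (1 - l) - n * K /\
  (n <> 0 -> 0 < P * (1 - l) - n * K).
Proof.
intros HP HK Hl Hn E.
assert (E2 : (P * l + n * K) * (P * l + n * K) + n * n * ((P - K) * (P + K)) = P * P) by nra.
assert (A : P * l + n * K <= P).
{ apply Rnot_lt_le; intros h.
  assert (0 <= n * n * ((P - K) * (P + K))) by (apply Rmult_le_pos; nra). nra. }
split; [|split].
- apply Rnot_lt_le; intros h.
  assert (E3 : (n * P + K * l) * (n * P + K * l) + l * l * ((P - K) * (P + K)) = P * P) by nra.
  destruct (Rle_lt_dec 0 K) as [h0|h0].
  + assert (n * P < K * (1 - l)) by lra.
    assert (l < 1) by nra.
    assert (0 <= n * P + K * l) by nra.
    assert ((n * P + K * l) * (n * P + K * l) <= K * K) by nra.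
    assert (l * l * ((P - K) * (P + K)) < (P - K) * (P + K)); [|nra].
    assert (0 < (P - K) * (P + K)) by nra.
    assert (l * l < 1) by nra. nra.
  + assert (n * P + K * l < K) by lra.
    assert (1 < l) by nra.
    assert (K * K < (n * P + K * l) * (n * P + K * l)) by nra.
    assert (0 < (P - K) * (P + K)) by nra.
    assert (1 < l * l) by nra. nra.
- lra.
- intros Nn; destruct (Rle_lt_or_eq_dec _ _ A) as [h|h]; [lra|exfalso].
  rewrite h in E2.
  assert (0 < n * n) by nra.
  assert (0 < n * n * ((P - K) * (P + K))) by (apply Rmult_lt_0_compat; nra). lra.
Qed.

Lemma marc_sym O A B q : d2 O A = d2 O B -> marc O A B q -> marc O B A q.
Proof.
intros E [H (l & n & Hl & Hn & ->)]; split; [congruence|].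
exists n, l; repeat split; auto; f_equal; ring.
Qed.

(** Up to the sign of [cross], [tang] is the derivative of the squared distance to [m] along the
    arc. Its signs at the two ends decide everything, because the vector from [A] to [q] is a
    combination of the two end tangents, with nonnegative coefficients by [cone_coefficients]. *)
Lemma marc_forward O A B m q :
  d2 O A = d2 O B -> cross O A B <> 0 ->
  0 <= cross O A B * tang O A m -> 0 < cross O A B * tang O B m ->
  marc O A B q -> q <> A -> d2 m A < d2 m q.
Proof.
destruct O as [o1 o2], A as [a1 a2], B as [b1 b2], m as [m1 m2].
unfold cross, tang, d2, marc, d2; simpl.
intros ER Ncr G1 G2 [E (l & n & Hl & Hn & ->)] Nq; simpl in *.
set (u1 := a1 - o1) in *; set (u2 := a2 - o2) in *.
set (w1 := b1 - o1) in *; set (w2 := b2 - o2) in *.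
set (v1 := o1 - m1) in *; set (v2 := o2 - m2) in *.
set (P := u1 * u1 + u2 * u2); set (K := u1 * w1 + u2 * w2).
set (cr := u1 * w2 - u2 * w1) in *.
assert (EP : w1 * w1 + w2 * w2 = P) by (unfold P, u1, u2, w1, w2; lra).
assert (D : (P - K) * (P + K) = cr * cr).
{ replace ((P - K) * (P + K)) with (P * P - K * K) by ring.
  rewrite <- EP at 2; unfold P, K, cr; ring. }
assert (Hcr : 0 < cr * cr) by nra.
assert (HP : 0 < P).
{ assert (0 <= P) by (unfold P; nra).
  destruct (Req_dec P 0); [exfalso|lra].
  assert (u1 = 0) by (unfold P in *; nra); assert (u2 = 0) by (unfold P in *; nra).
  apply Ncr; unfold cr; rewrite H1, H2; ring. }
assert (HK : - P < K < P) by (split; nra).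
assert (EN : P * (l * l + n * n) + 2 * K * l * n = P).
{ transitivity ((l * u1 + n * w1) * (l * u1 + n * w1) + (l * u2 + n * w2) * (l * u2 + n * w2)).
  - replace (P * (l * l + n * n)) with (P * (l * l) + P * (n * n)) by ring.
    rewrite <- EP at 2; unfold P, K; ring.
  - transitivity ((o1 - (o1 + l * u1 + n * w1)) * ((o1 - (o1 + l * u1 + n * w1)) * 1) +
       (o2 - (o2 + l * u2 + n * w2)) * ((o2 - (o2 + l * u2 + n * w2)) * 1)); [ring|].
    rewrite E; unfold P, u1, u2; ring. }
destruct (cone_coefficients P K l n HP HK Hl Hn EN) as (B1 & B2 & B3).
assert (Nn : n <> 0).
{ intros h; subst n.
  assert (h1 : (l - 1) * (l + 1) = 0) by nra.
  apply Rmult_integral in h1; destruct h1 as [h1|h1]; [|lra].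
  assert (l = 1) by lra; subst l.
  apply Nq; unfold u1, u2, w1, w2; f_equal; ring. }
specialize (B3 Nn).
set (g1 := cr * (u1 * v2 - u2 * v1)) in *; set (g2 := cr * (w1 * v2 - w2 * v1)) in *.
assert (H : cr * cr * ((l - 1) * (u1 * v1 + u2 * v2) + n * (w1 * v1 + w2 * v2))
            = g1 * (K * (l - 1) + n * P) + g2 * (P * (1 - l) - n * K)).
{ transitivity ((K * g1 - P * g2) * (l - 1) + (P * g1 - K * g2) * n); [|ring].
  assert (I1 : K * g1 - P * g2 = cr * cr * (u1 * v1 + u2 * v2)).
  { unfold g1, g2, K, P, cr; ring. }
  assert (I2 : P * g1 - K * g2 = cr * cr * (w1 * v1 + w2 * v2)).
  { rewrite <- EP; unfold g1, g2, K, cr; ring. }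
  rewrite I1, I2; ring. }
assert (Hpos : 0 < (l - 1) * (u1 * v1 + u2 * v2) + n * (w1 * v1 + w2 * v2)).
{ assert (0 < g1 * (K * (l - 1) + n * P) + g2 * (P * (1 - l) - n * K)) by nra.
  rewrite <- H in H0; nra. }
assert (EQ : (l * u1 + n * w1) * (l * u1 + n * w1) + (l * u2 + n * w2) * (l * u2 + n * w2) = P).
{ transitivity (P * (l * l + n * n) + 2 * K * l * n); [|exact EN].
  replace (P * (l * l + n * n)) with (P * (l * l) + P * (n * n)) by ring.
  rewrite <- EP at 2; unfold P, K; ring. }
replace (m1 - a1) with (- v1 - u1) by (unfold v1, u1; ring).
replace (m2 - a2) with (- v2 - u2) by (unfold v2, u2; ring).
replace (m1 - (o1 + l * u1 + n * w1)) with (- v1 - (l * u1 + n * w1)) by (unfold v1; ring).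
replace (m2 - (o2 + l * u2 + n * w2)) with (- v2 - (l * u2 + n * w2)) by (unfold v2; ring).
unfold P in EQ; nra.
Qed.

Lemma cross_swap O A B : cross O B A = - cross O A B.
Proof. unfold cross; ring. Qed.

Lemma marc_backward O A B m q :
  d2 O A = d2 O B -> cross O A B <> 0 ->
  cross O A B * tang O B m <= 0 -> cross O A B * tang O A m < 0 ->
  marc O A B q -> q <> B -> d2 m B < d2 m q.
Proof.
intros E N G1 G2 H Nq; apply marc_forward with O A; auto; try (rewrite (cross_swap O A B); lra).
apply marc_sym; auto.
Qed.

Definition inner (O z m : point) : R :=
  (fst z - fst O) * (fst m - fst O) + (snd z - snd O) * (snd m - snd O).

Lemma d2_inner O q m : d2 m q = d2 O q + d2 O m - 2 * inner O q m.
Proof. unfold d2, inner; ring. Qed.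

(* If two distinct points of the arc were closest to m, the midpoint of the
   arc between them would be closer. *)
Lemma marc_closest_unique O A B m z x y :
  d2 O A = d2 O B -> cross O A B <> 0 ->
  marc O A B z -> 0 < inner O z m ->
  closest (marc O A B) m x -> closest (marc O A B) m y -> x = y.
Proof.
intros ER Ncr Mz Hz Hx Hy; apply closest_d2 in Hx, Hy.
destruct Hx as [Mx Hx], Hy as [My Hy].
apply NNPP; intros Nxy.
destruct Mx as [Ex (l & n & Hl & Hn & Dx)], My as [Ey (l' & n' & Hl' & Hn' & Dy)].
assert (Iz := Hx z Mz); rewrite (d2_inner O x m), (d2_inner O z m) in Iz.
assert (Ez := proj1 Mz).
assert (Ixy : inner O x m = inner O y m).
{ assert (I1 := Hx y (conj Ey (ex_intro _ l' (ex_intro _ n' (conj Hl' (conj Hn' Dy)))))).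
  assert (I2 := Hy x (conj Ex (ex_intro _ l (ex_intro _ n (conj Hl (conj Hn Dx)))))).
  rewrite (d2_inner O x m), (d2_inner O y m) in I1, I2; lra. }
assert (HI : 0 < inner O x m) by lra.
assert (Dxy : 0 < d2 x y).
{ assert (H := d2_ge0 x y); destruct (Req_dec (d2 x y) 0) as [h|h]; [|lra].
  apply d2_eq0 in h; contradiction. }
set (s1 := (fst x - fst O) + (fst y - fst O)); set (s2 := (snd x - snd O) + (snd y - snd O)).
set (Q := s1 * s1 + s2 * s2).
assert (EQ : Q = 4 * d2 O A - d2 x y).
{ rewrite <- Ex at 1; assert (H : d2 O y = d2 O x) by congruence.
  unfold Q, s1, s2; unfold d2 in H |- *; nra. }
assert (HQ : 0 < Q).
{ assert (0 <= Q) by (unfold Q; nra).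
  destruct (Req_dec Q 0) as [h|h]; [exfalso|lra].
  assert (S1 : s1 = 0) by (unfold Q in *; nra); assert (S2 : s2 = 0) by (unfold Q in *; nra).
  unfold s1, s2 in S1, S2; rewrite Dx, Dy in S1, S2; simpl in S1, S2.
  assert (T1 : (l + l') * (fst A - fst O) + (n + n') * (fst B - fst O) = 0) by lra.
  assert (T2 : (l + l') * (snd A - snd O) + (n + n') * (snd B - snd O) = 0) by lra.
  assert (C1 : (l + l') * cross O A B = 0).
  { transitivity (((l + l') * (fst A - fst O) + (n + n') * (fst B - fst O)) * (snd B - snd O)
      - ((l + l') * (snd A - snd O) + (n + n') * (snd B - snd O)) * (fst B - fst O));
      [unfold cross; ring|rewrite T1, T2; ring]. }
  assert (C2 : (n + n') * cross O A B = 0).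
  { transitivity (((l + l') * (snd A - snd O) + (n + n') * (snd B - snd O)) * (fst A - fst O)
      - ((l + l') * (fst A - fst O) + (n + n') * (fst B - fst O)) * (snd A - snd O));
      [unfold cross; ring|rewrite T1, T2; ring]. }
  apply Rmult_integral in C1; destruct C1 as [C1|C1]; [|contradiction].
  apply Rmult_integral in C2; destruct C2 as [C2|C2]; [|contradiction].
  assert (l = 0) by lra; assert (n = 0) by lra; subst l n.
  rewrite Dx in HI; unfold inner in HI; simpl in HI; nra. }
assert (HA : 0 < d2 O A) by lra.
set (k := sqrt (d2 O A) / sqrt Q).
assert (SA := sqrt_lt_R0 _ HA); assert (SQ := sqrt_lt_R0 _ HQ).
assert (Hk : 0 < k) by (apply Rdiv_lt_0_compat; auto).
assert (Hk2 : k * k * Q = d2 O A).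
{ unfold k; assert (A1 := sqrt_sqrt _ (Rlt_le _ _ HA)); assert (A2 := sqrt_sqrt _ (Rlt_le _ _ HQ)).
  rewrite <- A2 at 3; rewrite <- A1 at 3; field; lra. }
(* The sum of two distinct radius vectors is shorter than the diameter, so bringing it back to the
   circle takes a factor above 1/2; this excess makes the midpoint of the arc strictly closer. *)
assert (Hk3 : / 2 < k).
{ apply Rnot_le_lt; intros h; assert (k * k <= / 4) by nra; nra. }
set (w := (fst O + k * s1, snd O + k * s2)).
assert (Mw : marc O A B w).
{ split.
  - rewrite <- Hk2; unfold Q, w, d2; simpl; ring.
  - exists (k * (l + l')), (k * (n + n')); split; [nra|]; split; [nra|].
    unfold w, s1, s2; rewrite Dx, Dy; simpl; f_equal; ring. }
assert (Iw := Hx w Mw); rewrite (d2_inner O x m), (d2_inner O w m) in Iw.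
assert (Ew := proj1 Mw).
assert (Iw2 : inner O w m = k * (inner O x m + inner O y m)).
{ unfold w, inner, s1, s2; simpl; ring. }
nra.
Qed.

Lemma marc_start O A B : marc O A B A.
Proof.
split; auto; exists 1, 0; repeat split; try lra.
destruct A; simpl; f_equal; ring.
Qed.

Lemma marc_end O A B : d2 O A = d2 O B -> marc O A B B.
Proof.
intros E; split; auto; exists 0, 1; repeat split; try lra.
destruct B; simpl; f_equal; ring.
Qed.

(** The two signs put [m] strictly inside the cone of the arc at [O]. Its inner product with the sum
    of the two end radii is then positive, hence also that with one of them, as
    [marc_closest_unique] requires. *)
Lemma marc_unique_between O A B m x y :
  d2 O A = d2 O B -> cross O A B <> 0 ->
  cross O A B * tang O A m < 0 -> 0 < cross O A B * tang O B m ->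
  closest (marc O A B) m x -> closest (marc O A B) m y -> x = y.
Proof.
intros ER Ncr G1 G2 Hx Hy.
assert (H : 0 < inner O A m \/ 0 < inner O B m).
{ apply NNPP; intros h; apply not_or_and in h; destruct h as [h1 h2].
  apply Rnot_lt_le in h1, h2.
  clear Hx Hy; destruct O as [o1 o2], A as [a1 a2], B as [b1 b2], m as [m1 m2].
  unfold cross, tang, inner, d2 in *; simpl in *.
  set (u1 := a1 - o1) in *; set (u2 := a2 - o2) in *.
  set (w1 := b1 - o1) in *; set (w2 := b2 - o2) in *.
  replace (o1 - m1) with (- (m1 - o1)) in * by ring.
  replace (o2 - m2) with (- (m2 - o2)) in * by ring.
  set (v1 := m1 - o1) in *; set (v2 := m2 - o2) in *.
  set (P := u1 * u1 + u2 * u2); set (K := u1 * w1 + u2 * w2).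
  set (cr := u1 * w2 - u2 * w1) in *.
  assert (EP : w1 * w1 + w2 * w2 = P) by (unfold P, u1, u2, w1, w2; lra).
  assert (D : (P - K) * (P + K) = cr * cr).
  { replace ((P - K) * (P + K)) with (P * P - K * K) by ring.
    rewrite <- EP at 2; unfold P, K, cr; ring. }
  assert (Hcr : 0 < cr * cr) by nra.
  assert (HP : 0 <= P) by (unfold P; nra).
  set (g1 := cr * (u1 * - v2 - u2 * - v1)) in *; set (g2 := cr * (w1 * - v2 - w2 * - v1)) in *.
  assert (I1 : K * g1 - P * g2 = - (cr * cr * (u1 * v1 + u2 * v2))) by (unfold g1, g2, K, P, cr; ring).
  assert (I2 : P * g1 - K * g2 = - (cr * cr * (w1 * v1 + w2 * v2))).
  { rewrite <- EP; unfold g1, g2, K, cr; ring. }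
  assert (J1 : 0 <= K * g1 - P * g2) by (rewrite I1; nra).
  assert (J2 : 0 <= P * g1 - K * g2) by (rewrite I2; nra).
  assert (- P < K < P) by (split; nra).
  nra. }
destruct H as [H|H].
- apply (marc_closest_unique O A B m A); auto; apply marc_start.
- apply (marc_closest_unique O A B m B); auto; apply marc_end; auto.
Qed.

Lemma seg_forward A B m q :
  0 <= (fst A - fst m) * (fst B - fst A) + (snd A - snd m) * (snd B - snd A) ->
  seg A B q -> q <> A -> d2 m A < d2 m q.
Proof.
destruct A as [a1 a2], B as [b1 b2], m as [m1 m2]; unfold seg, d2; simpl.
intros G [t [Ht ->]] N; simpl.
set (u := b1 - a1) in *; set (v := b2 - a2) in *.
assert (Nt : 0 < t).
{ destruct (Req_dec t 0) as [->|h]; [|lra]; exfalso; apply N; f_equal; ring. }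
assert (Nuv : 0 < u * u + v * v).
{ destruct (Req_dec u 0) as [h|h]; [|nra]; destruct (Req_dec v 0) as [h'|h']; [|nra].
  exfalso; apply N; rewrite h, h'; f_equal; ring. }
replace ((m1 - (a1 + t * u)) * ((m1 - (a1 + t * u)) * 1) + (m2 - (a2 + t * v)) * ((m2 - (a2 + t * v)) * 1))
  with ((m1 - a1) * ((m1 - a1) * 1) + (m2 - a2) * ((m2 - a2) * 1)
        + 2 * t * ((a1 - m1) * u + (a2 - m2) * v) + t * t * (u * u + v * v)) by ring.
assert (0 < t * t * (u * u + v * v)) by (apply Rmult_lt_0_compat; nra). nra.
Qed.

Lemma seg_sym A B q : seg A B q -> seg B A q.
Proof.
intros [t [Ht ->]]; exists (1 - t); split; [lra|]; f_equal; ring.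
Qed.

Lemma seg_backward A B m q :
  (fst B - fst m) * (fst B - fst A) + (snd B - snd m) * (snd B - snd A) <= 0 ->
  seg A B q -> q <> B -> d2 m B < d2 m q.
Proof.
intros G H N; apply seg_forward with A; auto; [|apply seg_sym; auto].
simpl; lra.
Qed.

(** By the parallelogram law the midpoint of two distinct closest points would be closer. *)
Lemma seg_closest_unique A B m x y :
  closest (seg A B) m x -> closest (seg A B) m y -> x = y.
Proof.
intros Hx Hy; apply closest_d2 in Hx, Hy; destruct Hx as [Sx Hx], Hy as [Sy Hy].
assert (E := Rle_antisym _ _ (Hx y Sy) (Hy x Sx)).
apply d2_eq0.
set (z := ((fst x + fst y) / 2, (snd x + snd y) / 2)).
assert (Sz : seg A B z).
{ destruct Sx as [t [Ht ->]], Sy as [u [Hu ->]]; exists ((t + u) / 2); split; [lra|].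
  unfold z; simpl; f_equal; field. }
assert (H := Hx z Sz).
assert (F : 4 * d2 m z = 2 * d2 m x + 2 * d2 m y - d2 x y).
{ unfold z, d2; simpl; field. }
assert (G := d2_ge0 x y); lra.
Qed.

(** * The half strand *)

Definition c8 : R := cos (PI / 8).
Definition s8 : R := sin (PI / 8).

Lemma c8s8_unit : c8 * c8 + s8 * s8 = 1.
Proof. assert (H := sin2_cos2 (PI / 8)); unfold Rsqr in H; unfold c8, s8; lra. Qed.

Lemma c8s8_diag : c8 * c8 - s8 * s8 = 2 * s8 * c8.
Proof.
unfold c8, s8; rewrite <- cos_2a, <- sin_2a.
replace (2 * (PI / 8)) with (PI / 4) by field; rewrite sin_cos_PI4; auto.
Qed.

(** The square q of [c8] satisfies (q - 1/2)^2 = 1/8, because cosine and sine agree at PI/4. This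
    precision suffices for all numerical estimates on the cores. *)
Lemma c8_bounds : 92387 / 100000 < c8 < 92388 / 100000.
Proof.
assert (H1 := c8s8_unit); assert (H2 := c8s8_diag); assert (HP := PI_RGT_0).
assert (Hc : 0 < c8) by (apply cos_gt_0; lra).
assert (Hs : 0 < s8) by (apply sin_gt_0; lra).
assert (E : 8 * (c8 * c8) * (c8 * c8) - 8 * (c8 * c8) + 1 = 0).
{ assert ((2 * (c8 * c8) - 1) * (2 * (c8 * c8) - 1) = / 2); [|lra].
  assert (c8 * c8 - s8 * s8 = 2 * (c8 * c8) - 1) by lra.
  rewrite <- H.
  assert ((c8 * c8 - s8 * s8) * (c8 * c8 - s8 * s8) + (2 * s8 * c8) * (2 * s8 * c8) = 1); [|rewrite <- H2 in H0; lra].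
  replace 1 with ((c8 * c8 + s8 * s8) * (c8 * c8 + s8 * s8)) by (rewrite H1; ring); ring. }
assert (Hcs : s8 < c8).
{ assert (0 < (c8 - s8) * (c8 + s8)) by nra; nra. }
assert (Hq : / 2 < c8 * c8) by nra.
set (q := c8 * c8) in *.
assert (EQ : (q - / 2) * (q - / 2) = / 8) by lra.
assert (L1 : 853536 / 1000000 < q) by (apply Rnot_le_lt; intros h; nra).
assert (L2 : q < 853554 / 1000000) by (apply Rnot_le_lt; intros h; nra).
unfold q in L1, L2; split; apply Rnot_le_lt; intros h; nra.
Qed.

Lemma s8_bounds : 38268 / 100000 < s8 < 38269 / 100000.
Proof.
assert (H1 := c8s8_unit); assert (H2 := c8s8_diag); assert (HP := PI_RGT_0).
assert (Hs : 0 < s8) by (apply sin_gt_0; lra).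
assert (Hc := c8_bounds).
set (c := c8) in *; set (s := s8) in *.
assert (E : 8 * (s * s) * (s * s) - 8 * (s * s) + 1 = 0).
{ assert ((1 - 2 * (s * s)) * (1 - 2 * (s * s)) = / 2); [|lra].
  assert (c * c - s * s = 1 - 2 * (s * s)) by lra.
  rewrite <- H.
  assert ((c * c - s * s) * (c * c - s * s) + (2 * s * c) * (2 * s * c) = 1); [|rewrite <- H2 in H0; lra].
  replace 1 with ((c * c + s * s) * (c * c + s * s)) by (rewrite H1; ring); ring. }
assert (Hq : s * s < / 2) by nra.
set (q := s * s) in *.
assert (EQ : (/ 2 - q) * (/ 2 - q) = / 8) by lra.
assert (L1 : 146445 / 1000000 < q) by (apply Rnot_le_lt; intros h; nra).
assert (L2 : q < 146449 / 1000000) by (apply Rnot_le_lt; intros h; nra).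
unfold q in L1, L2; split; apply Rnot_le_lt; intros h; nra.
Qed.

(** In the plane of the switch the flat middle of a strand lies at distance [hh] from the centre, on
    a tangent of the circle of radius 65 about [O1]; [ee] is half the length of that flat piece. *)
Definition hh : R := 147 * c8 + 56 * s8 - 65.
Definition ee : R := 147 * s8 - 56 * c8.

Definition P0 : point := (c8 * hh, s8 * hh).
Definition J1 : point := (147 - 65 * c8, 56 - 65 * s8).
Definition N2 : point := (114, 0).
Definition J2 : point := (180, 0).
Definition J3 : point := (209, 2).
Definition J4 : point := (219, 0).
Definition J5 : point := (400, 0).
(** Centres of the arcs. [J2] lies on the line through [O1] and [O3], [J3] on the line through [O3]
    and [O4], and [O4] straight above [J4], so consecutive pieces are tangent to each other. *)
Definition O1 : point := (147, 56).
Definition O3 : point := (393 / 2, -28).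
Definition O4 : point := (219, 26).

(** The cut at [N2] is not a junction of different circles: it isolates the sample-free stretch of a
    strand between two samples. *)
Definition core_in (z : point) : Prop := seg P0 J1 z \/ marc O1 J1 N2 z.
Definition core_out (z : point) : Prop :=
  marc O1 N2 J2 z \/ marc O3 J2 J3 z \/ marc O4 J3 J4 z.
Definition core (z : point) : Prop := core_in z \/ core_out z.
Definition sigma (z : point) : Prop := core z \/ seg J4 J5 z.

Ltac cs_facts :=
  assert (Huni := c8s8_unit); assert (Hdia := c8s8_diag);
  assert (Hcb := c8_bounds); assert (Hsb := s8_bounds).

Ltac geo := unfold d2, cross, tang, P0, J1, N2, J2, J3, J4, J5, O1, O3, O4; simpl.

Lemma radius_O1_J1 : d2 O1 J1 = d2 O1 N2.
Proof. cs_facts; geo; nra. Qed.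
Lemma radius_O1_J2 : d2 O1 N2 = d2 O1 J2.
Proof. geo; lra. Qed.
Lemma radius_O3 : d2 O3 J2 = d2 O3 J3.
Proof. geo; lra. Qed.
Lemma radius_O4 : d2 O4 J3 = d2 O4 J4.
Proof. geo; lra. Qed.

Lemma cross_O1_J1 : 0 < cross O1 J1 N2.
Proof. cs_facts; geo; lra. Qed.
Lemma cross_O1_J2 : 0 < cross O1 N2 J2.
Proof. geo; lra. Qed.
Lemma cross_O3 : cross O3 J2 J3 < 0.
Proof. geo; lra. Qed.
Lemma cross_O4 : 0 < cross O4 J3 J4.
Proof. geo; lra. Qed.

(* Up to positive factors, slope_J1, slope_N2, slope_J2, slope_J3, slope_J4 are the derivatives at J1, N2,
   J2, J3, J4 of the squared distance to m along the half strand. *)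
Definition slope_J1 (m : point) : R := ee - (s8 * fst m - c8 * snd m).
Definition slope_N2 (m : point) : R := 56 * (114 - fst m) + 33 * snd m.
Definition slope_J2 (m : point) : R := 56 * (180 - fst m) - 33 * snd m.
Definition slope_J3 (m : point) : R := 12 * (209 - fst m) - 5 * (2 - snd m).
Definition slope_J4 (m : point) : R := 219 - fst m.

(** In each of the first four clauses the distance to [m] may rise and then fall along one arc,
    which happens in the cone opposite to the arc at its centre; the circle about [O1] counts twice
    because of the cut at [N2]. The last clause is the far side of the edge of the wedge that the
    strand does not touch. *)
Definition bad (m : point) : Prop :=
  (0 <= slope_J1 m /\ slope_N2 m <= 0) \/ (0 <= slope_N2 m /\ slope_J2 m <= 0) \/
  (0 <= slope_J2 m /\ slope_J3 m <= 0) \/ (0 <= slope_J3 m /\ slope_J4 m <= 0) \/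
  s8 * fst m + c8 * snd m <= 0.

Lemma tang_O1_J1 m : tang O1 J1 m = 65 * slope_J1 m.
Proof. geo; unfold slope_J1, ee; ring. Qed.
Lemma tang_O1_N2 m : tang O1 N2 m = slope_N2 m.
Proof. geo; unfold slope_N2; ring. Qed.
Lemma tang_O1_J2 m : tang O1 J2 m = slope_J2 m.
Proof. geo; unfold slope_J2; ring. Qed.
Lemma tang_O3_J2 m : tang O3 J2 m = - (slope_J2 m / 2).
Proof. geo; unfold slope_J2; field. Qed.
Lemma tang_O3_J3 m : tang O3 J3 m = - (5 / 2 * slope_J3 m).
Proof. geo; unfold slope_J3; field. Qed.
Lemma tang_O4_J3 m : tang O4 J3 m = 2 * slope_J3 m.
Proof. geo; unfold slope_J3; ring. Qed.
Lemma tang_O4_J4 m : tang O4 J4 m = 26 * slope_J4 m.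
Proof. geo; unfold slope_J4; ring. Qed.

Definition beyond (m A : point) (P : point -> Prop) : Prop :=
  forall q, P q -> q <> A -> d2 m A < d2 m q.

Lemma beyond_chain m A B (P T : point -> Prop) :
  beyond m A P -> P B -> beyond m B T -> beyond m A (fun q => P q \/ T q).
Proof.
intros HP PB HT q [Pq|Tq] N; auto.
destruct (classic (q = B)) as [->|NB]; auto.
destruct (classic (B = A)) as [<-|NA]; auto.
apply Rlt_trans with (d2 m B); auto.
Qed.

Lemma closest_in_middle m A B (K H P T : point -> Prop) x :
  (forall q, K q -> H q \/ P q \/ T q) -> (forall q, P q -> K q) ->
  P A -> P B -> beyond m A H -> beyond m B T ->
  closest K m x -> closest P m x.
Proof.
intros HK PK PA PB HA HB Hx; apply closest_d2 in Hx; destruct Hx as [Kx Hx].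
apply closest_d2; split; auto.
destruct (HK x Kx) as [h|[h|h]]; auto.
- destruct (classic (x = A)) as [->|N]; auto.
  assert (L := HA x h N); assert (L' := Hx A (PK A PA)); lra.
- destruct (classic (x = B)) as [->|N]; auto.
  assert (L := HB x h N); assert (L' := Hx B (PK B PB)); lra.
Qed.

(** Admits a vanishing derivative at [A], the boundary case left over by deciding the sign of a
    slope at each junction; the closest point is then [A]. *)
Lemma marc_unique_weak O A B m x y :
  d2 O A = d2 O B -> cross O A B <> 0 ->
  cross O A B * tang O A m <= 0 -> 0 < cross O A B * tang O B m ->
  closest (marc O A B) m x -> closest (marc O A B) m y -> x = y.
Proof.
intros E N G1 G2 Hx Hy.
destruct (Rle_lt_or_eq_dec _ _ G1) as [h|h].
- apply (marc_unique_between O A B m); auto.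
- assert (F : forall z, closest (marc O A B) m z -> z = A).
  { intros z Hz; apply closest_d2 in Hz; destruct Hz as [Mz Hz].
    apply NNPP; intros Nz.
    assert (L := marc_forward O A B m z E N (Req_le _ _ (eq_sym h)) G2 Mz Nz).
    assert (L' := Hz A (marc_start O A B)); lra. }
  rewrite (F x Hx), (F y Hy); auto.
Qed.

Lemma seg_start A B : seg A B A.
Proof. exists 0; split; [lra|]; destruct A; simpl; f_equal; ring. Qed.

Lemma seg_end A B : seg A B B.
Proof. exists 1; split; [lra|]; destruct B; simpl; f_equal; ring. Qed.

Lemma ee_bounds : 4 < ee < 5.
Proof. cs_facts; unfold ee; split; lra. Qed.

Lemma hh_bounds : 9223 / 100 < hh < 9225 / 100.
Proof. cs_facts; unfold hh; split; lra. Qed.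

Lemma J1_P0 : fst J1 - fst P0 = ee * s8 /\ snd J1 - snd P0 = - (ee * c8).
Proof.
cs_facts; unfold J1, P0, ee, hh; simpl; split.
- replace 147 with (147 * (c8 * c8 + s8 * s8)) at 1 by (rewrite Huni; ring); ring.
- replace 56 with (56 * (c8 * c8 + s8 * s8)) at 1 by (rewrite Huni; ring); ring.
Qed.

Lemma slope_J1_eq m : slope_J1 m = (fst J1 - fst m) * s8 - (snd J1 - snd m) * c8.
Proof. unfold slope_J1, J1, ee; simpl; ring. Qed.

Lemma slope_P0_eq m : - (s8 * fst m - c8 * snd m) = (fst P0 - fst m) * s8 - (snd P0 - snd m) * c8.
Proof. unfold P0; simpl; ring. Qed.

(** * Uniqueness of the closest point on the half strand *)

Section Uniqueness.

Variable m : point.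
(** The four cone conditions in contrapositive form: from the first nonnegative slope on, all later
    slopes are positive. *)
Hypothesis C1 : 0 <= slope_J1 m -> 0 < slope_N2 m.
Hypothesis CN : 0 <= slope_N2 m -> 0 < slope_J2 m.
Hypothesis C2 : 0 <= slope_J2 m -> 0 < slope_J3 m.
Hypothesis C3 : 0 <= slope_J3 m -> 0 < slope_J4 m.

Let T4 := seg J4 J5.
Let T3 q := marc O4 J3 J4 q \/ T4 q.
Let T2 q := marc O3 J2 J3 q \/ T3 q.
Let TN q := marc O1 N2 J2 q \/ T2 q.
Let T1 q := marc O1 J1 N2 q \/ TN q.

Lemma beyond_J4 : 0 <= slope_J4 m -> beyond m J4 T4.
Proof.
intros h q Hq N; apply seg_forward with J5; auto.
revert h; unfold slope_J4, J4, J5; simpl; lra.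
Qed.

Lemma beyond_J3 : 0 <= slope_J3 m -> beyond m J3 T3.
Proof.
intros h; apply beyond_chain with J4.
- intros q Hq N; apply marc_forward with O4 J4; auto using radius_O4.
  + apply Rgt_not_eq, cross_O4.
  + rewrite tang_O4_J3; assert (H := cross_O4); nra.
  + rewrite tang_O4_J4; assert (H := cross_O4); specialize (C3 h); nra.
- apply marc_end, radius_O4.
- apply beyond_J4, Rlt_le; auto.
Qed.

Lemma beyond_J2 : 0 <= slope_J2 m -> beyond m J2 T2.
Proof.
intros h; apply beyond_chain with J3.
- intros q Hq N; apply marc_forward with O3 J3; auto using radius_O3.
  + apply Rlt_not_eq, cross_O3.
  + rewrite tang_O3_J2; assert (H := cross_O3); nra.
  + rewrite tang_O3_J3; assert (H := cross_O3); specialize (C2 h); nra.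
- apply marc_end, radius_O3.
- apply beyond_J3, Rlt_le; auto.
Qed.

Lemma beyond_N2 : 0 <= slope_N2 m -> beyond m N2 TN.
Proof.
intros h; apply beyond_chain with J2.
- intros q Hq N; apply marc_forward with O1 J2; auto using radius_O1_J2.
  + apply Rgt_not_eq, cross_O1_J2.
  + rewrite tang_O1_N2; assert (H := cross_O1_J2); nra.
  + rewrite tang_O1_J2; assert (H := cross_O1_J2); specialize (CN h); nra.
- apply marc_end, radius_O1_J2.
- apply beyond_J2, Rlt_le; auto.
Qed.

Lemma beyond_J1 : 0 <= slope_J1 m -> beyond m J1 T1.
Proof.
intros h; apply beyond_chain with N2.
- intros q Hq N; apply marc_forward with O1 N2; auto using radius_O1_J1.
  + apply Rgt_not_eq, cross_O1_J1.
  + rewrite tang_O1_J1; assert (H := cross_O1_J1); nra.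
  + rewrite tang_O1_N2; assert (H := cross_O1_J1); specialize (C1 h); nra.
- apply marc_end, radius_O1_J1.
- apply beyond_N2, Rlt_le; auto.
Qed.

Let H1 := seg P0 J1.
Let HN q := marc O1 J1 N2 q \/ H1 q.
Let H2 q := marc O1 N2 J2 q \/ HN q.
Let H3 q := marc O3 J2 J3 q \/ H2 q.
Let H4 q := marc O4 J3 J4 q \/ H3 q.

Lemma before_J1 : slope_J1 m <= 0 -> beyond m J1 H1.
Proof.
intros h q Hq N; apply seg_backward with P0; auto.
destruct J1_P0 as [-> ->]; rewrite slope_J1_eq in h; assert (E := ee_bounds); nra.
Qed.

Lemma before_N2 : slope_N2 m <= 0 -> beyond m N2 HN.
Proof.
intros h; assert (slope_J1 m < 0) by (apply Rnot_le_lt; intros k; specialize (C1 k); lra).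
apply beyond_chain with J1.
- intros q Hq N; apply marc_backward with O1 J1; auto using radius_O1_J1.
  + apply Rgt_not_eq, cross_O1_J1.
  + rewrite tang_O1_N2; assert (K := cross_O1_J1); nra.
  + rewrite tang_O1_J1; assert (K := cross_O1_J1); nra.
- apply marc_start.
- apply before_J1; lra.
Qed.

Lemma before_J2 : slope_J2 m <= 0 -> beyond m J2 H2.
Proof.
intros h; assert (slope_N2 m < 0) by (apply Rnot_le_lt; intros k; specialize (CN k); lra).
apply beyond_chain with N2.
- intros q Hq N; apply marc_backward with O1 N2; auto using radius_O1_J2.
  + apply Rgt_not_eq, cross_O1_J2.
  + rewrite tang_O1_J2; assert (K := cross_O1_J2); nra.
  + rewrite tang_O1_N2; assert (K := cross_O1_J2); nra.
- apply marc_start.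
- apply before_N2; lra.
Qed.

Lemma before_J3 : slope_J3 m <= 0 -> beyond m J3 H3.
Proof.
intros h; assert (slope_J2 m < 0) by (apply Rnot_le_lt; intros k; specialize (C2 k); lra).
apply beyond_chain with J2.
- intros q Hq N; apply marc_backward with O3 J2; auto using radius_O3.
  + apply Rlt_not_eq, cross_O3.
  + rewrite tang_O3_J3; assert (K := cross_O3); nra.
  + rewrite tang_O3_J2; assert (K := cross_O3); nra.
- apply marc_start.
- apply before_J2; lra.
Qed.

Lemma before_J4 : slope_J4 m <= 0 -> beyond m J4 H4.
Proof.
intros h; assert (slope_J3 m < 0) by (apply Rnot_le_lt; intros k; specialize (C3 k); lra).
apply beyond_chain with J3.
- intros q Hq N; apply marc_backward with O4 J3; auto using radius_O4.
  + apply Rgt_not_eq, cross_O4.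
  + rewrite tang_O4_J4; assert (K := cross_O4); nra.
  + rewrite tang_O4_J3; assert (K := cross_O4); nra.
- apply marc_start.
- apply before_J3; lra.
Qed.

(** The first junction with positive slope (nonnegative at [J1]) singles out one piece: the head
    before it and the tail after it are strictly farther than the junctions where they are attached.
    A single piece has only one closest point. *)
Lemma sigma_closest_unique x y :
  closest sigma m x -> closest sigma m y -> x = y.
Proof.
intros Hx Hy.
assert (M1 := marc_start O1 J1 N2); assert (M2 := marc_end O1 J1 N2 radius_O1_J1).
assert (M3 := marc_start O1 N2 J2); assert (M4 := marc_end O1 N2 J2 radius_O1_J2).
assert (M5 := marc_start O3 J2 J3); assert (M6 := marc_end O3 J2 J3 radius_O3).
assert (M7 := marc_start O4 J3 J4); assert (M8 := marc_end O4 J3 J4 radius_O4).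
assert (S1 := seg_start P0 J1); assert (S2 := seg_end P0 J1).
assert (S3 := seg_start J4 J5).
assert (Dec : forall q, sigma q -> seg P0 J1 q \/ marc O1 J1 N2 q \/ marc O1 N2 J2 q \/
   marc O3 J2 J3 q \/ marc O4 J3 J4 q \/ seg J4 J5 q).
{ unfold sigma, core, core_in, core_out; tauto. }
assert (none : forall A, beyond m A (fun _ => False)) by (intros A q []).
destruct (Rle_lt_dec 0 (slope_J1 m)) as [k1|k1].
{ apply (seg_closest_unique P0 J1 m);
    (apply (closest_in_middle m J1 J1 sigma (fun _ => False) _ T1);
     [intros q Hq; apply Dec in Hq; unfold T1, TN, T2, T3, T4; tauto
     |intros q; unfold sigma, core, core_in; tauto
     |assumption|assumption|apply none|apply beyond_J1; auto|assumption]). }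
destruct (Rlt_le_dec 0 (slope_N2 m)) as [kN|kN].
{ apply (marc_unique_weak O1 J1 N2 m);
    [apply radius_O1_J1|apply Rgt_not_eq, cross_O1_J1
    |rewrite tang_O1_J1; assert (K := cross_O1_J1); nra
    |rewrite tang_O1_N2; assert (K := cross_O1_J1); nra| |];
    (apply (closest_in_middle m J1 N2 sigma H1 _ TN);
     [intros q Hq; apply Dec in Hq; unfold H1, TN, T2, T3, T4; tauto
     |intros q; unfold sigma, core, core_in; tauto
     |assumption|assumption|apply before_J1; lra|apply beyond_N2; lra|assumption]). }
destruct (Rlt_le_dec 0 (slope_J2 m)) as [k2|k2].
{ apply (marc_unique_weak O1 N2 J2 m);
    [apply radius_O1_J2|apply Rgt_not_eq, cross_O1_J2
    |rewrite tang_O1_N2; assert (K := cross_O1_J2); nra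
    |rewrite tang_O1_J2; assert (K := cross_O1_J2); nra| |];
    (apply (closest_in_middle m N2 J2 sigma HN _ T2);
     [intros q Hq; apply Dec in Hq; unfold HN, H1, T2, T3, T4; tauto
     |intros q; unfold sigma, core, core_out; tauto
     |assumption|assumption|apply before_N2; lra|apply beyond_J2; lra|assumption]). }
destruct (Rlt_le_dec 0 (slope_J3 m)) as [k3|k3].
{ apply (marc_unique_weak O3 J2 J3 m);
    [apply radius_O3|apply Rlt_not_eq, cross_O3
    |rewrite tang_O3_J2; assert (K := cross_O3); nra
    |rewrite tang_O3_J3; assert (K := cross_O3); nra| |];
    (apply (closest_in_middle m J2 J3 sigma H2 _ T3);
     [intros q Hq; apply Dec in Hq; unfold H2, HN, H1, T3, T4; tauto
     |intros q; unfold sigma, core, core_out; tauto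
     |assumption|assumption|apply before_J2; lra|apply beyond_J3; lra|assumption]). }
destruct (Rlt_le_dec 0 (slope_J4 m)) as [k4|k4].
{ apply (marc_unique_weak O4 J3 J4 m);
    [apply radius_O4|apply Rgt_not_eq, cross_O4
    |rewrite tang_O4_J3; assert (K := cross_O4); nra
    |rewrite tang_O4_J4; assert (K := cross_O4); nra| |];
    (apply (closest_in_middle m J3 J4 sigma H3 _ T4);
     [intros q Hq; apply Dec in Hq; unfold H3, H2, HN, H1, T4; tauto
     |intros q; unfold sigma, core, core_out; tauto
     |assumption|assumption|apply before_J3; lra|apply beyond_J4; lra|assumption]). }
apply (seg_closest_unique J4 J5 m);
  (apply (closest_in_middle m J4 J4 sigma H4 _ (fun _ => False));
     [intros q Hq; apply Dec in Hq; unfold H4, H3, H2, HN, H1; tauto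
     |intros q; unfold sigma; tauto
     |assumption|assumption|apply before_J4; lra|apply none|assumption]).
Qed.

(** For [m] on the edge of the wedge containing [P0], the closest point lies on that edge too, so
    the reflection in the edge creates no second closest point. *)
Lemma sigma_closest_axis x :
  s8 * fst m - c8 * snd m = 0 -> closest sigma m x -> x = P0.
Proof.
intros E Hx; assert (EB := ee_bounds).
assert (k1 : 0 <= slope_J1 m) by (unfold slope_J1; lra).
apply NNPP; intros N; apply closest_d2 in Hx; destruct Hx as [Sx Hx].
assert (SP : sigma P0) by (left; left; left; apply seg_start).
assert (B : beyond m P0 (fun q => seg P0 J1 q \/ T1 q)).
{ apply beyond_chain with J1.
  - intros q Hq Nq; apply seg_forward with J1; auto.
    destruct J1_P0 as [-> ->]; assert (G := slope_P0_eq m); rewrite E in G; nra.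
  - apply seg_end.
  - apply beyond_J1; auto. }
assert (L : d2 m P0 < d2 m x).
{ apply B; auto; revert Sx; unfold sigma, core, core_in, core_out, T1, TN, T2, T3, T4; tauto. }
specialize (Hx P0 SP); lra.
Qed.

End Uniqueness.

(** * Distances from the core to its samples and to the cones *)

Lemma d2_projection (p m : point) a b k :
  a * a + b * b = 1 -> 0 <= k ->
  k <= a * (fst m - fst p) + b * (snd m - snd p) -> k * k <= d2 p m.
Proof.
intros E Hk H; unfold d2.
set (u := fst m - fst p) in *; set (v := snd m - snd p) in *.
replace (fst p - fst m) with (- u) by (unfold u; ring).
replace (snd p - snd m) with (- v) by (unfold v; ring).
assert (k * k <= (a * u + b * v) * (a * u + b * v)) by nra.
assert (0 <= (a * v - b * u) * (a * v - b * u)) by apply Rle_0_sqr.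
assert ((a * u + b * v) * (a * u + b * v) + (a * v - b * u) * (a * v - b * u)
        = (a * a + b * b) * (u * u + v * v)) by ring.
rewrite E in H2; nra.
Qed.

Lemma marc_coordinates O A B q :
  d2 O A = d2 O B -> 0 < d2 O A -> marc O A B q ->
  exists l n, 0 <= l /\ 0 <= n /\ 1 <= l + n /\
    fst q = fst O + l * (fst A - fst O) + n * (fst B - fst O) /\
    snd q = snd O + l * (snd A - snd O) + n * (snd B - snd O) /\
    (fst q - fst O) * (fst q - fst O) + (snd q - snd O) * (snd q - snd O) = d2 O A.
Proof.
intros ER HP [E (l & n & Hl & Hn & D)]; exists l, n.
assert (E' : (fst q - fst O) * (fst q - fst O) + (snd q - snd O) * (snd q - snd O) = d2 O A).
{ rewrite <- E; unfold d2; ring. }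
split; auto; split; auto; split; [|rewrite D; simpl; auto].
- rewrite D in E'; simpl in E'; unfold d2 in *.
  set (a1 := fst A - fst O) in *; set (a2 := snd A - snd O) in *.
  set (b1 := fst B - fst O) in *; set (b2 := snd B - snd O) in *.
  replace (fst O - fst A) with (- a1) in * by (unfold a1; ring).
  replace (snd O - snd A) with (- a2) in * by (unfold a2; ring).
  replace (fst O - fst B) with (- b1) in * by (unfold b1; ring).
  replace (snd O - snd B) with (- b2) in * by (unfold b2; ring).
  set (P := a1 * a1 + a2 * a2).
  assert (E1 : P = b1 * b1 + b2 * b2) by (unfold P; lra).
  assert (HP' : 0 < P) by (unfold P; lra).
  assert (E2 : P * (l * l) + P * (n * n) + 2 * (a1 * b1 + a2 * b2) * (l * n) = P).
  { rewrite E1 at 2; unfold P; nra. }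
  assert (HK : a1 * b1 + a2 * b2 <= P).
  { assert (0 <= (a1 - b1) * (a1 - b1) + (a2 - b2) * (a2 - b2))
      by (apply Rplus_le_le_0_compat; apply Rle_0_sqr). nra. }
  apply Rnot_lt_le; intros h.
  assert (0 <= l * n) by nra.
  assert (P <= P * ((l + n) * (l + n))) by nra.
  assert ((l + n) * (l + n) < 1) by nra. nra.
- repeat split; auto; rewrite D in E'; simpl in E'; exact E'.
Qed.

Lemma cone_O1a m : 0 <= slope_J1 m -> slope_N2 m <= 0 -> 147 <= fst m /\ 56 <= snd m.
Proof.
unfold slope_J1, slope_N2, ee; intros h1 h2; assert (Hcb := c8_bounds); assert (Hsb := s8_bounds).
set (X := fst m - 147); set (Y := snd m - 56).
assert (A : s8 * X <= c8 * Y) by (unfold X, Y; lra).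
assert (B : c8 * (33 * Y) <= c8 * (56 * X)) by (apply Rmult_le_compat_l; unfold X, Y; lra).
assert (HX : 0 <= X).
{ apply Rmult_le_reg_l with (56 * c8 - 33 * s8); [lra|]. lra. }
assert (0 <= s8 * X) by (apply Rmult_le_pos; lra).
assert (HY : 0 <= Y) by (apply Rmult_le_reg_l with c8; lra).
unfold X, Y in *; lra.
Qed.

Lemma cone_O1b m : 0 <= slope_N2 m -> slope_J2 m <= 0 ->
  56 <= snd m /\ 56 * (fst m - 147) <= 33 * (snd m - 56) /\
  - (33 * (snd m - 56)) <= 56 * (fst m - 147).
Proof. unfold slope_N2, slope_J2; lra. Qed.

Lemma cone_O3 m : 0 <= slope_J2 m -> slope_J3 m <= 0 -> snd m <= -28.
Proof. unfold slope_J2, slope_J3; lra. Qed.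

Lemma cone_O4 m : 0 <= slope_J3 m -> slope_J4 m <= 0 -> 219 <= fst m /\ 26 <= snd m.
Proof. unfold slope_J3, slope_J4; lra. Qed.

(** The factor is the square of 0.719. The bounds 2116 = 46^2 and 1 keep the distances in a fixed
    range and away from zero, for the choice of a radius in [core_lfs]. *)
Definition good_for (p w : point) : Prop :=
  d2 p w <= 2116 /\
  forall m, bad m -> d2 p w <= 516961 / 1000000 * d2 p m /\ 1 <= d2 p m.

Lemma good_of_bound p w :
  d2 p w <= 2116 ->
  (forall m, bad m -> exists k, 1 <= k /\ k * k <= d2 p m /\
     d2 p w <= 516961 / 1000000 * (k * k)) -> good_for p w.
Proof.
intros H0 H; split; auto; intros m Hm; destruct (H m Hm) as (k & K1 & K2 & K3).
split; nra.
Qed.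

(** The most demanding piece: near [P0] the sample [N2] is about 45.5 away, against about 65 both
    for the centre [O1] and for the far edge of the wedge. In the orthonormal directions (c8, s8)
    and (s8, -c8) the point has coordinates [hh] and [y]. *)
Lemma good_flat p : seg P0 J1 p -> good_for p N2.
Proof.
intros [t [Ht Dp]]; cs_facts; assert (EB := ee_bounds); assert (HB := hh_bounds).
destruct J1_P0 as [F1 F2]; rewrite F1, F2 in Dp.
set (y := t * ee).
assert (Hy : 0 <= y <= ee) by (unfold y; split; nra).
assert (Ex : fst p = c8 * hh + s8 * y) by (rewrite Dp; unfold y, P0; simpl; ring).
assert (Ey : snd p = s8 * hh - c8 * y) by (rewrite Dp; unfold y, P0; simpl; ring).
assert (DN : d2 p N2 = (hh - 114 * c8) * (hh - 114 * c8) + (y - 114 * s8) * (y - 114 * s8)).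
{ unfold d2, N2; simpl; rewrite Ex, Ey.
  transitivity ((c8 * c8 + s8 * s8) * (hh * hh + y * y) + 114 * 114 - 228 * (c8 * hh + s8 * y)); [ring|].
  rewrite Huni; replace (114 * 114) with (114 * 114 * (c8 * c8 + s8 * s8)) by (rewrite Huni; ring); ring. }
assert (B1 : (hh - 114 * c8) * (hh - 114 * c8) <= 1715 / 10).
{ assert (-131 / 10 <= hh - 114 * c8 <= -1307 / 100) by (unfold hh; split; lra). nra. }
assert (B2 : (y - 114 * s8) * (y - 114 * s8) <= 19034 / 10 - 82 * y).
{ assert (43625 / 1000 <= 114 * s8 <= 43627 / 1000) by lra.
  set (z := 114 * s8) in *.
  assert (z * z <= 43627 / 1000 * (43627 / 1000)) by (apply Rmult_le_compat; lra).
  assert (43625 / 1000 * y <= z * y) by (apply Rmult_le_compat_r; lra).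
  assert (y * y <= 5 * y) by (apply Rmult_le_compat_r; lra).
  lra. }
assert (A1 : c8 * hh <= 92388 / 100000 * (9225 / 100)) by (apply Rmult_le_compat; lra).
assert (A2 : s8 * y <= 1 * 5) by (apply Rmult_le_compat; lra).
assert (A3 : 38 / 100 * 92 <= s8 * hh) by (apply Rmult_le_compat; lra).
assert (A4 : c8 * y <= 1 * 5) by (apply Rmult_le_compat; lra).
assert (FP : fst p <= 92) by (rewrite Ex; lra).
assert (SP : 0 <= snd p) by (rewrite Ey; lra).
apply good_of_bound; [rewrite DN; lra|].
intros m [[h1 h2]|[[h1 h2]|[[h1 h2]|[[h1 h2]|h]]]].
(* The direction (c8, s8) is normal to the flat piece; [O1] is 65 beyond it in this direction, and
   the cone at [O1] goes further. *)
- exists 65; split; [lra|]; split; [|rewrite DN; lra].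
  apply d2_projection with c8 s8; [lra|lra|].
  rewrite Ex, Ey.
  destruct (cone_O1a m h1 h2) as [k1 k2].
  assert (0 <= c8 * (fst m - 147)) by (apply Rmult_le_pos; lra).
  assert (0 <= s8 * (snd m - 56)) by (apply Rmult_le_pos; lra).
  replace (c8 * (fst m - (c8 * hh + s8 * y)) + s8 * (snd m - (s8 * hh - c8 * y)))
    with (c8 * fst m + s8 * snd m - (c8 * c8 + s8 * s8) * hh) by ring.
  rewrite Huni; unfold hh; lra.
(* Here and in the later estimates the projection direction is often the unit normal of one
   half-plane of the cone: (56, 33)/65 for [slope_J2], (12, -5)/13 for [slope_J3]. The present bound
   is worst at y = 0. *)
- exists (6372 / 100); split; [lra|]; split; [|rewrite DN; lra].
  apply d2_projection with (56 / 65) (33 / 65); [lra|lra|].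
  rewrite Ex, Ey; unfold slope_J2 in h2.
  assert (64365 / 1000 <= 56 * c8 + 33 * s8) by lra.
  assert (0 <= (ee - y)) by lra.
  assert (E : 56 / 65 * (147 - (c8 * hh + s8 * y)) + 33 / 65 * (56 - (s8 * hh - c8 * y))
     = (56 * c8 + 33 * s8) + (56 * s8 - 33 * c8) / 65 * (ee - y)).
  { transitivity ((56 * (147 * (c8 * c8 + s8 * s8)) + 33 * (56 * (c8 * c8 + s8 * s8))) / 65
        - (56 * (c8 * hh + s8 * y) + 33 * (s8 * hh - c8 * y)) / 65); [rewrite Huni; field|].
    unfold hh, ee; field. }
  assert (-1394 / 10000 <= (56 * s8 - 33 * c8) / 65) by lra.
  assert (ee - y <= 452 / 100) by (unfold ee; lra).
  assert (-1394 / 10000 * (ee - y) <= (56 * s8 - 33 * c8) / 65 * (ee - y))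
    by (apply Rmult_le_compat_r; lra).
  lra.
- exists 100; split; [lra|]; split; [|rewrite DN; lra].
  apply d2_projection with (12 / 13) (-5 / 13); [lra|lra|].
  unfold slope_J3 in h2.
  lra.
- exists 100; split; [lra|]; split; [|rewrite DN; lra].
  apply d2_projection with 1 0; [lra|lra|].
  unfold slope_J4 in h2.
  lra.
(* In the plane of the switch this edge is the diagonal, at distance (hh - y)/sqrt 2 from the
   point. *)
- assert (E : s8 * fst p + c8 * snd p = 2 * s8 * c8 * (hh - y)).
  { rewrite Ex, Ey; replace (2 * s8 * c8 * (hh - y))
      with (2 * s8 * c8 * hh - 2 * s8 * c8 * y) by ring.
    rewrite <- Hdia at 2; ring. }
  assert (K : 7070 / 10000 <= 2 * s8 * c8).
  { assert (38268 / 100000 * (92387 / 100000) <= s8 * c8)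
      by (apply Rmult_le_compat; lra). lra. }
  assert (L : 7070 / 10000 * (hh - y) <= s8 * fst p + c8 * snd p).
  { rewrite E; apply Rmult_le_compat_r; lra. }
  exists (7070 / 10000 * (9223 / 100 - y)); split; [lra|]; split.
  + apply d2_projection with (- s8) (- c8); [lra|lra|]. lra.
  + rewrite DN; assert (0 <= y * y) by (apply Rle_0_sqr). lra.
Qed.

Lemma d2_O1_J1 : d2 O1 J1 = 4225.
Proof. rewrite radius_O1_J1; geo; lra. Qed.

Lemma good_arc_in p : marc O1 J1 N2 p -> good_for p N2.
Proof.
intros Hp; assert (Hcb := c8_bounds); assert (Hsb := s8_bounds).
destruct (marc_coordinates O1 J1 N2 p radius_O1_J1) as (l & n & Hl & Hn & Hln & Ex & Ey & Ec).
{ rewrite d2_O1_J1; lra. }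
{ auto. }
rewrite d2_O1_J1 in Ec.
set (a := fst p - 147); set (b := snd p - 56).
assert (Ea : a = - (65 * (c8 * l)) - 33 * n) by (unfold a; rewrite Ex; unfold O1, J1, N2; simpl; ring).
assert (Eb : b = - (65 * (s8 * l)) - 56 * n) by (unfold b; rewrite Ey; unfold O1, J1, N2; simpl; ring).
assert (Eab : a * a + b * b = 4225) by (rewrite <- Ec; unfold a, b, O1; simpl; ring).
assert (Cl : 92387 / 100000 * l <= c8 * l) by (apply Rmult_le_compat_r; lra).
assert (Cu : c8 * l <= 92388 / 100000 * l) by (apply Rmult_le_compat_r; lra).
assert (Sl : 38268 / 100000 * l <= s8 * l) by (apply Rmult_le_compat_r; lra).
assert (Su : s8 * l <= 38269 / 100000 * l) by (apply Rmult_le_compat_r; lra).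
assert (Ha : a <= -33) by lra.
assert (Hb : b <= 0) by lra.
assert (Hb' : -56 <= b).
{ clear - Eab Ha Hb; apply Rnot_lt_le; intros h; nra. }
assert (Ha' : -65 <= a).
{ clear - Eab Ha Hb; apply Rnot_lt_le; intros h; nra. }
(* On the circle a^2 + b^2 = 65^2, which makes the squared distance to a sample affine in [a] and
   [b]. *)
assert (DN : d2 p N2 = 8450 + 66 * a + 112 * b).
{ replace 8450 with (4225 + (a * a + b * b)) by lra; unfold d2, N2, a, b; simpl; ring. }
assert (B0 : d2 p N2 <= 1702) by (rewrite DN; lra).
assert (Fx : fst p = 147 + a) by (unfold a; ring).
assert (Fy : snd p = 56 + b) by (unfold b; ring).
apply good_of_bound; [lra|].
intros m [[h1 h2]|[[h1 h2]|[[h1 h2]|[[h1 h2]|h]]]].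
- destruct (cone_O1a m h1 h2) as [k1 k2].
  exists 60; split; [lra|]; split; [|lra].
  apply d2_projection with (4 / 5) (3 / 5); [lra|lra|]. rewrite Fx, Fy; lra.
- destruct (cone_O1b m h1 h2) as [k1 [k2 k3]].
  exists 60; split; [lra|]; split; [|lra].
  apply d2_projection with (4 / 5) (3 / 5); [lra|lra|]. rewrite Fx, Fy; lra.
- exists 60; split; [lra|]; split; [|lra].
  apply d2_projection with (12 / 13) (-5 / 13); [lra|lra|].
  unfold slope_J3 in h2; rewrite Fx, Fy; lra.
- exists 60; split; [lra|]; split; [|lra].
  apply d2_projection with 1 0; [lra|lra|].
  unfold slope_J4 in h2; rewrite Fx, Fy; lra.
- set (D := 38268 / 100000 * (147 + a) + 92387 / 100000 * (56 + b)).
  assert (HD : 30 <= D) by (unfold D; lra).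
  assert (D1 : 38268 / 100000 * (147 + a) <= s8 * (147 + a)) by (apply Rmult_le_compat_r; lra).
  assert (D2 : 92387 / 100000 * (56 + b) <= c8 * (56 + b)) by (apply Rmult_le_compat_r; lra).
  exists D; split; [lra|]; split.
  + assert (U := c8s8_unit); apply d2_projection with (- s8) (- c8); [lra|lra|].
    rewrite Fx, Fy; unfold D; lra.
  + (* D^2 is bounded below by its tangent at D = 62, which is affine in p *)
    assert (HT : 124 * D - 3844 <= D * D).
    { assert (0 <= (D - 62) * (D - 62)) by apply Rle_0_sqr; lra. }
    rewrite DN; unfold D in HT |- *; lra.
Qed.

(** The arc is divided at its lowest point a = 0: the half towards [N2] uses that sample, the other
    half uses [J2]. *)
Lemma good_arc_out p :
  marc O1 N2 J2 p -> good_for p N2 \/ good_for p J2.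
Proof.
intros Hp; assert (Hcb := c8_bounds); assert (Hsb := s8_bounds).
destruct (marc_coordinates O1 N2 J2 p radius_O1_J2) as (l & n & Hl & Hn & Hln & Ex & Ey & Ec).
{ geo; lra. }
{ auto. }
replace (d2 O1 N2) with 4225 in Ec by (geo; lra).
set (a := fst p - 147); set (b := snd p - 56).
assert (Eb : b = - 56 * (l + n)) by (unfold b; rewrite Ey; unfold O1, J2, N2; simpl; ring).
assert (Eab : a * a + b * b = 4225) by (rewrite <- Ec; unfold a, b, O1; simpl; ring).
assert (Hb : b <= -56) by lra.
assert (Hb' : -65 <= b).
{ clear - Eab Hb; apply Rnot_lt_le; intros h; nra. }
assert (Ha : -33 <= a <= 33).
{ clear - Eab Hb; split; apply Rnot_lt_le; intros h; nra. }
assert (Fx : fst p = 147 + a) by (unfold a; ring).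
assert (Fy : snd p = 56 + b) by (unfold b; ring).
set (D := 38268 / 100000 * (147 + a) + 92388 / 100000 * (56 + b)).
assert (D1 : 38268 / 100000 * (147 + a) <= s8 * (147 + a)) by (apply Rmult_le_compat_r; lra).
assert (D2 : 92388 / 100000 * (56 + b) <= c8 * (56 + b)).
{ assert (c8 * - (56 + b) <= 92388 / 100000 * - (56 + b)) by (apply Rmult_le_compat_r; lra).
  lra. }
assert (HD : 30 <= D) by (unfold D; lra).
(* The tangent of the square at D = 95/2, an affine lower bound that makes the comparison linear. *)
assert (HT : 95 * D - 9025 / 4 <= D * D).
{ assert (0 <= (D - 95 / 2) * (D - 95 / 2)) by apply Rle_0_sqr; lra. }
assert (U := c8s8_unit).
destruct (Rle_lt_dec a 0) as [h0|h0]; [left|right].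
(* The arc lies below the chord from its lowest point (0, -65) to [N2], which is (-33, -56) relative
   to [O1]. *)
- assert (Ch : b <= -65 - 3 / 11 * a).
  { clear - Eab Hb Ha h0; apply Rnot_lt_le; intros h.
    assert (b * b < (65 + 3 / 11 * a) * (65 + 3 / 11 * a)) by nra.
    assert (a * (33 + a) <= 0) by nra. nra. }
  assert (DN : d2 p N2 = 8450 + 66 * a + 112 * b).
  { replace 8450 with (4225 + (a * a + b * b)) by lra; unfold d2, N2, a, b; simpl; ring. }
  assert (B0 : d2 p N2 <= 1170) by (rewrite DN; lra).
  apply good_of_bound; [lra|].
  intros m [[h1 h2]|[[h1 h2]|[[h1 h2]|[[h1 h2]|h]]]].
  + destruct (cone_O1a m h1 h2) as [k1 k2].
    exists 56; split; [lra|]; split; [|lra].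
    apply d2_projection with 0 1; [lra|lra|]. rewrite Fx, Fy; lra.
  + destruct (cone_O1b m h1 h2) as [k1 [k2 k3]].
    exists 56; split; [lra|]; split; [|lra].
    apply d2_projection with 0 1; [lra|lra|]. rewrite Fx, Fy; lra.
  + exists 50; split; [lra|]; split; [|lra].
    apply d2_projection with (12 / 13) (-5 / 13); [lra|lra|].
    unfold slope_J3 in h2; rewrite Fx, Fy; lra.
  + exists 60; split; [lra|]; split; [|lra].
    apply d2_projection with 1 0; [lra|lra|].
    unfold slope_J4 in h2; rewrite Fx, Fy; lra.
  + exists D; split; [lra|]; split.
    * apply d2_projection with (- s8) (- c8); [lra|lra|].
      rewrite Fx, Fy; unfold D; lra.
    * rewrite DN; unfold D in HT |- *; lra.
- assert (Ch : b <= -65 + 3 / 11 * a).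
  { clear - Eab Hb Ha h0; apply Rnot_lt_le; intros h.
    assert (b * b < (65 - 3 / 11 * a) * (65 - 3 / 11 * a)) by nra.
    assert (a * (a - 33) <= 0) by nra. nra. }
  assert (DN : d2 p J2 = 8450 - 66 * a + 112 * b).
  { replace 8450 with (4225 + (a * a + b * b)) by lra; unfold d2, J2, a, b; simpl; ring. }
  assert (B0 : d2 p J2 <= 1170 - 35 * a) by (rewrite DN; lra).
  apply good_of_bound; [lra|].
  intros m [[h1 h2]|[[h1 h2]|[[h1 h2]|[[h1 h2]|h]]]].
  + destruct (cone_O1a m h1 h2) as [k1 k2].
    exists 56; split; [lra|]; split; [|lra].
    apply d2_projection with 0 1; [lra|lra|]. rewrite Fx, Fy; lra.
  + destruct (cone_O1b m h1 h2) as [k1 [k2 k3]].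
    exists 56; split; [lra|]; split; [|lra].
    apply d2_projection with 0 1; [lra|lra|]. rewrite Fx, Fy; lra.
  + exists (53 - 12 / 13 * a); split; [lra|]; split.
    * apply d2_projection with (12 / 13) (-5 / 13); [lra|lra|].
      unfold slope_J3 in h2; rewrite Fx, Fy; lra.
    * clear - B0 Ha h0; nra.
  + exists (72 - a); split; [lra|]; split.
    * apply d2_projection with 1 0; [lra|lra|].
      unfold slope_J4 in h2; rewrite Fx, Fy; lra.
    * clear - B0 Ha h0; nra.
  + exists D; split; [lra|]; split.
    * apply d2_projection with (- s8) (- c8); [lra|lra|].
      rewrite Fx, Fy; unfold D; lra.
    * rewrite DN; unfold D in HT |- *; lra.
Qed.

(** Only a thin strip along the ray is used, not the arcs in it. The abscissa 399/2 is midway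
    between [J2] and [J4]; of all bad points, only those in the cone at [O4] may come closer than
    28. *)
Lemma good_tail p :
  180 <= fst p <= 219 -> 0 <= snd p <= 9 / 2 -> good_for p J2 \/ good_for p J4.
Proof.
intros HX HY; assert (Hcb := c8_bounds); assert (Hsb := s8_bounds).
assert (U := c8s8_unit); assert (EB := ee_bounds).
set (X := fst p) in *; set (Y := snd p) in *.
assert (S1 : 38 / 100 * 180 <= s8 * X) by (apply Rmult_le_compat; lra).
assert (S2 : c8 * Y <= 1 * (9 / 2)) by (apply Rmult_le_compat; lra).
assert (S3 : 0 <= c8 * Y) by (apply Rmult_le_pos; lra).
assert (HY2 : Y * Y <= 81 / 4).
{ assert (Y * Y <= 9 / 2 * (9 / 2)) by (apply Rmult_le_compat; lra); lra. }
assert (Main : forall m, bad m -> 28 * 28 <= d2 p m \/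
  (219 - X) * (219 - X) + (26 - Y) * (26 - Y) <= d2 p m).
{ intros m [[h1 h2]|[[h1 h2]|[[h1 h2]|[[h1 h2]|h]]]].
  - left; apply d2_projection with (- s8) c8; [lra|lra|].
    unfold slope_J1 in h1; fold X Y; lra.
  - left; destruct (cone_O1b m h1 h2) as [k1 [k2 k3]].
    apply d2_projection with (- s8) c8; [lra|lra|].
    fold X Y.
    assert (L1 : s8 * (56 * (fst m - 147)) <= s8 * (33 * (snd m - 56))) by (apply Rmult_le_compat_l; lra).
    assert (L2 : s8 * (33 * (snd m - 56)) <= c8 * (33 * (snd m - 56))) by (apply Rmult_le_compat_r; lra).
    assert (L3 : 0 <= c8 * (snd m - 56)) by (apply Rmult_le_pos; lra).
    unfold ee in EB; lra.
  - left; assert (k := cone_O3 m h1 h2).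
    apply d2_projection with 0 (-1); [lra|lra|]. fold X Y; lra.
  - right; destruct (cone_O4 m h1 h2) as [k1 k2].
    unfold d2; fold X Y.
    assert (T1 : (219 - X) * (219 - X) <= (fst m - X) * (fst m - X)) by (apply Rmult_le_compat; lra).
    assert (T2 : (26 - Y) * (26 - Y) <= (snd m - Y) * (snd m - Y)) by (apply Rmult_le_compat; lra).
    lra.
  - left; apply d2_projection with (- s8) (- c8); [lra|lra|].
    fold X Y; lra. }
assert (HY3 : 462 <= (26 - Y) * (26 - Y)).
{ assert (43 / 2 * (43 / 2) <= (26 - Y) * (26 - Y)) by (apply Rmult_le_compat; lra); lra. }
destruct (Rle_lt_dec X (399 / 2)) as [h|h]; [left|right].
- assert (T1 : (X - 180) * (X - 180) <= 39 / 2 * (39 / 2)) by (apply Rmult_le_compat; lra).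
  assert (T2 : 39 / 2 * (39 / 2) <= (219 - X) * (219 - X)) by (apply Rmult_le_compat; lra).
  assert (DN : d2 p J2 = (X - 180) * (X - 180) + Y * Y) by (unfold d2, J2, X, Y; simpl; ring).
  split; [lra|]; intros m Hm; destruct (Main m Hm); lra.
- assert (T1 : (219 - X) * (219 - X) <= 39 / 2 * (39 / 2)) by (apply Rmult_le_compat; lra).
  assert (T2 : 0 <= (219 - X) * (219 - X)) by apply Rle_0_sqr.
  assert (DN : d2 p J4 = (219 - X) * (219 - X) + Y * Y) by (unfold d2, J4, X, Y; simpl; ring).
  split; [lra|]; intros m Hm; destruct (Main m Hm); lra.
Qed.

(** * Abscissas and extent of the pieces *)

Lemma lower_semicircle_cross a b a' b' :
  b < 0 -> b' < 0 -> a * a + b * b = a' * a' + b' * b' -> a < a' ->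
  0 < a * b' - b * a'.
Proof.
intros Hb Hb' E H.
destruct (Rle_lt_dec 0 a) as [h|h].
- assert (a * a < a' * a') by nra.
  assert (b < b') by nra. nra.
- destruct (Rle_lt_dec 0 a') as [h'|h'].
  + assert (0 < a * b') by nra. assert (b * a' <= 0) by nra. lra.
  + assert (a' * a' < a * a) by nra.
    assert (b' < b) by nra. nra.
Qed.

(** On a lower half circle the cross product orders points as their abscissas do, and a point of the
    cone of [A] and [B] lies between them in that order. *)
Lemma marc_lower O A B q :
  d2 O A = d2 O B -> snd A < snd O -> snd B < snd O -> fst A < fst B ->
  marc O A B q ->
  fst A <= fst q <= fst B /\ (fst q = fst A -> q = A) /\ (fst q = fst B -> q = B) /\
  snd q < snd O.
Proof.
intros ER HA HB HAB Hq.
destruct (marc_coordinates O A B q ER) as (l & n & Hl & Hn & Hln & Ex & Ey & Ec); auto.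
{ unfold d2; assert (0 <= (fst O - fst A) ^ 2) by apply pow2_ge_0; nra. }
set (a1 := fst A - fst O) in *; set (a2 := snd A - snd O) in *.
set (b1 := fst B - fst O) in *; set (b2 := snd B - snd O) in *.
set (x := fst q - fst O) in *; set (y := snd q - snd O) in *.
assert (Eqx : x = l * a1 + n * b1) by (unfold x; lra).
assert (Eqy : y = l * a2 + n * b2) by (unfold y; lra).
assert (Ha2 : a2 < 0) by (unfold a2; lra). assert (Hb2 : b2 < 0) by (unfold b2; lra).
assert (EA : a1 * a1 + a2 * a2 = d2 O A) by (unfold a1, a2, d2; ring).
assert (EB : b1 * b1 + b2 * b2 = d2 O A) by (rewrite ER; unfold b1, b2, d2; ring).
assert (Hy : y < 0).
{ rewrite Eqy; destruct (Rle_lt_dec l 0) as [h|h]; nra. }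
assert (Hcr : 0 < a1 * b2 - a2 * b1).
{ apply lower_semicircle_cross; auto; [lra|unfold a1, b1; lra]. }
assert (L : a1 <= x).
{ apply Rnot_lt_le; intros h.
  assert (K := lower_semicircle_cross x y a1 a2 Hy Ha2 ltac:(lra) h).
  rewrite Eqx, Eqy in K.
  assert (0 <= n * (a1 * b2 - a2 * b1)) by nra. lra. }
assert (R' : x <= b1).
{ apply Rnot_lt_le; intros h.
  assert (K := lower_semicircle_cross b1 b2 x y Hb2 Hy ltac:(lra) h).
  rewrite Eqx, Eqy in K.
  assert (0 <= l * (a1 * b2 - a2 * b1)) by nra. lra. }
assert (U : forall w1 w2, w2 < 0 -> w1 * w1 + w2 * w2 = d2 O A -> x = w1 -> y = w2).
{ intros w1 w2 Hw Ew E; rewrite E in Ec.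
  assert (Z : (y - w2) * (y + w2) = 0) by lra.
  apply Rmult_integral in Z; destruct Z; lra. }
split; [unfold x, a1, b1 in *; lra|]; split; [|split].
- intros E; assert (E1 : x = a1) by (unfold x, a1; lra).
  assert (E2 := U a1 a2 Ha2 EA E1).
  destruct q, A; simpl in *; unfold x, y, a1, a2 in *; f_equal; lra.
- intros E; assert (E1 : x = b1) by (unfold x, b1; lra).
  assert (E2 := U b1 b2 Hb2 EB E1).
  destruct q, B; simpl in *; unfold x, y, b1, b2 in *; f_equal; lra.
- unfold y in Hy; lra.
Qed.

Definition refl (q : point) : point := (fst q, - snd q).

Lemma refl_refl q : refl (refl q) = q.
Proof. destruct q; unfold refl; simpl; f_equal; ring. Qed.

Lemma d2_refl p q : d2 (refl p) (refl q) = d2 p q.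
Proof. unfold d2, refl; simpl; ring. Qed.

Lemma marc_refl O A B q : marc O A B q -> marc (refl O) (refl A) (refl B) (refl q).
Proof.
intros [E (l & n & Hl & Hn & ->)]; split; [rewrite !d2_refl; auto|].
exists l, n; repeat split; auto; unfold refl; simpl; f_equal; ring.
Qed.

Lemma marc_upper O A B q :
  d2 O A = d2 O B -> snd O < snd A -> snd O < snd B -> fst A < fst B ->
  marc O A B q ->
  fst A <= fst q <= fst B /\ (fst q = fst A -> q = A) /\ (fst q = fst B -> q = B) /\
  snd O < snd q.
Proof.
intros ER HA HB HAB Hq.
destruct (marc_lower (refl O) (refl A) (refl B) (refl q)) as (H1 & H2 & H3 & H4);
  try (rewrite ?d2_refl; simpl; auto; lra).
- apply marc_refl; auto.
- simpl in *; split; auto; split; [|split; [|lra]]; intros E.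
  + rewrite <- (refl_refl q), <- (refl_refl A); f_equal; apply H2, E.
  + rewrite <- (refl_refl q), <- (refl_refl B); f_equal; apply H3, E.
Qed.

(** A certificate for gluing: two such arcs over adjacent intervals of abscissas can only meet at
    the common end, so no intersection of circles is ever computed. *)
Definition monotone_arc (K : point -> Prop) (A B : point) : Prop :=
  is_arc K A B /\ forall q, K q ->
    fst A <= fst q <= fst B /\ (fst q = fst A -> q = A) /\ (fst q = fst B -> q = B).

Lemma monotone_arc_concat K1 K2 A B C :
  fst A < fst B < fst C ->
  monotone_arc K1 A B -> monotone_arc K2 B C ->
  monotone_arc (fun q => K1 q \/ K2 q) A C.
Proof.
intros HAB [A1 M1] [A2 M2]; split.
- apply arc_concat with B; auto; intros q H1 H2.
  destruct (M1 q H1) as (I1 & _ & E1), (M2 q H2) as (I2 & _ & _).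
  apply E1; lra.
- intros q [H|H].
  + destruct (M1 q H) as (I1 & E1 & E2); split; [lra|]; split; auto; intros; lra.
  + destruct (M2 q H) as (I1 & E1 & E2); split; [lra|]; split; auto; intros; lra.
Qed.

Lemma monotone_seg A B : fst A < fst B -> monotone_arc (seg A B) A B.
Proof.
intros H; split; [apply seg_arc; intros E; rewrite E in H; lra|].
intros q [t [Ht ->]]; simpl; split; [nra|]; split; intros E.
- assert (t = 0) by nra; subst t; destruct A; simpl; f_equal; ring.
- assert (t = 1) by nra; subst t; destruct B; simpl; f_equal; ring.
Qed.

Lemma P0_J1_fst : 85 < fst P0 < fst J1 /\ fst J1 < 88.
Proof.
cs_facts; assert (HB := hh_bounds); assert (EB := ee_bounds).
destruct J1_P0 as [F1 _].
assert (0 < ee * s8) by nra.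
assert (L : 92387 / 100000 * (9223 / 100) <= c8 * hh) by (apply Rmult_le_compat; lra).
unfold P0, J1 in *; simpl in *; lra.
Qed.

Lemma range_O1a q : marc O1 J1 N2 q ->
  fst J1 <= fst q <= 114 /\ (fst q = fst J1 -> q = J1) /\ (fst q = 114 -> q = N2) /\
  0 <= snd q <= 56 /\ (snd q = 0 -> q = N2).
Proof.
intros H; cs_facts; assert (FJ := P0_J1_fst).
destruct (marc_lower O1 J1 N2 q radius_O1_J1) as (I1 & E1 & E2 & L); auto;
  try (unfold O1, J1, N2; simpl; lra).
unfold N2 in I1; simpl in I1; unfold O1 in L; simpl in L.
assert (E := proj1 H); rewrite radius_O1_J1 in E; unfold d2, O1, N2 in E; simpl in E.
split; auto; split; auto; split; auto.
assert (A : 0 <= snd q).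
{ apply Rnot_lt_le; intros h.
  assert (33 * 33 <= (147 - fst q) * (147 - fst q)) by (apply Rmult_le_compat; lra).
  assert (56 * 56 < (56 - snd q) * (56 - snd q)) by (apply Rmult_le_0_lt_compat; lra). lra. }
split; [lra|]; intros h; apply E2; unfold N2; simpl.
rewrite h in E; clear - E I1.
assert (Z : (fst q - 114) * (fst q - 180) = 0) by lra.
apply Rmult_integral in Z; destruct Z; lra.
Qed.

Lemma range_O1b q : marc O1 N2 J2 q ->
  114 <= fst q <= 180 /\ (fst q = 114 -> q = N2) /\ (fst q = 180 -> q = J2) /\
  -9 <= snd q <= 0.
Proof.
intros H.
destruct (marc_lower O1 N2 J2 q radius_O1_J2) as (I1 & E1 & E2 & L); auto;
  try (unfold O1, J2, N2; simpl; lra).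
unfold N2, J2 in I1; simpl in I1; unfold O1 in L; simpl in L.
assert (E := proj1 H); unfold d2, O1, N2 in E; simpl in E.
split; auto; split; auto; split; auto.
assert (0 <= (147 - fst q) * (147 - fst q)) by apply Rle_0_sqr.
split; apply Rnot_lt_le; intros h.
- assert (65 * 65 < (56 - snd q) * (56 - snd q)) by (apply Rmult_le_0_lt_compat; lra). lra.
- assert ((56 - snd q) * (56 - snd q) < 56 * 56) by (apply Rmult_le_0_lt_compat; lra).
  assert (0 <= (fst q - 114) * (180 - fst q)) by (apply Rmult_le_pos; lra). lra.
Qed.

Lemma range_O3 q : marc O3 J2 J3 q ->
  180 <= fst q <= 209 /\ (fst q = 180 -> q = J2) /\ (fst q = 209 -> q = J3) /\
  0 <= snd q <= 9 / 2.
Proof.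
intros H.
destruct (marc_upper O3 J2 J3 q radius_O3) as (I1 & E1 & E2 & L); auto;
  try (unfold O3, J2, J3; simpl; lra).
unfold J3, J2 in I1; simpl in I1; unfold O3 in L; simpl in L.
assert (E := proj1 H); unfold d2, O3, J2 in E; simpl in E.
split; auto; split; auto; split; auto.
assert (0 <= (393 / 2 - fst q) * (393 / 2 - fst q)) by apply Rle_0_sqr.
split; apply Rnot_lt_le; intros h.
- assert ((28 + snd q) * (28 + snd q) < 28 * 28) by (apply Rmult_le_0_lt_compat; lra).
  assert (0 <= (fst q - 180) * (213 - fst q)) by (apply Rmult_le_pos; lra). lra.
- assert (65 / 2 * (65 / 2) < (28 + snd q) * (28 + snd q)) by (apply Rmult_le_0_lt_compat; lra). lra.
Qed.

Lemma range_O4 q : marc O4 J3 J4 q ->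
  209 <= fst q <= 219 /\ (fst q = 209 -> q = J3) /\ (fst q = 219 -> q = J4) /\
  0 <= snd q <= 2.
Proof.
intros H.
destruct (marc_lower O4 J3 J4 q radius_O4) as (I1 & E1 & E2 & L); auto;
  try (unfold O4, J4, J3; simpl; lra).
unfold J3, J4 in I1; simpl in I1; unfold O4 in L; simpl in L.
assert (E := proj1 H); unfold d2, O4, J3 in E; simpl in E.
split; auto; split; auto; split; auto.
assert (0 <= (219 - fst q) * (219 - fst q)) by apply Rle_0_sqr.
assert ((219 - fst q) * (219 - fst q) <= 10 * 10) by (apply Rmult_le_compat; lra).
split; apply Rnot_lt_le; intros h.
- assert (26 * 26 < (26 - snd q) * (26 - snd q)) by (apply Rmult_le_0_lt_compat; lra). lra.
- assert ((26 - snd q) * (26 - snd q) < 24 * 24) by (apply Rmult_le_0_lt_compat; lra). lra.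
Qed.

Lemma core_in_arc : monotone_arc core_in P0 N2.
Proof.
assert (FJ := P0_J1_fst).
apply monotone_arc_concat with J1; [change (fst N2) with 114; lra| |].
- apply monotone_seg; lra.
- split; [apply marc_arc; [apply radius_O1_J1|apply Rgt_not_eq, cross_O1_J1]|].
  intros q H; destruct (range_O1a q H) as (A & B & C & _); auto.
Qed.

Lemma core_out_arc : monotone_arc core_out N2 J4.
Proof.
apply monotone_arc_concat with J2; [unfold N2, J2, J4; simpl; lra| |].
- split; [apply marc_arc; [apply radius_O1_J2|apply Rgt_not_eq, cross_O1_J2]|].
  intros q H; destruct (range_O1b q H) as (A & B & C & _); auto.
- apply monotone_arc_concat with J3; [unfold J3, J2, J4; simpl; lra| |].
  + split; [apply marc_arc; [apply radius_O3|apply Rlt_not_eq, cross_O3]|].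
    intros q H; destruct (range_O3 q H) as (A & B & C & _); auto.
  + split; [apply marc_arc; [apply radius_O4|apply Rgt_not_eq, cross_O4]|].
    intros q H; destruct (range_O4 q H) as (A & B & C & _); auto.
Qed.

Lemma core_arc : monotone_arc core P0 J4.
Proof.
assert (FJ := P0_J1_fst).
apply monotone_arc_concat with N2; [change (fst N2) with 114; change (fst J4) with 219; lra| |].
- apply core_in_arc.
- apply core_out_arc.
Qed.

Lemma ray_arc : monotone_arc (seg J4 J5) J4 J5.
Proof. apply monotone_seg; unfold J4, J5; simpl; lra. Qed.

Lemma flat_coordinates p : seg P0 J1 p ->
  exists y, 0 <= y <= ee /\ fst p = c8 * hh + s8 * y /\ snd p = s8 * hh - c8 * y.
Proof.
intros [t [Ht Dp]]; assert (EB := ee_bounds).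
destruct J1_P0 as [F1 F2]; rewrite F1, F2 in Dp.
exists (t * ee); split; [nra|]; rewrite Dp; unfold P0; simpl; split; ring.
Qed.

Lemma core_in_above p : core_in p ->
  0 <= snd p /\ (snd p = 0 -> p = N2).
Proof.
intros [H|H].
- destruct (flat_coordinates p H) as (y & Hy & Ex & Ey); cs_facts.
  assert (EB := ee_bounds); assert (HB := hh_bounds).
  assert (0 < snd p); [|split; [lra|intros; lra]].
  rewrite Ey.
  assert (38 / 100 * 92 <= s8 * hh) by (apply Rmult_le_compat; lra).
  assert (c8 * y <= 1 * 5) by (apply Rmult_le_compat; lra). lra.
- destruct (range_O1a p H) as (_ & _ & _ & A & B); split; [lra|auto].
Qed.

Lemma core_size p : core p -> 85 < fst p <= 219 /\ -9 <= snd p <= 56.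
Proof.
assert (FJ := P0_J1_fst).
intros H; destruct (proj2 core_arc p H) as [I _]; split; [change (fst J4) with 219 in I; lra|].
destruct H as [[H|H]|[H|[H|H]]].
- destruct (flat_coordinates p H) as (y & Hy & Ex & Ey); cs_facts.
  assert (EB := ee_bounds); assert (HB := hh_bounds); rewrite Ey.
  assert (38 / 100 * 92 <= s8 * hh) by (apply Rmult_le_compat; lra).
  assert (s8 * hh <= 4 / 10 * 93) by (apply Rmult_le_compat; lra).
  assert (0 <= c8 * y) by (apply Rmult_le_pos; lra).
  assert (c8 * y <= 1 * 5) by (apply Rmult_le_compat; lra). lra.
- destruct (range_O1a p H) as (_ & _ & _ & A & _); lra.
- destruct (range_O1b p H) as (_ & _ & _ & A); lra.
- destruct (range_O3 p H) as (_ & _ & _ & A); lra.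
- destruct (range_O4 p H) as (_ & _ & _ & A); lra.
Qed.

Lemma ray_coordinates p : seg J4 J5 p -> 219 <= fst p <= 400 /\ snd p = 0.
Proof. intros [t [Ht ->]]; unfold J4, J5; simpl; lra. Qed.

(* The half strand touches only the edge s8 X = c8 Y of its wedge, at P0. *)
Lemma sigma_wedge p : sigma p ->
  0 < s8 * fst p + c8 * snd p /\ 0 <= s8 * fst p - c8 * snd p /\
  (s8 * fst p - c8 * snd p = 0 -> p = P0).
Proof.
cs_facts; assert (EB := ee_bounds); assert (HB := hh_bounds); assert (FJ := P0_J1_fst).
intros [[[H|H]|H]|H].
- destruct (flat_coordinates p H) as (y & Hy & Ex & Ey).
  assert (E1 : s8 * fst p - c8 * snd p = y).
  { rewrite Ex, Ey; transitivity ((c8 * c8 + s8 * s8) * y); [ring|rewrite Huni; ring]. }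
  split; [|split; [lra|]].
  + destruct (core_in_above p (or_introl H)) as [A _].
    destruct (proj2 (monotone_seg P0 J1 (proj2 (proj1 FJ))) p H) as [B _].
    assert (0 < s8 * fst p) by nra. nra.
  + intros E; rewrite E1 in E; rewrite E in Ex, Ey.
    destruct p; unfold P0; simpl in *; f_equal; lra.
- destruct (range_O1a p H) as (I1 & _ & _ & A & _).
  destruct (marc_coordinates O1 J1 N2 p radius_O1_J1) as (l & n & Hl & Hn & Hln & Ex & Ey & _); auto.
  { rewrite d2_O1_J1; lra. }
  assert (E : s8 * fst p - c8 * snd p = ee + (56 * c8 - 33 * s8) * n).
  { rewrite Ex, Ey; unfold O1, J1, N2, ee; simpl; ring. }
  assert (0 <= (56 * c8 - 33 * s8) * n) by (apply Rmult_le_pos; lra).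
  split; [|split; [lra|intros; lra]].
  assert (0 < s8 * fst p) by nra. nra.
- assert (B : 114 <= fst p /\ -9 <= snd p <= 9 / 2).
  { destruct H as [H|[H|H]].
    - destruct (range_O1b p H) as (A & _ & _ & B); lra.
    - destruct (range_O3 p H) as (A & _ & _ & B); lra.
    - destruct (range_O4 p H) as (A & _ & _ & B); lra. }
  destruct B as (B1 & B2).
  assert (38 / 100 * 114 <= s8 * fst p) by (apply Rmult_le_compat; lra).
  assert (c8 * snd p <= c8 * (9 / 2)) by (apply Rmult_le_compat_l; lra).
  assert (c8 * (-9) <= c8 * snd p) by (apply Rmult_le_compat_l; lra).
  split; [lra|split; [lra|intros; lra]].
- destruct (ray_coordinates p H) as [A B]; rewrite B.
  assert (0 < s8 * fst p) by nra. split; [lra|split; [lra|intros; lra]].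
Qed.

(** Keeps the switch in the closed disc outside which the links run; the two share only the ends of
    the rays. *)
Lemma sigma_norm p : sigma p ->
  fst p * fst p + snd p * snd p <= 160000 /\
  (fst p * fst p + snd p * snd p = 160000 -> p = J5).
Proof.
intros [H|H].
- destruct (core_size p H) as [A B].
  assert (fst p * fst p <= 219 * 219) by (apply Rmult_le_compat; lra).
  assert (snd p * snd p <= 56 * 56) by nra. split; [lra|intros; lra].
- destruct (ray_coordinates p H) as [A B]; rewrite B.
  assert (fst p * fst p <= 400 * 400) by (apply Rmult_le_compat; lra).
  split; [lra|]; intros E.
  assert (Z : (fst p - 400) * (fst p + 400) = 0) by lra.
  apply Rmult_integral in Z; destruct p as [x y]; unfold J5; simpl in *; f_equal; lra.
Qed.

Lemma core_good p : core p ->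
  exists w, (w = N2 \/ w = J2 \/ w = J4) /\ good_for p w.
Proof.
intros [[H|H]|[H|[H|H]]].
- exists N2; split; auto using good_flat.
- exists N2; split; auto using good_arc_in.
- destruct (good_arc_out p H); eauto.
- destruct (range_O3 p H) as (A & _ & _ & B).
  destruct (good_tail p) as [h|h]; try lra; eauto.
- destruct (range_O4 p H) as (A & _ & _ & B).
  destruct (good_tail p) as [h|h]; try lra; eauto.
Qed.

(** * Switches: dihedral copies of the half strand *)

Definition k8 : R := 2 * s8 * c8.

(* [psi] exchanges the plane and the frame of the ray of angle PI/8; [rho] is
   the reflection about that ray, exchanging the two states of a switch. *)
Definition psi (q : point) : point := (c8 * fst q + s8 * snd q, s8 * fst q - c8 * snd q).
Definition rho (q : point) : point := (k8 * (fst q + snd q), k8 * (fst q - snd q)).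
Definition turn (s : bool) (q : point) : point := if s then rho q else q.

Definition sg (b : bool) (x : R) : R := if b then - x else x.

(* Elements of the dihedral group of order 8, indexing the 8 rays. *)
Definition dih : Type := (bool * bool * bool)%type.

Definition act (d : dih) (q : point) : point :=
  let '(b1, b2, b3) := d in
  (sg b1 (if b3 then snd q else fst q), sg b2 (if b3 then fst q else snd q)).
Definition actinv (d : dih) (q : point) : point :=
  let '(b1, b2, b3) := d in
  if b3 then (sg b2 (snd q), sg b1 (fst q)) else (sg b1 (fst q), sg b2 (snd q)).

Definition frame (s : bool) (d : dih) (z : point) : point := act d (turn s (psi z)).
Definition unframe (s : bool) (d : dih) (q : point) : point := psi (turn s (actinv d q)).

Definition fold (q : point) : point :=
  (Rmax (Rabs (fst q)) (Rabs (snd q)), Rmin (Rabs (fst q)) (Rabs (snd q))).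

Lemma k8_sqr : 2 * (k8 * k8) = 1.
Proof.
assert (U := c8s8_unit); assert (D := c8s8_diag); unfold k8.
assert ((c8 * c8 - s8 * s8) * (c8 * c8 - s8 * s8) + (2 * s8 * c8) * (2 * s8 * c8)
        = (c8 * c8 + s8 * s8) * (c8 * c8 + s8 * s8)) by ring.
rewrite U, D in H; lra.
Qed.

Lemma k8_pos : 0 < k8.
Proof. cs_facts; unfold k8; apply Rmult_lt_0_compat; lra. Qed.

Lemma psi_psi q : psi (psi q) = q.
Proof.
assert (U := c8s8_unit); destruct q as [x y]; unfold psi; simpl.
replace (c8 * (c8 * x + s8 * y) + s8 * (s8 * x - c8 * y)) with ((c8 * c8 + s8 * s8) * x) by ring.
replace (s8 * (c8 * x + s8 * y) - c8 * (s8 * x - c8 * y)) with ((c8 * c8 + s8 * s8) * y) by ring.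
rewrite U; f_equal; ring.
Qed.

Lemma rho_rho q : rho (rho q) = q.
Proof.
assert (U := k8_sqr); destruct q as [x y]; unfold rho; simpl.
replace (k8 * (k8 * (x + y) + k8 * (x - y))) with (2 * (k8 * k8) * x) by ring.
replace (k8 * (k8 * (x + y) - k8 * (x - y))) with (2 * (k8 * k8) * y) by ring.
rewrite U; f_equal; ring.
Qed.

Lemma turn_turn s q : turn s (turn s q) = q.
Proof. destruct s; simpl; auto using rho_rho. Qed.

Lemma act_actinv d q : act d (actinv d q) = q.
Proof.
destruct d as [[[] []] []], q as [x y]; unfold act, actinv, sg; simpl; f_equal; ring.
Qed.

Lemma actinv_act d q : actinv d (act d q) = q.
Proof.
destruct d as [[[] []] []], q as [x y]; unfold act, actinv, sg; simpl; f_equal; ring.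
Qed.

Lemma frame_unframe s d q : frame s d (unframe s d q) = q.
Proof. unfold frame, unframe; rewrite psi_psi, turn_turn, act_actinv; auto. Qed.

Lemma unframe_frame s d q : unframe s d (frame s d q) = q.
Proof. unfold frame, unframe; rewrite actinv_act, turn_turn, psi_psi; auto. Qed.

Lemma d2_psi p q : d2 (psi p) (psi q) = d2 p q.
Proof.
assert (U := c8s8_unit); unfold d2, psi; simpl.
transitivity ((c8 * c8 + s8 * s8) * ((fst p - fst q) * (fst p - fst q) + (snd p - snd q) * (snd p - snd q)));
  [ring|rewrite U; ring].
Qed.

Lemma d2_turn s p q : d2 (turn s p) (turn s q) = d2 p q.
Proof.
destruct s; simpl; auto; assert (U := k8_sqr); unfold d2, rho; simpl.
transitivity (2 * (k8 * k8) * ((fst p - fst q) * (fst p - fst q) + (snd p - snd q) * (snd p - snd q)));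
  [ring|rewrite U; ring].
Qed.

Lemma d2_act d p q : d2 (act d p) (act d q) = d2 p q.
Proof. destruct d as [[[] []] []]; unfold d2, act, sg; simpl; ring. Qed.

Lemma d2_actinv d p q : d2 (actinv d p) (actinv d q) = d2 p q.
Proof. destruct d as [[[] []] []]; unfold d2, actinv, sg; simpl; ring. Qed.

Lemma d2_frame s d p q : d2 (frame s d p) (frame s d q) = d2 p q.
Proof. unfold frame; rewrite d2_act, d2_turn, d2_psi; auto. Qed.

Lemma d2_unframe s d p q : d2 (unframe s d p) (unframe s d q) = d2 p q.
Proof. unfold unframe; rewrite d2_psi, d2_turn, d2_actinv; auto. Qed.

Lemma affine_psi : affine psi.
Proof. exists c8, s8, 0, s8, (- c8), 0; intros q; unfold psi; f_equal; ring. Qed.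

Lemma affine_turn s : affine (turn s).
Proof.
destruct s.
- exists k8, k8, 0, k8, (- k8), 0; intros q; unfold turn, rho; f_equal; ring.
- exists 1, 0, 0, 0, 1, 0; intros [x y]; simpl; f_equal; ring.
Qed.

Lemma affine_act d : affine (act d).
Proof.
destruct d as [[b1 b2] b3].
exists (if b3 then 0 else sg b1 1), (if b3 then sg b1 1 else 0), 0,
       (if b3 then sg b2 1 else 0), (if b3 then 0 else sg b2 1), 0.
intros q; destruct b1, b2, b3; unfold act, sg; f_equal; ring.
Qed.

Lemma affine_frame s d : affine (frame s d).
Proof.
apply (affine_comp (act d) (fun z => turn s (psi z))); [apply affine_act|].
apply (affine_comp (turn s) psi); [apply affine_turn|apply affine_psi].
Qed.

(** [rho] fixes the ray of angle PI/8 pointwise, so the state [s] drops out: points of the rays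
    belong to both states in the same place. *)
Lemma frame_axis s d x : frame s d (x, 0) = act d (c8 * x, s8 * x).
Proof.
unfold frame; f_equal; unfold psi; simpl.
replace (c8 * x + s8 * 0) with (c8 * x) by ring.
replace (s8 * x - c8 * 0) with (s8 * x) by ring.
destruct s; simpl; auto; unfold rho; simpl.
assert (U := c8s8_unit); assert (D := c8s8_diag); unfold k8; f_equal.
- transitivity ((c8 * c8 - s8 * s8 + 2 * (s8 * s8)) * (c8 * x)).
  + rewrite D; ring.
  + replace (c8 * c8 - s8 * s8 + 2 * (s8 * s8)) with (c8 * c8 + s8 * s8) by ring.
    rewrite U; ring.
- transitivity ((2 * (c8 * c8) - 2 * s8 * c8) * (s8 * x)); [ring|].
  rewrite <- D; replace (2 * (c8 * c8) - (c8 * c8 - s8 * s8)) with (c8 * c8 + s8 * s8) by ring.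
  rewrite U; ring.
Qed.

(** * Folding the plane onto a wedge *)

Definition wedge (q : point) : Prop := 0 <= snd q <= fst q.

Lemma fold_wedge q : wedge (fold q).
Proof.
unfold wedge, fold; simpl; split.
- apply Rmin_glb; apply Rabs_pos.
- apply Rle_trans with (Rabs (fst q)); [apply Rmin_l|apply Rmax_l].
Qed.

Lemma fold_actinv d q : fold (actinv d q) = fold q.
Proof.
destruct d as [[[] []] []]; unfold fold, actinv, sg; simpl; rewrite ?Rabs_Ropp; auto;
  rewrite Rmax_comm, Rmin_comm; auto.
Qed.

Lemma fold_id q : wedge q -> fold q = q.
Proof.
intros [A B]; unfold fold; rewrite !Rabs_right by lra.
rewrite Rmax_left, Rmin_right by lra; destruct q; auto.
Qed.

Lemma fold_exists q : exists d, q = act d (fold q).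
Proof.
destruct q as [x y]; unfold fold; simpl.
assert (B : forall t, exists b, t = sg b (Rabs t)).
{ intros t; destruct (Rle_lt_dec 0 t) as [h|h].
  - exists false; simpl; rewrite Rabs_right; lra.
  - exists true; simpl; rewrite Rabs_left; lra. }
destruct (B x) as [b1 E1], (B y) as [b2 E2].
destruct (Rle_lt_dec (Rabs y) (Rabs x)) as [h|h].
- exists (b1, b2, false); unfold act; simpl.
  rewrite Rmax_left, Rmin_right by lra; f_equal; auto.
- exists (b1, b2, true); unfold act; simpl.
  rewrite Rmax_right, Rmin_left by lra; f_equal; auto.
Qed.

(** Rearrangement inequality: among all orders and signs of the coordinates of [b], the decreasing
    absolute values maximize the inner product with the decreasing nonnegative pair [a]. *)
Lemma fold_pairing a b : wedge a ->
  fst a * fst b + snd a * snd b <= fst a * fst (fold b) + snd a * snd (fold b).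
Proof.
intros [A B]; unfold fold; simpl.
assert (H1 := Rle_abs (fst b)); assert (H2 := Rle_abs (snd b)).
assert (fst a * fst b + snd a * snd b <= fst a * Rabs (fst b) + snd a * Rabs (snd b)) by nra.
destruct (Rle_lt_dec (Rabs (snd b)) (Rabs (fst b))) as [h|h].
- rewrite Rmax_left, Rmin_right by lra; lra.
- rewrite Rmax_right, Rmin_left by lra; nra.
Qed.

Lemma fold_norm b :
  fst (fold b) * fst (fold b) + snd (fold b) * snd (fold b) = fst b * fst b + snd b * snd b.
Proof.
assert (E : forall t, Rabs t * Rabs t = t * t).
{ intros t; rewrite <- Rabs_mult; apply Rabs_right, Rle_ge, Rle_0_sqr. }
unfold fold; simpl; destruct (Rle_lt_dec (Rabs (snd b)) (Rabs (fst b))) as [h|h].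
- rewrite Rmax_left, Rmin_right by lra; rewrite !E; ring.
- rewrite Rmax_right, Rmin_left by lra; rewrite !E; ring.
Qed.

Lemma d2_expand a b : d2 a b = (fst a * fst a + snd a * snd a) + (fst b * fst b + snd b * snd b)
  - 2 * (fst a * fst b + snd a * snd b).
Proof. unfold d2; ring. Qed.

Lemma fold_closer a b : wedge a -> d2 a (fold b) <= d2 a b.
Proof.
intros W; assert (H := fold_pairing a b W); assert (N := fold_norm b).
rewrite !d2_expand; lra.
Qed.

(** Strictly inside the wedge the rearrangement inequality is strict unless [b] is already folded.
    For [a] on an edge the mirror image of [b] is equally far; the last two hypotheses dispose of
    this by putting [fold b] on the same edge. *)
Lemma fold_equality a b :
  wedge a -> 0 < fst a -> d2 a b = d2 a (fold b) ->
  (snd a = fst a -> fst (fold b) = snd (fold b)) ->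
  (snd a = 0 -> snd (fold b) = 0) -> b = fold b.
Proof.
intros [W1 W2] Ha E H1 H2; assert (N := fold_norm b).
assert (E' : fst a * fst b + snd a * snd b = fst a * fst (fold b) + snd a * snd (fold b))
  by (rewrite !d2_expand in E; lra).
clear E N; unfold fold in *; simpl in *.
assert (A1 := Rle_abs (fst b)); assert (A2 := Rle_abs (snd b)).
assert (P1 := Rabs_pos (fst b)); assert (P2 := Rabs_pos (snd b)).
destruct (Rle_lt_dec (Rabs (snd b)) (Rabs (fst b))) as [h|h].
- rewrite Rmax_left, Rmin_right in * by lra.
  assert (0 <= snd a * (Rabs (snd b) - snd b)) by (apply Rmult_le_pos; lra).
  assert (0 <= fst a * (Rabs (fst b) - fst b)) by (apply Rmult_le_pos; lra).
  assert (F1 : fst a * (Rabs (fst b) - fst b) = 0) by lra.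
  assert (F2 : snd a * (Rabs (snd b) - snd b) = 0) by lra.
  apply Rmult_integral in F1; destruct F1 as [F1|F1]; [lra|].
  destruct b as [x y]; simpl in *; f_equal; [lra|].
  apply Rmult_integral in F2; destruct F2 as [F2|F2]; [|lra].
  assert (H3 := H2 F2); rewrite H3.
  destruct (Req_dec y 0) as [->|n]; auto.
  exfalso; apply (Rabs_no_R0 y n H3).
- rewrite Rmax_right, Rmin_left in * by lra.
  destruct (Req_dec (snd a) (fst a)) as [e|e]; [specialize (H1 e); lra|].
  assert (0 < (fst a - snd a) * (Rabs (snd b) - Rabs (fst b))) by (apply Rmult_lt_0_compat; lra).
  assert (0 <= snd a * (Rabs (snd b) - snd b)) by (apply Rmult_le_pos; lra).
  assert (0 <= fst a * (Rabs (fst b) - fst b)) by (apply Rmult_le_pos; lra).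
  lra.
Qed.

(** The linear forms vanishing on the two edges of the wedge, the axis and the diagonal, expressed
    in the coordinates of the half strand. *)
Lemma psi_forms q :
  s8 * fst (psi q) - c8 * snd (psi q) = snd q /\
  s8 * fst (psi q) + c8 * snd (psi q) = k8 * (fst q - snd q).
Proof.
assert (U := c8s8_unit); assert (D := c8s8_diag); unfold psi, k8; simpl; split.
- transitivity ((c8 * c8 + s8 * s8) * snd q); [ring|rewrite U; ring].
- transitivity (2 * s8 * c8 * fst q - (c8 * c8 - s8 * s8) * snd q); [ring|rewrite D; ring].
Qed.

Lemma turn_wedge s q : wedge q -> wedge (turn s q).
Proof.
intros [A B]; destruct s; [|split; auto]; assert (K := k8_pos).
unfold wedge, turn, rho; simpl; nra.
Qed.

Lemma sigma_in_wedge s z : sigma z -> wedge (turn s (psi z)).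
Proof.
intros H; apply turn_wedge; destruct (sigma_wedge z H) as (A & B & _).
rewrite <- (psi_psi z) in A, B.
destruct (psi_forms (psi z)) as [E1 E2]; rewrite E1 in B; rewrite E2 in A.
assert (K := k8_pos); split; [lra|].
assert (0 < fst (psi z) - snd (psi z)); [|lra].
apply Rmult_lt_reg_l with k8; lra.
Qed.

Lemma psi_P0 : psi P0 = (hh, 0).
Proof.
assert (U := c8s8_unit); unfold psi, P0; simpl; f_equal; [|ring].
transitivity ((c8 * c8 + s8 * s8) * hh); [ring|rewrite U; ring].
Qed.

Definition switch (s : bool) (q : point) : Prop := exists d, sigma (unframe s d q).

Lemma not_bad_cases m : ~ bad m ->
  (0 <= slope_J1 m -> 0 < slope_N2 m) /\ (0 <= slope_N2 m -> 0 < slope_J2 m) /\ (0 <= slope_J2 m -> 0 < slope_J3 m) /\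
  (0 <= slope_J3 m -> 0 < slope_J4 m) /\ 0 < s8 * fst m + c8 * snd m.
Proof.
unfold bad; intros H; repeat split; intros; apply Rnot_le_lt; intros h; apply H; tauto.
Qed.

(* Folding by the dihedral group reduces the closest points of a switch to
   those of one half strand. *)
Lemma switch_closest_unique s (C : point -> Prop) m dm :
  m = act dm (fold m) -> ~ bad (psi (turn s (fold m))) ->
  (forall q, switch s q -> C q) ->
  forall x y, closest C m x -> closest C m y -> switch s x -> switch s y -> x = y.
Proof.
intros Em NB HC.
set (a := fold m) in *; set (m0 := psi (turn s a)) in *.
assert (Wa := fold_wedge m : wedge a).
clearbody a.
destruct (not_bad_cases m0 NB) as (B1 & B2 & B3 & B4 & B5).
assert (K := k8_pos).
(* The copy of [x] in the wedge of [m] also belongs to [C] and is not farther; as [x] is closest,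
   folding is an equality and the folded point is closest on the half strand. *)
assert (Key : forall x, closest C m x -> switch s x -> exists z,
  closest sigma m0 z /\ fold x = turn s (psi z) /\ d2 a (actinv dm x) = d2 a (fold x)).
{ intros x Hx [dx Sx]; set (z := unframe s dx x) in *.
  apply closest_d2 in Hx; destruct Hx as [Cx Hx].
  assert (Fx : fold x = turn s (psi z)).
  { rewrite <- (fold_actinv dx x).
    replace (actinv dx x) with (turn s (psi z)).
    - apply fold_id, sigma_in_wedge; auto.
    - unfold z, unframe; rewrite psi_psi, turn_turn; auto. }
  assert (D1 : d2 m x = d2 a (actinv dm x)).
  { rewrite <- (d2_actinv dm m x); f_equal; rewrite Em; apply actinv_act. }
  assert (D2 : d2 a (fold x) = d2 m0 z).
  { rewrite Fx; unfold m0; rewrite <- (psi_psi z) at 2; rewrite d2_psi.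
    rewrite <- (turn_turn s (psi z)) at 2; rewrite d2_turn; auto. }
  assert (D3 : d2 a (fold x) <= d2 a (actinv dm x)).
  { rewrite <- (fold_actinv dm x); apply fold_closer; auto. }
  assert (D4 : forall z', sigma z' -> d2 m x <= d2 m0 z').
  { intros z' Sz'.
    assert (Cz : C (frame s dm z')).
    { apply HC; exists dm; rewrite unframe_frame; auto. }
    assert (L := Hx _ Cz); apply Rle_trans with (1 := L), Req_le.
    rewrite <- (d2_frame s dm m0 z'); f_equal.
    unfold m0, frame; rewrite psi_psi, turn_turn; auto. }
  exists z; split; [|split; auto].
  - apply closest_d2; split; auto; intros z' Sz'; assert (L := D4 z' Sz'); lra.
  - assert (L := D4 z Sx); lra. }
intros x y Hx Hy Sx Sy.
destruct (Key x Hx Sx) as (zx & Cx & Fx & Dx), (Key y Hy Sy) as (zy & Cy & Fy & Dy).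
assert (Ez : zx = zy) by (apply (sigma_closest_unique m0); auto).
(* Equality in the folding inequality places the closest point in the wedge of [m]. On one edge it
   is [P0], which lies on that edge; the other edge is excluded by [B5]. The state decides which
   edge is the axis and which the diagonal. *)
assert (Fin : forall w z, closest sigma m0 z -> fold w = turn s (psi z) ->
   d2 a (actinv dm w) = d2 a (fold w) -> actinv dm w = fold w).
{ intros w z Cz Fw Dw; rewrite <- (fold_actinv dm w) in Dw |- *.
  destruct Wa as [W1 W2].
  destruct (psi_forms (turn s a)) as [E1 E2]; fold m0 in E1, E2.
  assert (AX : s8 * fst m0 - c8 * snd m0 = 0 -> z = P0).
  { intros E; apply (sigma_closest_axis m0); auto. }
  rewrite E2 in B5; rewrite E1 in AX.
  assert (B6 : 0 < fst (turn s a) - snd (turn s a)) by (apply Rmult_lt_reg_l with k8; lra).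
  rewrite <- (fold_actinv dm w) in Fw.
  apply fold_equality with a; auto; [split; auto| | |].
  - destruct s; unfold turn, rho in B6; simpl in B6; [|lra].
    assert (0 < k8 * snd a) by lra.
    assert (0 < snd a) by (apply Rmult_lt_reg_l with k8; lra). lra.
  - intros E; destruct s; unfold turn, rho in B6, AX; simpl in B6, AX; [|lra].
    rewrite Fw, AX, psi_P0; [unfold turn, rho; simpl; ring|rewrite E; ring].
  - intros E; destruct s; unfold turn, rho in B6, AX; simpl in B6, AX.
    + rewrite E in B6; lra.
    + rewrite Fw, AX, psi_P0; auto. }
rewrite <- (act_actinv dm x), <- (act_actinv dm y); f_equal.
rewrite (Fin x zx Cx Fx Dx), (Fin y zy Cy Fy Dy), Fx, Fy, Ez; auto.
Qed.

(** It is enough that [C] agrees with the switch inside the circle of radius 400: a point [m] within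
    64 of [p] has its closest points within 230 + 64 + 64 of the centre. *)
Lemma core_lfs s (C : point -> Prop) d p :
  proximinal C -> (forall q, switch s q -> C q) ->
  (forall q, C q -> fst q * fst q + snd q * snd q < 160000 -> switch s q) ->
  core (unframe s d p) ->
  exists w r, (w = N2 \/ w = J2 \/ w = J4) /\ 0 < r /\
    edist p (frame s d w) < 72 / 100 * r /\
    forall m, medial_axis C m -> r <= edist p m.
Proof.
intros PC HC HC' Hp; set (z := unframe s d p) in *.
destruct (core_good z Hp) as (w & Hw & G1 & G2).
assert (Ep : p = frame s d z) by (unfold z; rewrite frame_unframe; auto).
assert (Ed : edist p (frame s d w) = edist z w).
{ rewrite !edist_d2; f_equal; rewrite Ep, d2_frame; auto. }
set (e := edist z w) in *; assert (He := edist_ge0 z w : 0 <= e).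
assert (He2 : e <= 46).
{ assert (S := edist_sqr z w); fold e in S; apply Rnot_lt_le; intros h; nra. }
(* The value 1 takes care of a point that is itself a sample. As 46/0.719 is below 64, so is the
   radius. *)
set (r := Rmax 1 (e / (719 / 1000))).
assert (R1 : 1 <= r) by apply Rmax_l.
assert (R2 : e / (719 / 1000) <= r) by apply Rmax_r.
assert (R3 : r <= 64) by (apply Rmax_lub; lra).
exists w, r; split; auto; split; [lra|]; split; [rewrite Ed; lra|].
intros m Mm; apply Rnot_lt_le; intros Hlt.
destruct (fold_exists m) as [dm Em].
set (m0 := psi (turn s (fold m))).
(* The folded image of [m] is at most as far, so a lower bound for bad points in the coordinates of
   one half strand is a lower bound for [m] itself. *)
assert (Dz : d2 z m0 <= d2 p m).
{ unfold z, m0, unframe; rewrite d2_psi, d2_turn.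
  rewrite <- (d2_actinv d p m), <- (fold_actinv d m).
  apply fold_closer.
  replace (actinv d p) with (turn s (psi z)).
  - apply sigma_in_wedge; left; auto.
  - unfold z, unframe; rewrite psi_psi, turn_turn; auto. }
assert (NB : ~ bad m0).
{ intros B; destruct (G2 m0 B) as [B1 B2].
  assert (Lz : edist z m0 < r).
  { apply Rle_lt_trans with (edist p m); auto; apply edist_le; auto. }
  assert (S1 := edist_sqr z m0); assert (S2 := edist_sqr z w); fold e in S2.
  assert (Q := edist_ge0 z m0); set (f := edist z m0) in *.
  assert (F1 : 1 <= f) by (apply Rnot_lt_le; intros h; nra).
  assert (F2 : e <= 719 / 1000 * f).
  { apply Rnot_lt_le; intros h.
    assert (719 / 1000 * f * (719 / 1000 * f) < e * e) by (apply Rmult_le_0_lt_compat; lra). lra. }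
  assert (r <= f) by (apply Rmax_lub; lra). lra. }
assert (Cp : C p) by (apply HC; exists d; left; auto).
assert (Np : edist (0, 0) p <= 230).
{ destruct (core_size z Hp) as [X Y].
  assert (N : fst p * fst p + snd p * snd p = fst z * fst z + snd z * snd z).
  { assert (E := d2_unframe s d (0, 0) p); fold z in E.
    replace (unframe s d (0, 0)) with (0, 0) in E.
    - unfold d2 in E; cbn [fst snd] in E; lra.
    - destruct s, d as [[[] []] []]; unfold unframe, psi, turn, rho, actinv, sg; simpl; f_equal; ring. }
  apply Rlt_le, edist_lt_sqr; [lra|]; unfold d2; cbn [fst snd].
  assert (fst z * fst z <= 219 * 219) by (apply Rmult_le_compat; lra).
  assert (0 <= (56 - snd z) * (56 + snd z)) by (apply Rmult_le_pos; lra). lra. }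
apply (not_medial C m PC); auto.
assert (Sw : forall x, closest C m x -> switch s x).
{ intros x [Cx Hx]; apply HC'; auto.
  assert (T1 := edist_triangle (0, 0) p x); assert (T2 := edist_triangle p m x).
  assert (T3 := Hx p Cp); rewrite (edist_sym m p) in T3.
  assert (T4 : edist (0, 0) x < 400) by lra.
  apply sqr_lt_edist in T4; unfold d2 in T4; simpl in T4; lra. }
intros x y Hx Hy; apply (switch_closest_unique s C m dm); auto.
Qed.

(** * Links and legs *)

(* The link leaving along the unit vector (C, S) is an arc of the circle through
   400 (C, S) orthogonal to both the circle |q| = 400 and the line x = 1000. *)
Definition lyc (C S : R) : R := (400 - 1000 * C) / S.
Definition lR (C S : R) : R := (1000 - 400 * C) / S.
Definition lcen (C S : R) : point := (1000, lyc C S).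
Definition lT (C S : R) : point := (400 * C, 400 * S).
Definition lQ (C S : R) : point := (1000, lyc C S + lR C S).

(** Only directions of the upper half plane; the rays below are handled by the reflection
    [lower]. *)
Definition is_dir (C S : R) : Prop := C * C + S * S = 1 /\ 0 < S.

Lemma is_dir_C C S : is_dir C S -> -1 < C < 1.
Proof. intros [H1 H2]; split; nra. Qed.

Lemma lR_pos C S : is_dir C S -> 0 < lR C S.
Proof.
intros H; assert (B := is_dir_C C S H); destruct H; apply Rdiv_lt_0_compat; lra.
Qed.

Lemma lT_rel C S : is_dir C S ->
  fst (lT C S) - 1000 = - (lR C S * S) /\ snd (lT C S) - lyc C S = lR C S * C.
Proof.
intros [H1 H2]; unfold lT, lyc, lR; simpl; split; [field; lra|].
apply Rmult_eq_reg_r with S; [|lra].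
replace ((400 * S - (400 - 1000 * C) / S) * S) with (400 * (S * S) - 400 + 1000 * C) by (field; lra).
replace ((1000 - 400 * C) / S * C * S) with (1000 * C - 400 * (C * C)) by (field; lra). lra.
Qed.

Lemma lQ_rel C S :
  fst (lQ C S) - 1000 = 0 /\ snd (lQ C S) - lyc C S = lR C S.
Proof. unfold lQ; simpl; split; ring. Qed.

Lemma link_radius C S : is_dir C S ->
  d2 (lcen C S) (lT C S) = lR C S * lR C S /\ d2 (lcen C S) (lQ C S) = lR C S * lR C S.
Proof.
intros H; destruct (lT_rel C S H) as [E1 E2], (lQ_rel C S) as [E3 E4], H as [H1 H2].
unfold d2; split.
- transitivity ((fst (lT C S) - 1000) * (fst (lT C S) - 1000) +
                (snd (lT C S) - lyc C S) * (snd (lT C S) - lyc C S)); [unfold lcen; simpl; ring|].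
  rewrite E1, E2; transitivity (lR C S * lR C S * (C * C + S * S)); [ring|rewrite H1; ring].
- transitivity ((fst (lQ C S) - 1000) * (fst (lQ C S) - 1000) +
                (snd (lQ C S) - lyc C S) * (snd (lQ C S) - lyc C S)); [unfold lcen; simpl; ring|].
  rewrite E3, E4; ring.
Qed.

Lemma link_cross C S : is_dir C S -> cross (lcen C S) (lT C S) (lQ C S) < 0.
Proof.
intros H; assert (R := lR_pos C S H).
destruct (lT_rel C S H) as [E1 E2], (lQ_rel C S) as [E3 E4], H as [H1 H2].
replace (cross (lcen C S) (lT C S) (lQ C S))
  with ((fst (lT C S) - 1000) * (snd (lQ C S) - lyc C S)
        - (snd (lT C S) - lyc C S) * (fst (lQ C S) - 1000)) by (unfold cross, lcen; simpl; ring).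
rewrite E1, E2, E3, E4; assert (0 < lR C S * S) by nra; nra.
Qed.

Definition ulink (C S : R) : point -> Prop := marc (lcen C S) (lT C S) (lQ C S).

Lemma ulink_arc C S : is_dir C S -> is_arc (ulink C S) (lT C S) (lQ C S).
Proof.
intros H; destruct (link_radius C S H) as [E1 E2].
apply marc_arc; [congruence|apply Rlt_not_eq, link_cross; auto].
Qed.

Lemma ulink_coordinates C S q : is_dir C S -> ulink C S q ->
  exists l n, 0 <= l /\ 0 <= n /\ l * l + n * n + 2 * C * l * n = 1 /\
    fst q = 1000 - l * (lR C S * S) /\
    snd q = lyc C S + lR C S * (l * C + n).
Proof.
intros H [E (l & n & Hl & Hn & D)].
assert (R := lR_pos C S H).
destruct (link_radius C S H) as [F1 F2]; rewrite F1 in E.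
destruct (lT_rel C S H) as [E1 E2], (lQ_rel C S) as [E3 E4], H as [H1 H2].
exists l, n; split; auto; split; auto.
assert (X : fst q = 1000 - l * (lR C S * S)).
{ rewrite D; unfold lcen; cbn [fst snd]; rewrite E1, E3; ring. }
assert (Y : snd q = lyc C S + lR C S * (l * C + n)).
{ rewrite D; unfold lcen; cbn [fst snd]; rewrite E2, E4; ring. }
split; auto.
unfold d2, lcen in E; cbn [fst snd] in E; rewrite X, Y in E.
apply Rmult_eq_reg_l with (lR C S * lR C S); [|nra].
rewrite Rmult_1_r; etransitivity; [|exact E].
transitivity (lR C S * lR C S * (l * l * (C * C + S * S) + 2 * C * l * n + n * n)); [rewrite H1|]; ring.
Qed.

(** Separating data for gluing: a link touches the line x = 1000, the circle of radius 400 and the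
    normal at the end of its ray only at an end point. The equation shows that all these circles
    pass through the two points of the horizontal axis with x^2 - 2000 x + 160000 = 0, so distinct
    ones meet nowhere else. *)
Lemma ulink_facts C S q : is_dir C S -> ulink C S q ->
  (fst q <= 1000 /\ (fst q = 1000 -> q = lQ C S)) /\
  (160000 <= fst q * fst q + snd q * snd q /\
   (fst q * fst q + snd q * snd q = 160000 -> q = lT C S)) /\
  400 * S <= snd q /\
  S * (fst q * fst q + snd q * snd q - 2000 * fst q + 160000) = 2 * (400 - 1000 * C) * snd q /\
  (400 <= C * fst q + S * snd q /\ (C * fst q + S * snd q = 400 -> q = lT C S)).
Proof.
intros H Hq; destruct (ulink_coordinates C S q H Hq) as (l & n & Hl & Hn & E & X & Y).
assert (R := lR_pos C S H); assert (B := is_dir_C C S H).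
destruct (lT_rel C S H) as [T1 T2]; assert (H1 := proj1 H); assert (H2 := proj2 H).
destruct (cone_coefficients 1 C l n) as (K1 & K2 & K3); try lra.
assert (IsT : n = 0 -> q = lT C S).
{ intros ->; assert (Z : (l - 1) * (l + 1) = 0) by lra.
  apply Rmult_integral in Z; assert (l = 1) by lra; subst l.
  destruct q as [qx qy]; cbn [fst snd] in *; unfold lT in *; cbn [fst snd] in *; f_equal; lra. }
assert (LN : l - n <= 1).
{ apply Rnot_lt_le; intros h; assert (0 <= l * n) by nra.
  assert (1 < (l - n) * (l - n)) by nra. nra. }
assert (SR : S * lR C S = 1000 - 400 * C) by (unfold lR; field; lra).
assert (SY : S * lyc C S = 400 - 1000 * C) by (unfold lyc; field; lra).
assert (Ey : snd q - 400 * S = lR C S * (C * (l - 1) + n)).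
{ rewrite Y; unfold lT in T2; cbn [fst snd] in T2; lra. }
assert (Nrm : S * (fst q * fst q + snd q * snd q - 160000) =
  2 * lR C S * (1000 * (1 - l - n * C) + 400 * (n - C * (1 - l)))).
{ apply Rmult_eq_reg_l with S; [|lra].
  transitivity ((S * fst q) * (S * fst q) + (S * snd q) * (S * snd q) - 160000 * (S * S)); [ring|].
  assert (SX : S * fst q = 1000 * S - l * S * (1000 - 400 * C)) by (rewrite X, <- SR; ring).
  assert (SYq : S * snd q = 400 - 1000 * C + (1000 - 400 * C) * (l * C + n)).
  { rewrite Y, <- SR, <- SY; ring. }
  rewrite SX, SYq.
  transitivity (2 * (S * lR C S) * (1000 * (1 - l - n * C) + 400 * (n - C * (1 - l)))); [|ring].
  rewrite SR; set (A := 1000 - 400 * C).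
  assert (S2 : S * S = 1 - C * C) by lra.
  transitivity ((S * S) * (1000 - l * A) * (1000 - l * A)
     + (400 - 1000 * C + A * (l * C + n)) * (400 - 1000 * C + A * (l * C + n)) - 160000 * (S * S)); [ring|].
  rewrite S2.
  transitivity (A * A * (l * l + n * n + 2 * C * l * n) - 2000 * l * A * (1 - C * C)
    + 2 * A * (400 - 1000 * C) * (l * C + n) + 840000 * (1 - C * C)
    + (400 - 1000 * C) * (400 - 1000 * C)); [ring|].
  rewrite E; unfold A; ring. }
assert (Pos : 0 <= 1000 * (1 - l - n * C) + 400 * (n - C * (1 - l))).
{ assert (0 <= (1 - C) * (1 - l + n)) by (apply Rmult_le_pos; lra). lra. }
split; [|split; [|split; [|split]]].
- split; [rewrite X; assert (0 <= l * (lR C S * S)) by (apply Rmult_le_pos; nra); lra|].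
  intros F; rewrite X in F.
  assert (Z : l * (lR C S * S) = 0) by lra.
  assert (0 < lR C S * S) by (apply Rmult_lt_0_compat; auto).
  assert (l = 0) by (apply Rmult_integral in Z; destruct Z; lra); subst l.
  assert (Z2 : (n - 1) * (n + 1) = 0) by lra.
  apply Rmult_integral in Z2; assert (n = 1) by lra; subst n.
  destruct q as [qx qy]; cbn [fst snd] in *; unfold lQ; f_equal; lra.
- split.
  + apply Rnot_lt_le; intros h.
    assert (S * (fst q * fst q + snd q * snd q - 160000) < 0) by nra.
    assert (0 <= 2 * lR C S * (1000 * (1 - l - n * C) + 400 * (n - C * (1 - l))))
      by (apply Rmult_le_pos; lra). lra.
  + intros F; apply IsT; rewrite F in Nrm.
    destruct (Req_dec n 0) as [h|h]; auto; exfalso; specialize (K3 h).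
    assert (0 <= (1 - C) * (1 - l + n)) by (apply Rmult_le_pos; lra).
    assert (0 < 2 * lR C S * (1000 * (1 - l - n * C) + 400 * (n - C * (1 - l))))
      by (apply Rmult_lt_0_compat; lra). lra.
- assert (0 <= lR C S * (C * (l - 1) + n)) by (apply Rmult_le_pos; lra). lra.
- replace (S * (fst q * fst q + snd q * snd q - 2000 * fst q + 160000))
    with (S * (fst q * fst q + snd q * snd q - 160000) + 320000 * S - 2000 * (S * fst q)) by ring.
  rewrite Nrm.
  apply Rmult_eq_reg_l with S; [|lra].
  assert (SX : S * fst q = 1000 * S - l * S * (1000 - 400 * C)) by (rewrite X, <- SR; ring).
  assert (SYq : S * snd q = 400 - 1000 * C + (1000 - 400 * C) * (l * C + n)).
  { rewrite Y, <- SR, <- SY; ring. }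
  rewrite SX; replace (S * (2 * (400 - 1000 * C) * snd q)) with (2 * (400 - 1000 * C) * (S * snd q)) by ring.
  rewrite SYq.
  transitivity (2 * (S * lR C S) * (1000 * (1 - l - n * C) + 400 * (n - C * (1 - l)))
    + 320000 * (S * S) - 2000 * (1000 * (S * S) - l * (S * S) * (1000 - 400 * C))); [ring|].
  rewrite SR; replace (S * S) with (1 - C * C) by lra; ring.
- assert (F : C * fst q + S * snd q = 400 + (1000 - 400 * C) * n).
  { transitivity (C * 1000 - C * l * (S * lR C S) + S * lyc C S + S * lR C S * (l * C + n));
      [rewrite X, Y; ring|rewrite SY, SR; ring]. }
  rewrite F; split.
  + assert (0 <= (1000 - 400 * C) * n) by (apply Rmult_le_pos; lra). lra.
  + intros G; apply IsT.
    assert (Z : (1000 - 400 * C) * n = 0) by lra.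
    apply Rmult_integral in Z; destruct Z; lra.
Qed.

Definition dirC (b1 b3 : bool) : R := sg b1 (if b3 then s8 else c8).
Definition dirS (b3 : bool) : R := if b3 then c8 else s8.

Lemma is_dir_dih b1 b3 : is_dir (dirC b1 b3) (dirS b3).
Proof. cs_facts; unfold dirC, dirS, sg, is_dir; destruct b1, b3; split; lra. Qed.

Definition lower (b : bool) (q : point) : point := if b then refl q else q.

Definition link (d : dih) (q : point) : Prop :=
  let '(b1, b2, b3) := d in ulink (dirC b1 b3) (dirS b3) (lower b2 q).

Definition Qpt (d : dih) : point :=
  let '(b1, b2, b3) := d in lower b2 (lQ (dirC b1 b3) (dirS b3)).
Definition Ppt (s : bool) (d : dih) : point := frame s d P0.
Definition Npt (d : dih) : point := frame false d N2.
Definition J4pt (d : dih) : point := frame false d J4.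
Definition Tpt (d : dih) : point := frame false d J5.

Definition legcore (s : bool) (d : dih) (q : point) : Prop := core (unframe s d q).
Definition ray (d : dih) (q : point) : Prop := seg J4 J5 (unframe false d q).
Definition tail (d : dih) (q : point) : Prop := ray d q \/ link d q.
Definition leg (s : bool) (d : dih) (q : point) : Prop := legcore s d q \/ tail d q.

Lemma frame_N2 s d : frame s d N2 = Npt d.
Proof. unfold Npt, N2; rewrite !frame_axis; auto. Qed.
Lemma frame_J4 s d : frame s d J4 = J4pt d.
Proof. unfold J4pt, J4; rewrite !frame_axis; auto. Qed.
Lemma frame_J5 s d : frame s d J5 = Tpt d.
Proof. unfold Tpt, J5; rewrite !frame_axis; auto. Qed.

(** Rays are fixed by the reflection exchanging the states; hence [tail] carries no state and can be
    sampled once for all configurations. *)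
Lemma ray_state s d q : seg J4 J5 (unframe s d q) <-> ray d q.
Proof.
assert (A : forall s s' z, seg J4 J5 (unframe s d z) -> unframe s' d z = unframe s d z).
{ intros a b z H; assert (E := frame_unframe a d z).
  destruct (ray_coordinates _ H) as [_ H0].
  set (w := unframe a d z) in *.
  assert (Ew : w = (fst w, 0)) by (destruct w; simpl in *; congruence).
  rewrite <- E, Ew, frame_axis, <- (frame_axis b d (fst w)), unframe_frame; auto. }
unfold ray; split; intros H.
- rewrite (A s false); auto.
- rewrite (A false s); auto.
Qed.

Lemma switch_leg s q : switch s q <-> exists d, legcore s d q \/ ray d q.
Proof.
unfold switch, sigma, legcore; split; intros [d [H|H]]; exists d; auto; right;
  apply (ray_state s); auto.
Qed.

(** Position along the ray [d], the same in both states. The pieces of a leg occupy the successive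
    ranges up to 114, 114 to 219, 219 to 400 and from 400 on, and share only the junctions. *)
Definition Xd (d : dih) (q : point) : R := fst (unframe false d q).

Lemma Xd_state s d q : fst (unframe s d q) = Xd d q.
Proof.
destruct s; auto; unfold Xd, unframe; set (a := actinv d q); unfold turn, rho, psi; simpl.
assert (U := c8s8_unit); assert (D := c8s8_diag); unfold k8.
transitivity ((c8 * c8 - s8 * s8 + 2 * (s8 * s8)) * (c8 * fst a)
              + (2 * (c8 * c8) - 2 * s8 * c8) * (s8 * snd a)).
- rewrite D; ring.
- rewrite <- D.
  replace (c8 * c8 - s8 * s8 + 2 * (s8 * s8)) with (c8 * c8 + s8 * s8) by ring.
  replace (2 * (c8 * c8) - (c8 * c8 - s8 * s8)) with (c8 * c8 + s8 * s8) by ring.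
  rewrite U; ring.
Qed.

Lemma Xd_link d q : let '(b1, b2, b3) := d in
  Xd d q = dirC b1 b3 * fst (lower b2 q) + dirS b3 * snd (lower b2 q).
Proof.
destruct d as [[[] []] []]; unfold Xd, unframe, psi, turn, actinv, dirC, dirS, lower, refl, sg; simpl; ring.
Qed.

Lemma Tpt_link b1 b2 b3 : Tpt (b1, b2, b3) = lower b2 (lT (dirC b1 b3) (dirS b3)).
Proof.
unfold Tpt, J5; rewrite frame_axis.
destruct b1, b2, b3; unfold act, lower, refl, lT, dirC, dirS, sg; simpl; f_equal; ring.
Qed.

Lemma lower_lower b q : lower b (lower b q) = q.
Proof. destruct b; simpl; auto using refl_refl. Qed.

Lemma affine_lower b : affine (lower b).
Proof.
destruct b.
- exists 1, 0, 0, 0, (-1), 0; intros q; unfold lower, refl; f_equal; ring.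
- exists 1, 0, 0, 0, 1, 0; intros [x y]; simpl; f_equal; ring.
Qed.

Lemma link_arc d : is_arc (link d) (Tpt d) (Qpt d).
Proof.
destruct d as [[b1 b2] b3]; rewrite Tpt_link.
apply (arc_map (lower b2) (lower b2)); auto using lower_lower, affine_lower.
apply ulink_arc, is_dir_dih.
Qed.

Lemma frame_arc s d K A B : is_arc K A B ->
  is_arc (fun q => K (unframe s d q)) (frame s d A) (frame s d B).
Proof.
apply arc_map; auto using affine_frame, unframe_frame, frame_unframe.
Qed.

Definition legcore_in s d q := core_in (unframe s d q).
Definition legcore_out s d q := core_out (unframe s d q).

Lemma legcore_in_arc s d : is_arc (legcore_in s d) (Ppt s d) (Npt d).
Proof. rewrite <- (frame_N2 s d); apply frame_arc, core_in_arc. Qed.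
Lemma legcore_out_arc s d : is_arc (legcore_out s d) (Npt d) (J4pt d).
Proof. rewrite <- (frame_N2 s d), <- (frame_J4 s d); apply frame_arc, core_out_arc. Qed.
Lemma ray_is_arc d : is_arc (ray d) (J4pt d) (Tpt d).
Proof. apply frame_arc, ray_arc. Qed.

Lemma unframe_inj s d q w : unframe s d q = w -> q = frame s d w.
Proof. intros <-; rewrite frame_unframe; auto. Qed.

Lemma legcore_in_X s d q : legcore_in s d q -> Xd d q <= 114 /\ (Xd d q = 114 -> q = Npt d).
Proof.
intros H; destruct (proj2 core_in_arc _ H) as (I & _ & E).
rewrite Xd_state in I, E; split; [apply I|].
intros F; rewrite <- (frame_N2 s d); apply unframe_inj, E, F.
Qed.

Lemma legcore_out_X s d q : legcore_out s d q ->
  114 <= Xd d q <= 219 /\ (Xd d q = 114 -> q = Npt d) /\ (Xd d q = 219 -> q = J4pt d).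
Proof.
intros H; destruct (proj2 core_out_arc _ H) as (I & E & E').
rewrite Xd_state in I, E, E'; split; [apply I|]; split; intros F.
- rewrite <- (frame_N2 s d); apply unframe_inj, E, F.
- rewrite <- (frame_J4 s d); apply unframe_inj, E', F.
Qed.

Lemma legcore_X s d q : legcore s d q -> Xd d q <= 219 /\ (Xd d q = 219 -> q = J4pt d).
Proof.
intros [H|H].
- destruct (legcore_in_X s d q H); split; [lra|intros; lra].
- destruct (legcore_out_X s d q H) as (A & _ & B); split; [lra|auto].
Qed.

Lemma ray_X d q : ray d q ->
  219 <= Xd d q <= 400 /\ (Xd d q = 219 -> q = J4pt d) /\ (Xd d q = 400 -> q = Tpt d).
Proof.
intros H; destruct (proj2 ray_arc _ H) as (I & E & E').
split; [apply I|]; split; intros F; apply unframe_inj; [apply E, F|apply E', F].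
Qed.

Lemma link_X d q : link d q -> 400 <= Xd d q /\ (Xd d q = 400 -> q = Tpt d).
Proof.
destruct d as [[b1 b2] b3]; intros H.
rewrite (Xd_link (b1, b2, b3) q), Tpt_link.
destruct (ulink_facts _ _ _ (is_dir_dih b1 b3) H) as (_ & _ & _ & _ & A & B).
split; auto; intros E; rewrite <- (B E), lower_lower; auto.
Qed.

Lemma legcore_arc s d : is_arc (legcore s d) (Ppt s d) (J4pt d).
Proof.
apply (arc_concat (legcore_in s d) (legcore_out s d) _ (Npt d));
  [apply legcore_in_arc|apply legcore_out_arc|].
intros q A B; destruct (legcore_in_X s d q A), (legcore_out_X s d q B).
apply H0; lra.
Qed.

Lemma tail_arc d : is_arc (tail d) (J4pt d) (Qpt d).
Proof.
apply (arc_concat (ray d) (link d) _ (Tpt d)); [apply ray_is_arc|apply link_arc|].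
intros q A B; destruct (ray_X d q A) as (A1 & _ & A2), (link_X d q B); apply A2; lra.
Qed.

Lemma tail_X d q : tail d q -> 219 <= Xd d q.
Proof.
intros [A|A]; [destruct (ray_X d q A)|destruct (link_X d q A)]; lra.
Qed.

Lemma leg_arc s d : is_arc (leg s d) (Ppt s d) (Qpt d).
Proof.
apply (arc_concat (legcore s d) (tail d) _ (J4pt d)); [apply legcore_arc|apply tail_arc|].
intros q A B; assert (C := tail_X d q B); destruct (legcore_X s d q A); apply H0; lra.
Qed.

(* The part of the leg beyond the sample N. *)
Definition legout s d q := legcore_out s d q \/ tail d q.

Lemma legout_arc s d : is_arc (legout s d) (Npt d) (Qpt d).
Proof.
apply (arc_concat (legcore_out s d) (tail d) _ (J4pt d)); [apply legcore_out_arc|apply tail_arc|].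
intros q A B; assert (C := tail_X d q B); destruct (legcore_out_X s d q A) as (D & _ & E).
apply E; lra.
Qed.

Lemma legout_X s d q : legout s d q -> 114 <= Xd d q /\ (Xd d q = 114 -> q = Npt d).
Proof.
intros [A|A].
- destruct (legcore_out_X s d q A) as (D & E & _); split; [lra|auto].
- assert (B := tail_X d q A); split; [lra|intros; lra].
Qed.

(** * The curves *)

(** State [false] joins a ray to its reflection in the nearest coordinate axis, state [true] to its
    reflection in the diagonal of its quadrant. *)
Definition partner (s : bool) (d : dih) : dih :=
  let '(b1, b2, b3) := d in
  if s then (b1, b2, negb b3) else if b3 then (negb b1, b2, b3) else (b1, negb b2, b3).

Lemma partner_partner s d : partner s (partner s d) = d.
Proof. destruct s, d as [[[] []] []]; reflexivity. Qed.

Lemma partner_neq s d : partner s d <> d.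
Proof. destruct s, d as [[[] []] []]; discriminate. Qed.

Lemma Ppt_partner s d : Ppt s (partner s d) = Ppt s d.
Proof.
unfold Ppt, frame; rewrite psi_P0.
destruct s, d as [[[] []] []]; unfold act, turn, rho, sg; simpl; f_equal; ring.
Qed.

Ltac dih_cases :=
  try (left; reflexivity); try (right; reflexivity); exfalso; lra.

Lemma act_inj_inside d d' a :
  0 < snd a < fst a -> act d a = act d' a -> d = d'.
Proof.
intros H E; assert (A := f_equal fst E); assert (B := f_equal snd E); clear E.
destruct d as [[[] []] []], d' as [[[] []] []]; unfold act, sg in A, B; simpl in A, B;
  try reflexivity; exfalso; lra.
Qed.

Lemma act_inj_axis d d' a :
  0 < fst a -> snd a = 0 -> act d a = act d' a -> d = d' \/ d' = partner false d.
Proof.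
intros H H0 E; assert (A := f_equal fst E); assert (B := f_equal snd E); clear E.
destruct d as [[[] []] []], d' as [[[] []] []]; unfold act, sg in A, B; simpl in A, B; dih_cases.
Qed.

Lemma act_inj_diag d d' a :
  0 < fst a -> snd a = fst a -> act d a = act d' a -> d = d' \/ d' = partner true d.
Proof.
intros H H0 E; assert (A := f_equal fst E); assert (B := f_equal snd E); clear E.
destruct d as [[[] []] []], d' as [[[] []] []]; unfold act, sg in A, B; simpl in A, B; dih_cases.
Qed.

Lemma unframe_actinv s d q : actinv d q = turn s (psi (unframe s d q)).
Proof. unfold unframe; rewrite psi_psi, turn_turn; auto. Qed.

Lemma sigma_fold s d q : sigma (unframe s d q) -> fold q = turn s (psi (unframe s d q)).
Proof.
intros H; rewrite <- (fold_actinv d q), (unframe_actinv s d q).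
apply fold_id, sigma_in_wedge; auto.
Qed.

Lemma sigma_strict z : sigma z ->
  0 <= snd (psi z) < fst (psi z) /\ (snd (psi z) = 0 -> z = P0).
Proof.
intros H; destruct (sigma_wedge z H) as (A & B & C).
rewrite <- (psi_psi z) in A, B, C.
destruct (psi_forms (psi z)) as [E1 E2]; rewrite E1 in B, C; rewrite E2 in A.
assert (K := k8_pos).
assert (0 < fst (psi z) - snd (psi z)) by (apply Rmult_lt_reg_l with k8; lra).
split; [lra|]; intros E; rewrite psi_psi in C; auto.
Qed.

(** A common point folds to a single point of the wedge. Strictly inside, this determines the
    dihedral element; the only point of a half strand on an edge is [P0], where the stabilizer has
    order two. *)
Lemma switch_disjoint s d d' q :
  sigma (unframe s d q) -> sigma (unframe s d' q) ->
  d = d' \/ (d' = partner s d /\ q = Ppt s d).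
Proof.
intros H H'; set (z := unframe s d q).
assert (F := sigma_fold s d q H); assert (F' := sigma_fold s d' q H').
assert (Eq : q = act d (fold q)) by (rewrite F, <- unframe_actinv, act_actinv; auto).
assert (Eq' : q = act d' (fold q)) by (rewrite F', <- unframe_actinv, act_actinv; auto).
assert (E : act d (fold q) = act d' (fold q)) by congruence.
destruct (sigma_strict z H) as [A B]; assert (K := k8_pos).
fold z in F; set (b := psi z) in *.
assert (PP : z = P0 -> q = Ppt s d) by (intros Ez; rewrite <- (frame_unframe s d q); fold z; rewrite Ez; auto).
destruct s; simpl in F.
- assert (X : fst (fold q) = k8 * (fst b + snd b)) by (rewrite F; auto).
  assert (Y : snd (fold q) = k8 * (fst b - snd b)) by (rewrite F; auto).
  clear F F'.
  destruct (Req_dec (snd b) 0) as [e|e].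
  + destruct (act_inj_diag d d' (fold q)) as [h|h]; auto.
    * rewrite X; apply Rmult_lt_0_compat; lra.
    * rewrite X, Y, e; ring.
  + left; apply act_inj_inside with (fold q); auto; rewrite X, Y; split.
    * apply Rmult_lt_0_compat; lra.
    * apply Rmult_lt_compat_l; lra.
- rewrite F in E; destruct (Req_dec (snd b) 0) as [e|e].
  + destruct (act_inj_axis d d' b) as [h|h]; auto; lra.
  + left; apply act_inj_inside with b; auto; lra.
Qed.

Lemma norm_unframe s d q :
  fst (unframe s d q) * fst (unframe s d q) + snd (unframe s d q) * snd (unframe s d q)
  = fst q * fst q + snd q * snd q.
Proof.
assert (E := d2_unframe s d (0, 0) q).
replace (unframe s d (0, 0)) with (0, 0) in E.
- unfold d2 in E; cbn [fst snd] in E; lra.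
- destruct s, d as [[[] []] []]; unfold unframe, psi, turn, rho, actinv, sg; simpl; f_equal; ring.
Qed.

Lemma lower_norm b q :
  fst (lower b q) * fst (lower b q) + snd (lower b q) * snd (lower b q)
  = fst q * fst q + snd q * snd q.
Proof. destruct b; unfold lower, refl; simpl; ring. Qed.

Lemma link_norm d q : link d q ->
  160000 <= fst q * fst q + snd q * snd q /\
  (fst q * fst q + snd q * snd q = 160000 -> q = Tpt d).
Proof.
destruct d as [[b1 b2] b3]; intros H; rewrite Tpt_link.
destruct (ulink_facts _ _ _ (is_dir_dih b1 b3) H) as (_ & [A B] & _).
rewrite lower_norm in A, B; split; auto; intros E.
rewrite <- (B E), lower_lower; auto.
Qed.

Lemma Tpt_inj d d' : Tpt d = Tpt d' -> d = d'.
Proof.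
unfold Tpt, J5; rewrite !frame_axis; apply act_inj_inside; cs_facts; simpl; lra.
Qed.

(** A point off the horizontal axis lies on one circle of the pencil only, and the parameter (400 -
    1000 C)/S takes different values at the four rays of a half plane. *)
Lemma link_disjoint d d' q : link d q -> link d' q -> d = d'.
Proof.
destruct d as [[b1 b2] b3], d' as [[b1' b2'] b3']; intros H H'.
destruct (ulink_facts _ _ _ (is_dir_dih b1 b3) H) as (_ & _ & Y & E & _).
destruct (ulink_facts _ _ _ (is_dir_dih b1' b3') H') as (_ & _ & Y' & E' & _).
assert (S := proj2 (is_dir_dih b1 b3)); assert (S' := proj2 (is_dir_dih b1' b3')).
assert (Eb : b2 = b2').
{ destruct b2, b2'; auto; exfalso; unfold lower, refl in Y, Y'; simpl in Y, Y'; lra. }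
subst b2'; set (w := lower b2 q) in *.
assert (F : dirS b3' * (400 - 1000 * dirC b1 b3) = dirS b3 * (400 - 1000 * dirC b1' b3')).
{ apply Rmult_eq_reg_r with (2 * snd w); [|lra].
  transitivity (dirS b3' * (2 * (400 - 1000 * dirC b1 b3) * snd w)); [ring|].
  transitivity (dirS b3 * (2 * (400 - 1000 * dirC b1' b3') * snd w)); [|ring].
  rewrite <- E, <- E'; ring. }
clear E E' Y Y' H H' S S'; cs_facts.
assert (0 < s8 * c8) by (apply Rmult_lt_0_compat; lra).
assert (s8 * s8 < 4 / 10 * (4 / 10)) by (apply Rmult_le_0_lt_compat; lra).
assert (9 / 10 * (9 / 10) < c8 * c8) by (apply Rmult_le_0_lt_compat; lra).
destruct b1, b3, b1', b3'; auto; exfalso; unfold dirC, dirS, sg in F; lra.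
Qed.

Lemma leg_cases s d q : leg s d q -> sigma (unframe s d q) \/ link d q.
Proof.
intros [H|[H|H]]; auto; left; [left|right; apply ray_state]; auto.
Qed.

Lemma sigma_J5 s d q : sigma (unframe s d q) ->
  fst q * fst q + snd q * snd q <= 160000 /\
  (fst q * fst q + snd q * snd q = 160000 -> q = Tpt d).
Proof.
intros H; destruct (sigma_norm _ H) as [A B]; rewrite norm_unframe in A, B.
split; auto; intros E; rewrite <- (frame_J5 s d); apply unframe_inj; auto.
Qed.

Lemma leg_disjoint s d d' q : leg s d q -> leg s d' q ->
  d = d' \/ (d' = partner s d /\ q = Ppt s d).
Proof.
intros H H'; apply leg_cases in H; apply leg_cases in H'.
destruct H as [H|H], H' as [H'|H'].
- apply switch_disjoint; auto.
- left; destruct (sigma_J5 s d q H), (link_norm d' q H').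
  apply Tpt_inj; rewrite <- H1, <- H3; auto; lra.
- left; destruct (sigma_J5 s d' q H'), (link_norm d q H).
  apply Tpt_inj; rewrite <- H1, <- H3; auto; lra.
- left; apply (link_disjoint d d' q); auto.
Qed.

Lemma fst_lower b q : fst (lower b q) = fst q.
Proof. destruct b; auto. Qed.

Lemma leg_right s d q : leg s d q -> fst q <= 1000 /\ (fst q = 1000 -> q = Qpt d).
Proof.
intros H; apply leg_cases in H; destruct H as [H|H].
- destruct (sigma_J5 s d q H) as [A _].
  assert (0 <= snd q * snd q) by apply Rle_0_sqr.
  assert (fst q < 1000); [|split; [lra|intros; lra]].
  apply Rnot_le_lt; intros h; assert (1000 * 1000 <= fst q * fst q) by (apply Rmult_le_compat; lra). lra.
- destruct d as [[b1 b2] b3].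
  destruct (ulink_facts _ _ _ (is_dir_dih b1 b3) H) as ([A B] & _).
  rewrite fst_lower in A, B; split; auto; intros E; simpl.
  rewrite <- (B E), lower_lower; auto.
Qed.

Lemma Qpt_fst d : fst (Qpt d) = 1000.
Proof. destruct d as [[b1 b2] b3]; simpl; rewrite fst_lower; auto. Qed.

Lemma Qpt_inj d d' : Qpt d = Qpt d' -> d = d'.
Proof.
intros E; apply (link_disjoint d d' (Qpt d)).
- apply arc_end with (Tpt d), link_arc.
- rewrite E; apply arc_end with (Tpt d'), link_arc.
Qed.

Lemma leg_Qpt s d d' : leg s d (Qpt d') -> d = d'.
Proof.
intros H; destruct (leg_right s d _ H) as [_ A].
symmetry; apply Qpt_inj, A, Qpt_fst.
Qed.

Definition mir (q : point) : point := (2000 - fst q, snd q).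

Lemma mir_mir q : mir (mir q) = q.
Proof. destruct q; unfold mir; simpl; f_equal; ring. Qed.

Lemma affine_mir : affine mir.
Proof. exists (-1), 0, 2000, 0, 1, 0; intros q; unfold mir; f_equal; ring. Qed.

Lemma mir_Qpt d : mir (Qpt d) = Qpt d.
Proof.
assert (E := Qpt_fst d); unfold mir; destruct (Qpt d) as [x y]; simpl in *.
rewrite E; f_equal; ring.
Qed.

(** A whole strand of the left switch with both of its legs, from the mirror line back to it; the
    primed version is its image at the right switch. *)
Definition tarc (s : bool) (d : dih) (q : point) : Prop := leg s d q \/ leg s (partner s d) q.
Definition tarc' (s : bool) (d : dih) (q : point) : Prop := tarc s d (mir q).

Lemma tarc_arc s d : is_arc (tarc s d) (Qpt d) (Qpt (partner s d)).
Proof.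
apply (arc_concat (leg s d) (leg s (partner s d)) _ (Ppt s d)).
- apply arc_rev, leg_arc.
- rewrite <- Ppt_partner; apply leg_arc.
- intros q H H'; destruct (leg_disjoint s d (partner s d) q H H') as [h|[_ h]]; auto.
  exfalso; apply (partner_neq s d); auto.
Qed.

Lemma tarc'_arc s d : is_arc (tarc' s d) (Qpt d) (Qpt (partner s d)).
Proof.
rewrite <- (mir_Qpt d), <- (mir_Qpt (partner s d)).
apply (arc_map mir mir); auto using mir_mir, affine_mir, tarc_arc.
Qed.

Lemma tarc_right s d q : tarc s d q ->
  fst q <= 1000 /\ (fst q = 1000 -> exists x, q = Qpt x /\ (x = d \/ x = partner s d)).
Proof.
intros [H|H]; destruct (leg_right _ _ _ H) as [A B]; split; auto; intros E; eauto.
Qed.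

Lemma tarc_disjoint s d d' q : tarc s d q -> tarc s d' q -> d' = d \/ d' = partner s d.
Proof.
intros [H|H] [H'|H']; destruct (leg_disjoint _ _ _ _ H H') as [E|[E _]].
- auto.
- auto.
- right; rewrite E, partner_partner; auto.
- left; rewrite <- (partner_partner s d'), E, partner_partner; auto.
- auto.
- left; rewrite E, partner_partner; auto.
- left; rewrite <- (partner_partner s d'), <- E, partner_partner; auto.
- rewrite partner_partner in E; right; rewrite <- (partner_partner s d'), E; auto.
Qed.

Lemma tarc'_disjoint s d d' q : tarc' s d q -> tarc' s d' q -> d' = d \/ d' = partner s d.
Proof. apply tarc_disjoint. Qed.

Lemma tarc_tarc' a b d d' q : tarc a d q -> tarc' b d' q ->
  exists x, q = Qpt x /\ (x = d \/ x = partner a d) /\ (x = d' \/ x = partner b d').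
Proof.
intros H H'; destruct (tarc_right a d q H) as [A B], (tarc_right b d' _ H') as [A' B'].
simpl in A', B'.
destruct B as [x [Ex Hx]]; [lra|]; destruct B' as [y [Ey Hy]]; [lra|].
exists x; split; auto; split; auto.
assert (Exy : x = y).
{ apply Qpt_inj; rewrite <- Ex, <- (mir_mir q), Ey, mir_Qpt; auto. }
subst; auto.
Qed.

(* State a at the left switch, state b at the right one. *)
Definition config (a b : bool) (q : point) : Prop :=
  (exists d, leg a d q) \/ (exists d, leg b d (mir q)).

Lemma config_mir a b q : config a b q <-> config b a (mir q).
Proof. unfold config; rewrite mir_mir; tauto. Qed.

Definition ring (s : bool) (d : dih) (q : point) : Prop := tarc s d q \/ tarc' s d q.

Lemma ring_meet s d q : tarc s d q -> tarc' s d q -> q = Qpt d \/ q = Qpt (partner s d).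
Proof.
intros H H'; destruct (tarc_tarc' s s d d q H H') as (x & -> & [->| ->] & _); auto.
Qed.

Lemma ring_closed_curve s d : closed_curve (ring s d).
Proof.
apply (arcs_closed_curve (tarc s d) (tarc' s d) (Qpt d) (Qpt (partner s d))).
- apply tarc_arc.
- apply arc_rev, tarc'_arc.
- apply ring_meet.
Qed.

Lemma ring_disjoint s d d' q : ring s d q -> ring s d' q -> d' = d \/ d' = partner s d.
Proof.
intros [H|H] [H'|H'].
- apply (tarc_disjoint s d d' q); auto.
- destruct (tarc_tarc' s s d d' q H H') as (x & _ & [->| ->] & [E|E]); auto.
  + right; rewrite E, partner_partner; auto.
  + left; rewrite <- (partner_partner s d'), <- E, partner_partner; auto.
- destruct (tarc_tarc' s s d' d q H' H) as (x & _ & [->| ->] & [E|E]); auto.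
  + right; rewrite <- E, partner_partner; auto.
  + left; rewrite <- (partner_partner s d'), E, partner_partner; auto.
- apply (tarc'_disjoint s d d' q); auto.
Qed.

Definition ff : dih := (false, false, false).

(* When the two states differ, all arcs form one cycle; this is the part of it
   complementary to [tarc a ff]. *)
Definition chain_rest (a : bool) (q : point) : Prop :=
  let b := negb a in
  let e1 := partner a ff in let e2 := partner b e1 in
  let e3 := partner a e2 in let e4 := partner b e3 in
  let e5 := partner a e4 in let e6 := partner b e5 in
  let e7 := partner a e6 in
  ((((((tarc' b e1 q \/ tarc a e2 q) \/ tarc' b e3 q) \/ tarc a e4 q)
    \/ tarc' b e5 q) \/ tarc a e6 q) \/ tarc' b e7 q).

(** Different arcs on the same side are disjoint, and arcs on opposite sides meet only at points
    [Qpt]; comparing the indices then leaves the intended junction or a contradiction. *)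
Ltac meet :=
  let q := fresh "q" in let h := fresh "h" in let h' := fresh "h'" in
  intros q h h';
  repeat match type of h with _ \/ _ => destruct h as [h|h] end;
  match type of h with
  | tarc _ _ _ => match type of h' with
     | tarc _ _ _ => exfalso; destruct (tarc_disjoint _ _ _ _ h h') as [E|E]; discriminate E
     | tarc' _ _ _ => destruct (tarc_tarc' _ _ _ _ _ h h') as (x & -> & [->| ->] & [E|E]);
                      try discriminate E; simpl; auto
     end
  | tarc' _ _ _ => match type of h' with
     | tarc' _ _ _ => exfalso; destruct (tarc'_disjoint _ _ _ _ h h') as [E|E]; discriminate E
     | tarc _ _ _ => destruct (tarc_tarc' _ _ _ _ _ h' h) as (x & -> & [->| ->] & [E|E]);
                      try discriminate E; simpl; auto
     end
  end.

(** Alternating the involutions [partner a] and [partner (negb a)] runs through the eight rays in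
    cyclic order, so the arcs close up only when all are used. With equal states the walk returns
    after two arcs, whence the four curves of [rings]. *)
Lemma chain_rest_arc a : is_arc (chain_rest a) (Qpt (partner a ff)) (Qpt ff).
Proof.
unfold chain_rest; cbv zeta.
destruct a; simpl negb; cbn [partner ff negb].
- apply (arc_concat _ (tarc' false (false, true, false)) _ (Qpt (false, true, false)));
    [|apply (tarc'_arc false (false, true, false))|meet].
  apply (arc_concat _ (tarc true (false, true, true)) _ (Qpt (false, true, true)));
    [|apply (tarc_arc true (false, true, true))|meet].
  apply (arc_concat _ (tarc' false (true, true, true)) _ (Qpt (true, true, true)));
    [|apply (tarc'_arc false (true, true, true))|meet].
  apply (arc_concat _ (tarc true (true, true, false)) _ (Qpt (true, true, false)));
    [|apply (tarc_arc true (true, true, false))|meet].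
  apply (arc_concat _ (tarc' false (true, false, false)) _ (Qpt (true, false, false)));
    [|apply (tarc'_arc false (true, false, false))|meet].
  apply (arc_concat _ (tarc true (true, false, true)) _ (Qpt (true, false, true)));
    [|apply (tarc_arc true (true, false, true))|meet].
  apply (tarc'_arc false (false, false, true)).
- apply (arc_concat _ (tarc' true (false, false, true)) _ (Qpt (false, false, true)));
    [|apply (tarc'_arc true (false, false, true))|meet].
  apply (arc_concat _ (tarc false (true, false, true)) _ (Qpt (true, false, true)));
    [|apply (tarc_arc false (true, false, true))|meet].
  apply (arc_concat _ (tarc' true (true, false, false)) _ (Qpt (true, false, false)));
    [|apply (tarc'_arc true (true, false, false))|meet].
  apply (arc_concat _ (tarc false (true, true, false)) _ (Qpt (true, true, false)));
    [|apply (tarc_arc false (true, true, false))|meet].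
  apply (arc_concat _ (tarc' true (true, true, true)) _ (Qpt (true, true, true)));
    [|apply (tarc'_arc true (true, true, true))|meet].
  apply (arc_concat _ (tarc false (false, true, true)) _ (Qpt (false, true, true)));
    [|apply (tarc_arc false (false, true, true))|meet].
  apply (tarc'_arc true (false, true, false)).
Qed.

Lemma chain_rest_meet a q :
  tarc a ff q -> chain_rest a q -> q = Qpt ff \/ q = Qpt (partner a ff).
Proof.
unfold chain_rest; cbv zeta; intros H H'; revert q H' H.
destruct a; simpl negb; cbn [partner ff negb]; meet.
Qed.

Lemma config_chain a q : config a (negb a) q <-> tarc a ff q \/ chain_rest a q.
Proof.
unfold config, chain_rest, tarc', tarc; cbv zeta; split.
- intros [[d H]|[d H]]; destruct a, d as [[[] []] []]; simpl in *; tauto.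
- intros H; destruct a; simpl in H;
    repeat match type of H with _ \/ _ => destruct H as [H|H] end; eauto.
Qed.

Lemma config_connected a : closed_curve (config a (negb a)).
Proof.
apply closed_curve_ext with (fun q => tarc a ff q \/ chain_rest a q).
- intros q; symmetry; apply config_chain.
- apply (arcs_closed_curve (tarc a ff) (chain_rest a) (Qpt ff) (Qpt (partner a ff))).
  + apply tarc_arc.
  + apply chain_rest_arc.
  + apply chain_rest_meet.
Qed.

(** One representative from each of the four pairs of rays exchanged by [partner s]. *)
Definition rings (s : bool) : list (point -> Prop) :=
  if s then [ring true (false, false, false); ring true (false, true, false);
             ring true (true, false, false); ring true (true, true, false)]
  else [ring false (false, false, false); ring false (true, false, false);
        ring false (false, false, true); ring false (false, true, true)].

Lemma rings_disjoint s : disjoint_curves (rings s).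
Proof.
split.
- intros K H; destruct s; simpl in H;
    repeat (destruct H as [<-|H]; [apply ring_closed_curve|]); contradiction.
- assert (L : length (rings s) = 4%nat) by (destruct s; reflexivity); rewrite L.
  intros i j Hi Hj N p [A B].
  destruct i as [|[|[|[|i]]]]; [| | | |lia];
    (destruct j as [|[|[|[|j]]]]; [| | | |lia]); try (exfalso; lia);
    (destruct s; simpl in A, B; destruct (ring_disjoint _ _ _ _ A B) as [E|E]; discriminate E).
Qed.

Lemma union_rings s q : union_of (rings s) q <-> config s s q.
Proof.
unfold union_of, config; split.
- intros (K & HK & Kq); destruct s; simpl in HK;
    repeat (destruct HK as [<-|HK]; [destruct Kq as [[h|h]|[h|h]]; eauto|]); contradiction.
- intros [[d H]|[d H]].
  + destruct s, d as [[[] []] []];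
      match goal with
      | H : leg ?s ?d _ |- _ =>
        first
        [ exists (ring s d); split; [simpl; tauto|left; left; exact H]
        | exists (ring s (partner s d)); split; [simpl; tauto|left; right; exact H] ]
      end.
  + destruct s, d as [[[] []] []];
      match goal with
      | H : leg ?s ?d _ |- _ =>
        first
        [ exists (ring s d); split; [simpl; tauto|right; left; exact H]
        | exists (ring s (partner s d)); split; [simpl; tauto|right; right; exact H] ]
      end.
Qed.

(** The complement of a proximinal set is open, so the complement of each piece serves as the open
    set around the other. *)
Lemma disjoint_disconnected (K1 K2 : point -> Prop) (C : point -> Prop) :
  (forall q, C q <-> K1 q \/ K2 q) -> (forall q, K1 q -> K2 q -> False) ->
  proximinal K1 -> proximinal K2 -> disconnected C.
Proof.
intros E D P1 P2.
assert (O : forall K, proximinal K -> open2 (fun q => ~ K q)).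
{ intros K PK p Np; destruct (proximinal_separated K p PK Np) as [d [Hd H]].
  exists d; split; auto; intros q Hq Kq; specialize (H q Kq); lra. }
destruct (P1 (0, 0)) as [x1 [K1x _]], (P2 (0, 0)) as [x2 [K2x _]].
exists (fun q => ~ K2 q), (fun q => ~ K1 q); split; [auto|]; split; [auto|].
split; [|split; [|split]].
- intros p Cp; apply E in Cp; destruct Cp as [h|h]; [left|right]; eauto.
- exists x1; split; [apply E; auto|eauto].
- exists x2; split; [apply E; auto|eauto].
- intros p Cp [A B]; apply E in Cp; tauto.
Qed.

Lemma rings_disconnected s : disconnected (union_of (rings s)).
Proof.
assert (H : exists d1 d2 d3 d4, rings s = [ring s d1; ring s d2; ring s d3; ring s d4] /\
  d2 <> d1 /\ d2 <> partner s d1 /\ d3 <> d1 /\ d3 <> partner s d1 /\ d4 <> d1 /\ d4 <> partner s d1).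
{ destruct s; do 4 eexists; (split; [reflexivity|]); repeat split; discriminate. }
destruct H as (d1 & d2 & d3 & d4 & E & H).
apply (disjoint_disconnected (ring s d1) (fun q => ring s d2 q \/ ring s d3 q \/ ring s d4 q)).
- rewrite E; intros q; unfold union_of; split.
  + intros (K & HK & Kq); simpl in HK.
    repeat (destruct HK as [<-|HK]; [tauto|]); contradiction.
  + intros [h|[h|[h|h]]]; eexists; (split; [|exact h]); simpl; auto.
- intros q A [B|[B|B]]; destruct (ring_disjoint s _ _ _ A B); tauto.
- apply closed_curve_proximinal, ring_closed_curve.
- assert (PR : forall d, proximinal (ring s d))
    by (intros d; apply closed_curve_proximinal, ring_closed_curve).
  apply (proximinal_union (ring s d2) (fun q => ring s d3 q \/ ring s d4 q)); auto.
  apply (proximinal_union (ring s d3) (ring s d4)); auto.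
Qed.

(** * Local feature size on the links *)

Lemma dih_exists (K : dih -> point -> Prop) q :
  (exists d, K d q) <-> exists b1 b2 b3, K (b1, b2, b3) q.
Proof.
split; [intros [[[b1 b2] b3] H]; eauto|intros (b1 & b2 & b3 & H); eauto].
Qed.

Lemma proximinal_dih (K : dih -> point -> Prop) :
  (forall d, proximinal (K d)) -> proximinal (fun q => exists d, K d q).
Proof.
intros H; apply proximinal_ext with (fun q => exists b1 b2 b3, K (b1, b2, b3) q).
- intros q; symmetry; apply dih_exists.
- do 3 (apply proximinal_bool; intros ?); apply H.
Qed.

Lemma separated_dih (K : dih -> point -> Prop) p :
  (forall d, separated (K d) p) -> separated (fun q => exists d, K d q) p.
Proof.
intros H; apply separated_sub with (fun q => exists b1 b2 b3, K (b1, b2, b3) q).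
- intros q; apply dih_exists.
- do 3 (apply separated_bool; intros ?); apply H.
Qed.

Lemma mir_arc K a b : is_arc K a b -> is_arc (fun q => K (mir q)) (mir a) (mir b).
Proof. apply arc_map; auto using mir_mir, affine_mir. Qed.

Lemma config_proximinal a b : proximinal (config a b).
Proof.
apply proximinal_union; apply proximinal_dih; intros d.
- eapply arc_proximinal, leg_arc.
- eapply arc_proximinal, mir_arc, leg_arc.
Qed.

Lemma leg_mir_right b d q : leg b d (mir q) -> 1000 <= fst q /\ (fst q = 1000 -> q = Qpt d).
Proof.
intros H; destruct (leg_right b d _ H) as [A B]; simpl in A, B; split; [lra|].
intros E; rewrite <- (mir_mir q), B, mir_Qpt; auto; lra.
Qed.

Lemma config_switch a b q :
  config a b q -> fst q * fst q + snd q * snd q < 160000 -> switch a q.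
Proof.
intros [[d H]|[d H]] N.
- apply leg_cases in H; destruct H as [H|H]; [exists d; auto|].
  destruct (link_norm d q H); lra.
- destruct (leg_mir_right b d q H) as [A _].
  assert (1000 * 1000 <= fst q * fst q) by (apply Rmult_le_compat; lra).
  assert (0 <= snd q * snd q) by apply Rle_0_sqr; lra.
Qed.

Lemma switch_config a b q : switch a q -> config a b q.
Proof.
intros H; apply switch_leg in H; destruct H as [d [H|H]]; left; exists d;
  [left|right; left]; auto.
Qed.

Definition lfs_at_least (C : point -> Prop) (p : point) (r : R) : Prop :=
  forall m, medial_axis C m -> r <= edist p m.

Lemma ray_lower b1 b2 b3 q :
  ray (b1, b2, b3) q <->
  seg (219 * dirC b1 b3, 219 * dirS b3) (lT (dirC b1 b3) (dirS b3)) (lower b2 q).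
Proof.
assert (A : forall x, lower b2 (frame false (b1, b2, b3) (x, 0)) = (x * dirC b1 b3, x * dirS b3)).
{ intros x; rewrite frame_axis.
  destruct b1, b2, b3; unfold act, lower, refl, dirC, dirS, sg; simpl; f_equal; ring. }
split.
- intros [t [Ht E]]; exists t; split; auto.
  apply unframe_inj in E; unfold J4, J5 in E; cbn [fst snd] in E.
  replace (0 + t * (0 - 0)) with 0 in E by ring.
  rewrite E, A; unfold lT; simpl; f_equal; ring.
- intros [t [Ht E]]; exists t; split; auto.
  assert (E' : lower b2 q = lower b2 (frame false (b1, b2, b3) (219 + t * (400 - 219), 0))).
  { rewrite A, E; unfold lT; simpl; f_equal; ring. }
  apply (f_equal (lower b2)) in E'; rewrite !lower_lower in E'.
  rewrite E', unframe_frame; unfold J4, J5; simpl; f_equal; ring.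
Qed.

Lemma d2_lower b p q : d2 (lower b p) (lower b q) = d2 p q.
Proof. destruct b; simpl; auto using d2_refl. Qed.

Lemma edist_lower b p q : edist (lower b p) (lower b q) = edist p q.
Proof. rewrite !edist_d2, d2_lower; auto. Qed.

Lemma closest_lower b (K : point -> Prop) m x :
  closest (fun q => K (lower b q)) m x -> closest K (lower b m) (lower b x).
Proof.
rewrite !closest_d2; intros [A B]; split; auto; intros y Ky.
rewrite d2_lower, <- (lower_lower b y), d2_lower; apply B; rewrite lower_lower; auto.
Qed.

Lemma d2_mir p q : d2 (mir p) (mir q) = d2 p q.
Proof. unfold d2, mir; simpl; ring. Qed.

Lemma edist_mir p q : edist (mir p) (mir q) = edist p q.
Proof. rewrite !edist_d2, d2_mir; auto. Qed.

Lemma closest_mir (K : point -> Prop) m x :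
  closest (fun q => K (mir q)) m x -> closest K (mir m) (mir x).
Proof.
rewrite !closest_d2; intros [A B]; split; auto; intros y Ky.
rewrite d2_mir, <- (mir_mir y), d2_mir; apply B; rewrite mir_mir; auto.
Qed.

Lemma lR_large C S : is_dir C S -> 600 < lR C S.
Proof.
intros H; assert (B := is_dir_C C S H); destruct H as [H1 H2].
assert (S <= 1) by (apply Rnot_lt_le; intros h; nra).
apply Rmult_lt_reg_r with S; auto.
replace (lR C S * S) with (1000 - 400 * C) by (unfold lR; field; lra). lra.
Qed.

(** All radii exceed 600, so a point within 600 of the link has positive inner product with [p] as
    seen from the centre, the condition of [marc_closest_unique]. *)
Lemma ulink_unique C S p m x y : is_dir C S -> ulink C S p -> edist p m < 600 ->
  closest (ulink C S) m x -> closest (ulink C S) m y -> x = y.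
Proof.
intros H Hp Hm; destruct (link_radius C S H) as [E1 E2]; assert (L := lR_large C S H).
apply marc_closest_unique with p; auto.
- congruence.
- apply Rlt_not_eq, link_cross; auto.
- assert (E := d2_inner (lcen C S) p m); rewrite (proj1 Hp), E1 in E.
  apply sqr_lt_edist in Hm; rewrite d2_sym in Hm.
  assert (G := d2_ge0 (lcen C S) m).
  assert (600 * 600 < lR C S * lR C S) by (apply Rmult_le_0_lt_compat; lra). lra.
Qed.

Lemma tang_lT C S m : is_dir C S ->
  tang (lcen C S) (lT C S) m = - (lR C S * (400 - (C * fst m + S * snd m))).
Proof.
intros H; destruct (lT_rel C S H) as [E1 E2]; unfold tang.
change (fst (lcen C S)) with 1000; change (snd (lcen C S)) with (lyc C S).
rewrite E1, E2.
replace 400 with (1000 * C + S * lyc C S); [ring|].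
destruct H; unfold lyc; field; lra.
Qed.

Lemma tang_lQ C S m : tang (lcen C S) (lQ C S) m = - (lR C S * (1000 - fst m)).
Proof. unfold tang, lcen, lQ; simpl; ring. Qed.

Lemma unit_projection C S a b : is_dir C S ->
  Rabs (C * (fst a - fst b) + S * (snd a - snd b)) <= edist a b.
Proof.
intros [H1 H2]; apply Rsqr_incr_0_var; [|apply edist_ge0].
rewrite <- Rsqr_abs; unfold Rsqr; rewrite edist_sqr; unfold d2.
set (u := fst a - fst b); set (v := snd a - snd b).
assert (0 <= (C * v - S * u) * (C * v - S * u)) by apply Rle_0_sqr.
assert ((C * u + S * v) * (C * u + S * v) + (C * v - S * u) * (C * v - S * u)
        = (C * C + S * S) * (u * u + v * v)) by ring.
rewrite H1 in H0; lra.
Qed.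

Definition utail (C S : R) (q : point) : Prop :=
  seg (219 * C, 219 * S) (lT C S) q \/ ulink C S q.

Lemma beyond_closest m A (P T : point -> Prop) x :
  P A -> beyond m A T -> closest (fun q => P q \/ T q) m x -> closest P m x.
Proof.
intros PA B H; apply (closest_in_middle m A A (fun q => P q \/ T q) (fun _ => False) P T);
  try tauto; intros q [].
Qed.

Lemma closest_ext (K K' : point -> Prop) m x :
  (forall q, K q <-> K' q) -> closest K m x -> closest K' m x.
Proof.
intros E [A B]; split; [apply E; auto|]; intros y Ky; apply B, E; auto.
Qed.

(** The common normal at the junction decides: beyond it the segment is farther than the junction,
    before it the arc is, and each piece alone has only one closest point. *)
Lemma utail_unique_at_T C S m x y : is_dir C S -> edist (lT C S) m < 600 ->
  closest (utail C S) m x -> closest (utail C S) m y -> x = y.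
Proof.
intros H Hm Hx Hy; assert (L := lR_large C S H); assert (X := link_cross C S H).
assert (B := is_dir_C C S H); destruct (link_radius C S H) as [E1 E2].
assert (Hmx := Rle_lt_trans _ _ _ (edist_fst _ _) Hm); apply Rabs_def2 in Hmx.
unfold lT in Hmx; simpl in Hmx.
destruct (Rle_lt_dec (400 - (C * fst m + S * snd m)) 0) as [h|h].
- assert (BT : beyond m (lT C S) (seg (219 * C, 219 * S) (lT C S))).
  { intros q Hq N; apply seg_backward with (219 * C, 219 * S); auto.
    unfold lT; simpl.
    replace ((400 * C - fst m) * (400 * C - 219 * C) + (400 * S - snd m) * (400 * S - 219 * S))
      with (181 * (400 * (C * C + S * S) - (C * fst m + S * snd m))) by ring.
    rewrite (proj1 H); lra. }
  assert (A : forall z, closest (utail C S) m z -> closest (ulink C S) m z).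
  { intros z Hz; apply (beyond_closest m (lT C S) _ (seg (219 * C, 219 * S) (lT C S))); auto.
    - apply marc_start.
    - apply closest_ext with (utail C S); auto; unfold utail; tauto. }
  apply (ulink_unique C S (lT C S) m); auto; apply marc_start.
- assert (BT : beyond m (lT C S) (ulink C S)).
  { intros q Hq N; apply marc_forward with (lcen C S) (lQ C S); auto.
    - congruence.
    - lra.
    - rewrite tang_lT by auto.
      assert (0 < lR C S * (400 - (C * fst m + S * snd m))) by (apply Rmult_lt_0_compat; lra). nra.
    - rewrite tang_lQ.
      assert (0 < lR C S * (1000 - fst m)) by (apply Rmult_lt_0_compat; lra). nra. }
  apply (seg_closest_unique (219 * C, 219 * S) (lT C S) m);
    apply (beyond_closest m (lT C S) _ (ulink C S)); auto using seg_end.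
Qed.

(** The mirror line is the common normal at the junction of the two arcs; for [m] beyond it
    everything is reflected. *)
Lemma ulink_mir_unique C S m x y : is_dir C S -> edist (lQ C S) m < 600 ->
  closest (fun q => ulink C S q \/ ulink C S (mir q)) m x ->
  closest (fun q => ulink C S q \/ ulink C S (mir q)) m y -> x = y.
Proof.
intros H Hm Hx Hy; assert (L := lR_large C S H); assert (X := link_cross C S H).
assert (B := is_dir_C C S H); destruct (link_radius C S H) as [E1 E2].
assert (MQ : mir (lQ C S) = lQ C S) by (unfold mir, lQ; simpl; f_equal; ring).
assert (QQ : ulink C S (lQ C S)) by (apply marc_end; congruence).
assert (BB : forall m', edist (lQ C S) m' < 600 -> 1000 <= fst m' -> beyond m' (lQ C S) (ulink C S)).
{ intros m' Hm' h q Hq N; apply marc_backward with (lcen C S) (lT C S); auto.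
  - congruence.
  - lra.
  - rewrite tang_lQ; assert (0 <= lR C S * (fst m' - 1000)) by (apply Rmult_le_pos; lra). nra.
  - rewrite tang_lT by auto.
    assert (P := Rle_lt_trans _ _ _ (unit_projection C S _ _ H) Hm'); apply Rabs_def2 in P.
    assert (EQ : C * fst (lQ C S) + S * snd (lQ C S) = 400 + (1000 - 400 * C)).
    { unfold lQ, lyc, lR; simpl; destruct H; field; lra. }
    assert (0 < lR C S * ((C * fst m' + S * snd m') - 400)) by (apply Rmult_lt_0_compat; lra). nra. }
assert (Hm' : edist (lQ C S) (mir m) < 600) by (rewrite <- MQ, edist_mir; auto).
destruct (Rle_lt_dec (fst m) 1000) as [h|h].
- assert (BM : beyond m (lQ C S) (fun q => ulink C S (mir q))).
  { intros q Hq N; rewrite <- (d2_mir m (lQ C S)), <- (d2_mir m q), MQ.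
    apply BB; auto; [simpl; lra|].
    intros E; apply N; rewrite <- (mir_mir q), E; auto. }
  apply (ulink_unique C S (lQ C S) m); auto;
    apply (beyond_closest m (lQ C S) (ulink C S) (fun q => ulink C S (mir q))); auto.
- assert (A : forall z, closest (fun q => ulink C S q \/ ulink C S (mir q)) m z ->
     closest (ulink C S) (mir m) (mir z)).
  { intros z Hz; apply closest_mir.
    apply (beyond_closest m (lQ C S) (fun q => ulink C S (mir q)) (ulink C S)); auto.
    - rewrite MQ; auto.
    - apply BB; auto; lra.
    - apply closest_ext with (2 := Hz); intros q; tauto. }
  rewrite <- (mir_mir x), <- (mir_mir y); f_equal.
  apply (ulink_unique C S (lQ C S) (mir m)); auto.
Qed.

Lemma mir_lower b q : mir (lower b q) = lower b (mir q).
Proof. destruct b; auto. Qed.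

(** * Positive local feature size at every point of a tail *)

Section TailPoint.

Variables (a b : bool) (d : dih) (p : point).
Hypothesis Hp : tail d p.

Let Cf := config a b.

Lemma tail_config : Cf p.
Proof. left; exists d; right; exact Hp. Qed.

Lemma sep_other_legs : separated (fun q => exists d', d' <> d /\ leg a d' q) p.
Proof.
apply separated_dih; intros d'.
destruct (classic (d' = d)) as [e|e].
{ exists 1; split; [lra|]; intros q [n _]; contradiction. }
apply separated_sub with (leg a d'); [tauto|].
apply proximinal_separated; [eapply arc_proximinal, leg_arc|].
intros H; destruct (leg_disjoint a d d' p (or_intror Hp) H) as [E|[_ E]]; [auto|].
assert (X := tail_X d p Hp).
destruct (legcore_in_X a d p) as [X' _]; [|lra].
rewrite E; apply arc_start with (Npt d), legcore_in_arc.
Qed.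

Lemma tail_left : fst p <= 1000 /\ (fst p = 1000 -> p = Qpt d).
Proof. apply (leg_right a); right; exact Hp. Qed.

Lemma sep_other_mirror_legs : separated (fun q => exists d', d' <> d /\ leg b d' (mir q)) p.
Proof.
apply separated_dih; intros d'.
destruct (classic (d' = d)) as [e|e].
{ exists 1; split; [lra|]; intros q [n _]; contradiction. }
apply separated_sub with (fun q => leg b d' (mir q)); [tauto|].
apply proximinal_separated; [eapply arc_proximinal, mir_arc, leg_arc|].
intros H; destruct (leg_mir_right b d' p H) as [A B], tail_left as [A' B'].
apply e, Qpt_inj; rewrite <- B, <- B'; auto; lra.
Qed.

Lemma sep_core : p <> J4pt d -> separated (legcore a d) p.
Proof.
intros N; apply proximinal_separated; [eapply arc_proximinal, legcore_arc|].
intros H; destruct (legcore_X a d p H) as [A B]; assert (X := tail_X d p Hp).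
apply N, B; lra.
Qed.

Lemma sep_mirror_sigma : separated (fun q => legcore b d (mir q) \/ ray d (mir q)) p.
Proof.
apply proximinal_separated.
- apply proximinal_union; eapply arc_proximinal, mir_arc; [apply legcore_arc|apply ray_is_arc].
- intros H.
  assert (H' : sigma (unframe b d (mir p))).
  { destruct H as [H|H]; [left|right; apply ray_state]; auto. }
  destruct (sigma_J5 b d _ H') as [N _]; destruct tail_left as [A _]; simpl in N.
  assert (1000 * 1000 <= (2000 - fst p) * (2000 - fst p)) by (apply Rmult_le_compat; lra).
  assert (0 <= snd p * snd p) by apply Rle_0_sqr; lra.
Qed.

(** A configuration is a finite union of arcs, and those missing [p] are at positive distance from
    it. Only the ray, the link and the mirrored link of [d] may contain [p] and need to be
    discussed. *)
Lemma sep_config (G : point -> Prop) :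
  p <> J4pt d ->
  ((forall q, ray d q -> G q) \/ separated (ray d) p) ->
  ((forall q, link d q -> G q) \/ separated (link d) p) ->
  ((forall q, link d (mir q) -> G q) \/ separated (fun q => link d (mir q)) p) ->
  separated (fun q => Cf q /\ ~ G q) p.
Proof.
intros N H1 H2 H3.
assert (W : forall K : point -> Prop, ((forall q, K q -> G q) \/ separated K p) ->
              separated (fun q => K q /\ ~ G q) p).
{ intros K [h|h].
  - exists 1; split; [lra|]; intros q [k g]; exfalso; auto.
  - apply separated_sub with K; tauto. }
apply W in H1; apply W in H2; apply W in H3.
assert (S1 := sep_other_legs); assert (S2 := sep_other_mirror_legs).
assert (S3 := sep_core N); assert (S4 := sep_mirror_sigma).
assert (S := separated_union _ _ p (separated_union _ _ p (separated_union _ _ p S1 S2)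
  (separated_union _ _ p S3 S4)) (separated_union _ _ p H1 (separated_union _ _ p H2 H3))).
apply separated_sub with (2 := S).
intros q [[[d' Hd]|[d' Hd]] Gq].
- destruct (classic (d' = d)) as [->|e]; [|left; left; left; eauto].
  destruct Hd as [h|[h|h]]; tauto.
- destruct (classic (d' = d)) as [->|e]; [|left; left; right; eauto].
  destruct Hd as [h|[h|h]]; tauto.
Qed.

Lemma lfs_of_unique (G : point -> Prop) :
  (forall q, G q -> Cf q) -> separated (fun q => Cf q /\ ~ G q) p ->
  (forall m, edist p m < 600 -> forall x y, closest G m x -> closest G m y -> x = y) ->
  exists r, 0 < r /\ lfs_at_least Cf p r.
Proof.
intros HG S U; apply (lfs_pos_of_local_uniqueness Cf G p 600); auto; try lra.
- apply config_proximinal.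
- apply tail_config.
Qed.

(** The piece [G] around [p] depends on the place: two pieces at the junctions [Tpt] and [Qpt],
    otherwise the link or the ray alone. At [J4pt], where the core begins, the estimate for cores
    applies. *)
Lemma tail_lfs_positive : exists r, 0 < r /\ lfs_at_least Cf p r.
Proof.
destruct (classic (p = J4pt d)) as [e|N].
{ destruct (core_lfs a Cf d p) as (w & r & _ & Hr & _ & H).
  - apply config_proximinal.
  - intros q; apply switch_config.
  - intros q; apply config_switch.
  - rewrite e, <- (frame_J4 a d), unframe_frame; right; right; right; apply marc_end, radius_O4.
  - exists r; split; auto. }
destruct tail_left as [XL XQ].
assert (PR : proximinal (ray d)) by (eapply arc_proximinal, ray_is_arc).
assert (PL : proximinal (link d)) by (eapply arc_proximinal, link_arc).
assert (PM : proximinal (fun q => link d (mir q))) by (eapply arc_proximinal, mir_arc, link_arc).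
assert (SM : p <> Qpt d -> separated (fun q => link d (mir q)) p).
{ intros NQ; apply proximinal_separated; auto; intros H.
  destruct (leg_mir_right b d p) as [A B]; [right; right; auto|].
  apply NQ, B; lra. }
assert (RC : forall q, ray d q -> Cf q) by (intros q H; left; exists d; right; left; auto).
assert (LC : forall q, link d q -> Cf q) by (intros q H; left; exists d; right; right; auto).
assert (NTQ : p = Tpt d -> p <> Qpt d).
{ intros E E'; assert (F := Qpt_fst d); rewrite <- E', E in F.
  destruct (sigma_J5 false d (Tpt d)) as [G _].
  - unfold Tpt; rewrite unframe_frame; right; apply seg_end.
  - rewrite F in G; assert (0 <= snd (Tpt d) * snd (Tpt d)) by apply Rle_0_sqr; lra. }
destruct d as [[b1 b2] b3] eqn:Ed; rewrite <- Ed in *.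
assert (DD := is_dir_dih b1 b3); set (C := dirC b1 b3) in *; set (S := dirS b3) in *.
assert (Lk : forall q, link d q <-> ulink C S (lower b2 q)) by (rewrite Ed; intros; reflexivity).
assert (Ry : forall q, ray d q <-> seg (219 * C, 219 * S) (lT C S) (lower b2 q))
  by (rewrite Ed; intros; apply ray_lower).
assert (Tl : lower b2 (Tpt d) = lT C S) by (rewrite Ed, Tpt_link, lower_lower; auto).
destruct (classic (p = Tpt d)) as [eT|NT].
{ apply (lfs_of_unique (tail d)).
  - intros q [h|h]; auto.
  - apply sep_config; auto; unfold tail; auto.
  - intros m Hm x y Hx Hy.
    rewrite <- (lower_lower b2 x), <- (lower_lower b2 y); f_equal.
    apply (utail_unique_at_T C S (lower b2 m)); auto.
    + rewrite <- Tl, <- eT, edist_lower; auto.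
    + apply closest_lower, closest_ext with (2 := Hx).
      intros q; unfold tail, utail; rewrite Lk, Ry; tauto.
    + apply closest_lower, closest_ext with (2 := Hy).
      intros q; unfold tail, utail; rewrite Lk, Ry; tauto. }
destruct (classic (p = Qpt d)) as [eQ|NQ].
{ assert (Ql : lower b2 (Qpt d) = lQ C S) by (rewrite Ed; simpl; rewrite lower_lower; auto).
  apply (lfs_of_unique (fun q => link d q \/ link d (mir q))).
  - intros q [h|h]; auto; right; exists d; right; right; auto.
  - apply sep_config; auto; right; apply proximinal_separated; auto; intros H.
    destruct (ray_X d p H) as (A & _ & B).
    destruct (link_X d p) as [A' B']; [|apply NT, B; lra].
    rewrite eQ; apply arc_end with (Tpt d), link_arc.
  - intros m Hm x y Hx Hy.
    rewrite <- (lower_lower b2 x), <- (lower_lower b2 y); f_equal.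
    assert (EE : forall q, link d q \/ link d (mir q) <->
       ulink C S (lower b2 q) \/ ulink C S (mir (lower b2 q))).
    { intros q; rewrite !Lk, mir_lower; tauto. }
    apply (ulink_mir_unique C S (lower b2 m)); auto.
    + rewrite <- Ql, <- eQ, edist_lower; auto.
    + apply (closest_lower b2 (fun q => ulink C S q \/ ulink C S (mir q))).
      apply closest_ext with (2 := Hx); exact EE.
    + apply (closest_lower b2 (fun q => ulink C S q \/ ulink C S (mir q))).
      apply closest_ext with (2 := Hy); exact EE. }
destruct (classic (link d p)) as [HL|NL].
- apply (lfs_of_unique (link d)); auto.
  + apply sep_config; auto; right; apply proximinal_separated; auto; intros H.
    destruct (ray_X d p H) as (A & _ & B), (link_X d p HL); apply NT, B; lra.
  + intros m Hm x y Hx Hy.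
    rewrite <- (lower_lower b2 x), <- (lower_lower b2 y); f_equal.
    apply (ulink_unique C S (lower b2 p) (lower b2 m)); auto.
    * apply Lk; auto.
    * rewrite edist_lower; auto.
    * apply closest_lower, closest_ext with (2 := Hx); auto.
    * apply closest_lower, closest_ext with (2 := Hy); auto.
- apply (lfs_of_unique (ray d)); auto.
  + apply sep_config; auto; right; apply proximinal_separated; auto.
  + intros m Hm x y Hx Hy.
    rewrite <- (lower_lower b2 x), <- (lower_lower b2 y); f_equal.
    apply (seg_closest_unique (219 * C, 219 * S) (lT C S) (lower b2 m)).
    * apply closest_lower, closest_ext with (2 := Hx); auto.
    * apply closest_lower, closest_ext with (2 := Hy); auto.
Qed.

End TailPoint.

Lemma finite_cover (f : R -> posreal) :
  exists l : list R, (forall t, In t l -> 0 <= t <= 1) /\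
    forall x, 0 <= x <= 1 -> exists t, In t l /\ Rabs (x - t) < f t.
Proof.
apply NNPP; intros N.
(* The compactness statement is doubly negated and speaks of tuples, here of length 1 and closed by
   [tt]. The filter discards centres outside [0, 1]. *)
apply (compactness_list 1 (0, tt) (1, tt) (fun t => f (fst t))); intros [l Hl]; apply N.
exists (filter (fun t => if Rle_dec 0 t then if Rle_dec t 1 then true else false else false)
          (map (fun t => fst t) l)); split.
- intros t Ht; apply filter_In in Ht; destruct Ht as [_ Ht].
  destruct (Rle_dec 0 t); [|discriminate]; destruct (Rle_dec t 1); [lra|discriminate].
- intros x Hx; destruct (Hl (x, tt)) as [[t u] [It [Bt Ct]]].
  + simpl; auto.
  + simpl in Bt, Ct; exists t; split; [|apply Ct].
    apply filter_In; split; [apply in_map_iff; exists (t, u); auto|].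
    destruct (Rle_dec 0 t); [|lra]; destruct (Rle_dec t 1); [auto|lra].
Qed.

(** Here [P q r] stands for a lower bound [r] of the local feature size at [q]. The radius varies
    from point to point without uniform bound; compactness of the parameter interval makes finitely
    many balls suffice. *)
Lemma arc_cover K a b (P : point -> R -> Prop) :
  is_arc K a b ->
  (forall q, K q -> exists r, 0 < r /\ P q r) ->
  exists l : list point, (forall q, In q l -> K q) /\
    forall p, K p -> exists q r, In q l /\ P q r /\ edist p q < 4 / 10 * r.
Proof.
intros (g1 & g2 & C1 & C2 & _ & _ & _ & HK) H.
assert (D : forall t, exists e : posreal, 0 <= t <= 1 ->
  exists r, P (g1 t, g2 t) r /\
    forall u, Rabs (u - t) < e -> edist (g1 u, g2 u) (g1 t, g2 t) < 4 / 10 * r).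
{ intros t; destruct (classic (0 <= t <= 1)) as [Ht|Ht].
  - destruct (H (g1 t, g2 t)) as [r [Hr Pr]]; [apply HK; eauto|].
    (* Both coordinates within 0.2 r give a squared distance of at most 0.08 r^2, below the required
       0.16 r^2. *)
    destruct (continuous_epsilon g1 t (C1 t) (2 / 10 * r)) as [e1 [He1 A1]]; [lra|].
    destruct (continuous_epsilon g2 t (C2 t) (2 / 10 * r)) as [e2 [He2 A2]]; [lra|].
    exists (mkposreal _ (Rmin_pos _ _ He1 He2)); intros _; exists r; split; auto.
    intros u Hu; simpl in Hu.
    specialize (A1 u (Rlt_le_trans _ _ _ Hu (Rmin_l _ _))).
    specialize (A2 u (Rlt_le_trans _ _ _ Hu (Rmin_r _ _))).
    apply edist_lt_sqr; [lra|]; unfold d2; simpl.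
    apply Rabs_def2 in A1; apply Rabs_def2 in A2.
    assert (forall z, - (2 / 10 * r) < z < 2 / 10 * r -> z * z <= 2 / 10 * r * (2 / 10 * r)).
    { intros z Hz; assert (0 <= (2 / 10 * r - z) * (2 / 10 * r + z)) by (apply Rmult_le_pos; lra). lra. }
    assert (B1 := H0 (g1 u - g1 t) ltac:(lra)); assert (B2 := H0 (g2 u - g2 t) ltac:(lra)).
    assert (0 < r * r) by (apply Rmult_lt_0_compat; lra). lra.
  (* A dummy radius outside [0, 1]: the gauge has to be defined on the whole line. *)
  - exists (mkposreal 1 Rlt_0_1); intros; contradiction. }
set (f := fun t => proj1_sig (constructive_indefinite_description _ (D t))).
assert (Hf : forall t, 0 <= t <= 1 -> exists r, P (g1 t, g2 t) r /\
    forall u, Rabs (u - t) < f t -> edist (g1 u, g2 u) (g1 t, g2 t) < 4 / 10 * r).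
{ intros t; unfold f; apply (proj2_sig (constructive_indefinite_description _ (D t))). }
destruct (finite_cover f) as [l [L1 L2]].
exists (map (fun t => (g1 t, g2 t)) l); split.
- intros q Hq; apply in_map_iff in Hq; destruct Hq as [t [<- Ht]]; apply HK; eauto.
- intros p Kp; apply HK in Kp; destruct Kp as [x [Hx ->]].
  destruct (L2 x Hx) as [t [It Ct]]; destruct (Hf t (L1 t It)) as [r [Pr A]].
  exists (g1 t, g2 t), r; split; [apply in_map_iff; eauto|]; split; auto.
Qed.

(** The minimum over the four configurations lets one set of samples serve them all. Distance to the
    medial axis is 1-Lipschitz: within 0.4 r of a sample it is still at least 0.6 r, and 0.4 is less
    than 0.72 times 0.6. *)
Lemma tail_samples d : exists l : list point, (forall q, In q l -> tail d q) /\
  forall p, tail d p -> exists q r, In q l /\ edist p q < 72 / 100 * r /\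
    forall a b, lfs_at_least (config a b) p r.
Proof.
destruct (arc_cover (tail d) (J4pt d) (Qpt d) (fun p r => forall a b, lfs_at_least (config a b) p r))
  as [l [L1 L2]].
- apply tail_arc.
- intros q Hq.
  destruct (tail_lfs_positive true true d q Hq) as (r1 & P1 & H1).
  destruct (tail_lfs_positive true false d q Hq) as (r2 & P2 & H2).
  destruct (tail_lfs_positive false true d q Hq) as (r3 & P3 & H3).
  destruct (tail_lfs_positive false false d q Hq) as (r4 & P4 & H4).
  exists (Rmin (Rmin r1 r2) (Rmin r3 r4)); split; [repeat apply Rmin_pos; auto|].
  assert (A1 := Rmin_l (Rmin r1 r2) (Rmin r3 r4)); assert (A2 := Rmin_r (Rmin r1 r2) (Rmin r3 r4)).
  assert (A3 := Rmin_l r1 r2); assert (A4 := Rmin_r r1 r2).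
  assert (A5 := Rmin_l r3 r4); assert (A6 := Rmin_r r3 r4).
  intros a b m Mm; destruct a, b;
    [specialize (H1 m Mm)|specialize (H2 m Mm)|specialize (H3 m Mm)|specialize (H4 m Mm)]; lra.
- exists l; split; auto; intros p Tp; destruct (L2 p Tp) as (q & r & Iq & Hr & Hd).
  exists q, (6 / 10 * r); split; auto.
  assert (E := edist_ge0 p q); split; [lra|].
  intros a b m Mm; assert (B := Hr a b m Mm); assert (T := edist_triangle q p m).
  rewrite (edist_sym q p) in T; lra.
Qed.

(** * Samples *)

Definition all_dih : list dih :=
  [(false, false, false); (false, false, true); (false, true, false); (false, true, true);
   (true, false, false); (true, false, true); (true, true, false); (true, true, true)].

Lemma in_all_dih d : In d all_dih.
Proof. destruct d as [[[] []] []]; simpl; tauto. Qed.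

Definition J2pt (d : dih) : point := frame false d J2.

Lemma frame_J2 s d : frame s d J2 = J2pt d.
Proof. unfold J2pt, J2; rewrite !frame_axis; auto. Qed.

(** The first clause keeps the samples, in either state, off the inner stretch of each strand
    between its two points [Npt]; this makes these two points consecutive. *)
Definition left_samples (SA : list point) : Prop :=
  (forall q, In q SA -> exists d, forall a, legout a d q) /\
  (forall d, In (Npt d) SA /\ In (J2pt d) SA /\ In (J4pt d) SA) /\
  (forall d p, tail d p -> exists q r, In q SA /\ edist p q < 72 / 100 * r /\
    forall a b, lfs_at_least (config a b) p r).

Lemma left_samples_exist : exists SA, left_samples SA.
Proof.
assert (H : forall ds : list dih, exists SA,
  (forall q, In q SA -> exists d, forall a, legout a d q) /\
  (forall d, In d ds -> In (Npt d) SA /\ In (J2pt d) SA /\ In (J4pt d) SA) /\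
  (forall d p, In d ds -> tail d p -> exists q r, In q SA /\ edist p q < 72 / 100 * r /\
    forall a b, lfs_at_least (config a b) p r)).
{ induction ds as [|d ds [SA (H1 & H2 & H3)]].
  - exists []; repeat split; intros; try contradiction.
  - destruct (tail_samples d) as [l [L1 L2]].
    exists ((Npt d :: J2pt d :: J4pt d :: l) ++ SA); split; [|split].
    + intros q Hq; apply in_app_iff in Hq; destruct Hq as [[<-|[<-|[<-|Hq]]]|Hq]; auto.
      * exists d; intros a; left; apply arc_start with (J4pt d), legcore_out_arc.
      * exists d; intros a; left; unfold legcore_out.
        rewrite <- (frame_J2 a d), unframe_frame; right; left; apply marc_start.
      * exists d; intros a; left; apply arc_end with (Npt d), legcore_out_arc.
      * exists d; intros a; right; auto.
    + intros d' [<-|Hd]; [repeat split; apply in_app_iff; left; simpl; auto|].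
      destruct (H2 d' Hd) as (A & B & C); repeat split; apply in_app_iff; right; auto.
    + intros d' p [<-|Hd] Tp.
      * destruct (L2 p Tp) as (q & r & Iq & Hq); exists q, r; split; auto.
        apply in_app_iff; left; simpl; auto.
      * destruct (H3 d' p Hd Tp) as (q & r & Iq & Hq); exists q, r; split; auto.
        apply in_app_iff; auto. }
destruct (H all_dih) as [SA (H1 & H2 & H3)]; exists SA; split; auto; split.
- intros d; apply H2, in_all_dih.
- intros d p; apply H3, in_all_dih.
Qed.

Definition both_sides (SA : list point) : list point := SA ++ map mir SA.

Lemma in_both_sides SA q : In q (both_sides SA) <-> In q SA \/ In (mir q) SA.
Proof.
unfold both_sides; rewrite in_app_iff; split; intros [H|H]; auto; right.
- apply in_map_iff in H; destruct H as [x [<- Hx]]; rewrite mir_mir; auto.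
- apply in_map_iff; exists (mir q); split; auto using mir_mir.
Qed.

Lemma legout_leg a d q : legout a d q -> leg a d q.
Proof. intros [H|H]; [left; right|right]; auto. Qed.

Lemma medial_axis_ext (C C' : point -> Prop) m :
  (forall q, C q <-> C' q) -> medial_axis C m -> medial_axis C' m.
Proof.
intros E M [x [Hx U]]; apply M; exists x; split.
- apply closest_ext with (2 := Hx); intros q; symmetry; auto.
- intros y Hy; apply U; apply closest_ext with (2 := Hy); auto.
Qed.

Lemma medial_axis_mir (C : point -> Prop) m :
  medial_axis C m -> medial_axis (fun q => C (mir q)) (mir m).
Proof.
intros M [x [Hx U]]; apply M; exists (mir x); split.
- rewrite <- (mir_mir m); apply closest_mir; auto.
- intros y Hy; rewrite <- (mir_mir y); f_equal; apply U.
  apply (closest_mir (fun q => C (mir q))).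
  apply closest_ext with (2 := Hy); intros q; rewrite mir_mir; tauto.
Qed.

Lemma left_point SA a b d p : left_samples SA -> leg a d p ->
  exists s r, In s SA /\ edist p s < 72 / 100 * r /\ lfs_at_least (config a b) p r.
Proof.
intros (H1 & H2 & H3) [Hp|Hp].
- destruct (core_lfs a (config a b) d p) as (w & r & Hw & Hr & Hd & Hm); auto.
  + apply config_proximinal.
  + intros q; apply switch_config.
  + intros q; apply config_switch.
  + exists (frame a d w), r; split; auto; destruct (H2 d) as (A & B & C).
    destruct Hw as [->|[->| ->]]; rewrite ?frame_N2, ?frame_J2, ?frame_J4; auto.
- destruct (H3 d p Hp) as (s & r & Hs & Hd & Hr); exists s, r; auto.
Qed.

Lemma config_eps_sample SA a b (C : point -> Prop) :
  left_samples SA -> (forall q, C q <-> config a b q) ->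
  eps_sample (72 / 100) C (both_sides SA).
Proof.
intros HS E; split.
- intros s Hs; apply E; apply in_both_sides in Hs; destruct HS as [H1 _].
  destruct Hs as [Hs|Hs]; destruct (H1 _ Hs) as [d Hd]; [left|right]; exists d;
    apply legout_leg, Hd.
- intros p Cp; apply E in Cp; destruct Cp as [[d Hp]|[d Hp]].
  + destruct (left_point SA a b d p HS Hp) as (s & r & Is & Hd & Hr).
    apply eps_sample_point with r s; auto; [lra| |].
    * apply in_both_sides; auto.
    * intros m Mm; apply Hr, medial_axis_ext with (2 := Mm); auto.
  (* The mirror moves a point of the right half to the left and exchanges the two states. *)
  + destruct (left_point SA b a d (mir p) HS Hp) as (s & r & Is & Hd & Hr).
    apply eps_sample_point with r (mir s); auto; [lra| | |].
    * apply in_both_sides; rewrite mir_mir; auto.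
    * rewrite <- edist_mir, mir_mir; auto.
    * intros m Mm; rewrite <- edist_mir; apply Hr.
      apply medial_axis_ext with (fun q => C (mir q)); [|apply medial_axis_mir; auto].
      intros q; rewrite E, config_mir, mir_mir; tauto.
Qed.

(** * Sample graphs *)

(** The image is specified on one period only; periodicity, extended to natural and then to integer
    shifts, brings any parameter into [0, 1). *)
Lemma curve_param_in K g1 g2 x : curve_param K g1 g2 -> K (g1 x, g2 x).
Proof.
intros (_ & _ & P & _ & HK).
assert (N : forall (n : nat) y, g1 (y + INR n) = g1 y /\ g2 (y + INR n) = g2 y).
{ induction n as [|n IH]; intros y; [simpl; rewrite Rplus_0_r; auto|].
  rewrite S_INR, <- Rplus_assoc; destruct (P (y + INR n)) as [-> ->]; auto. }
assert (Z : forall z y, g1 (y + IZR z) = g1 y /\ g2 (y + IZR z) = g2 y).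
{ intros z y; destruct (Z.le_gt_cases 0 z) as [h|h].
  - rewrite <- (Z2Nat.id z h), <- INR_IZR_INZ; auto.
  - destruct (N (Z.to_nat (- z)) (y + IZR z)) as [A B].
    rewrite INR_IZR_INZ, Z2Nat.id, opp_IZR in A, B by lia.
    replace (y + IZR z + - IZR z) with y in A, B by ring; auto. }
destruct (base_Int_part x) as [A B].
destruct (Z (Int_part x) (x - IZR (Int_part x))) as [E1 E2].
replace (x - IZR (Int_part x) + IZR (Int_part x)) with x in E1, E2 by ring.
apply HK; exists (x - IZR (Int_part x)); split; [lra|congruence].
Qed.

(* Zero set: boundary of the part X < 219 of the sector |y| < x. *)
Definition barrier (q : point) : R :=
  Rmax (c8 * fst q + s8 * Rabs (snd q) - 219) (Rabs (snd q) - fst q).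

(** In state [false] no half strand touches a diagonal, so the barrier is met only where the
    coordinate along a ray equals 219, at a sample. Points of the barrier have abscissa at most 240,
    which rules out the links and the right half. *)
Lemma barrier_zero b q : config false b q -> barrier q = 0 -> exists d, q = J4pt d.
Proof.
unfold barrier; intros H E; cs_facts.
assert (B1 := Rmax_l (c8 * fst q + s8 * Rabs (snd q) - 219) (Rabs (snd q) - fst q)).
assert (B2 := Rmax_r (c8 * fst q + s8 * Rabs (snd q) - 219) (Rabs (snd q) - fst q)).
assert (B3 : c8 * fst q + s8 * Rabs (snd q) = 219 \/ Rabs (snd q) = fst q).
{ unfold Rmax in E; destruct (Rle_dec _ _) in E; [right|left]; lra. }
rewrite E in B1, B2; clear E.
assert (A := Rabs_pos (snd q)).
assert (A' : 0 <= s8 * Rabs (snd q)) by (apply Rmult_le_pos; lra).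
assert (X : fst q <= 240).
{ apply Rnot_lt_le; intros h.
  assert (92387 / 100000 * 240 <= c8 * fst q) by (apply Rmult_le_compat; lra). lra. }
destruct H as [[d H]|[d H]].
- assert (F : fold q = (fst q, Rabs (snd q))).
  { unfold fold; rewrite (Rabs_right (fst q)) by lra; rewrite Rmax_left, Rmin_right by lra; auto. }
  apply leg_cases in H; destruct H as [H|H].
  + exists d; set (z := unframe false d q) in *.
    assert (G := sigma_fold false d q H); fold z in G; simpl in G; rewrite F in G.
    destruct (sigma_strict z H) as [St _]; rewrite <- G in St; simpl in St.
    assert (Xz : fst z = 219).
    { rewrite <- (psi_psi z), <- G; simpl; lra. }
    apply unframe_inj; fold z.
    destruct H as [H|H].
    * apply (proj2 core_arc z H); auto.
    * apply (proj2 ray_arc z H); auto.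
  + exfalso; destruct (link_norm d q H) as [N _].
    assert (fst q * fst q <= 240 * 240) by (apply Rmult_le_compat; lra).
    assert (Rabs (snd q) * Rabs (snd q) <= 240 * 240) by (apply Rmult_le_compat; lra).
    rewrite <- Rabs_mult, Rabs_right in H1 by (apply Rle_ge, Rle_0_sqr). lra.
- exfalso; destruct (leg_mir_right b d q H) as [L _]; lra.
Qed.

Lemma continuous_barrier (g1 g2 : R -> R) x :
  continuous g1 x -> continuous g2 x -> continuous (fun t => barrier (g1 t, g2 t)) x.
Proof.
intros H1 H2; unfold barrier; cbn [fst snd].
assert (H3 : continuous (fun t => Rabs (g2 t)) x) by (apply continuous_Rabs_comp; auto).
apply continuous_Rmax_comp.
- apply (continuous_lin2 c8 s8 (-219) g1 (fun t => Rabs (g2 t))); auto.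
- apply continuous_ext with (fun t => -1 * g1 t + 1 * Rabs (g2 t) + 0).
  + intros t; match goal with |- _ ?u ?v => change (@eq R u v) end; ring.
  + apply continuous_lin2; auto.
Qed.

(** Treats every parametrization and orientation at once: the barrier function changes sign between
    [u] and [v], so by the intermediate value theorem it vanishes strictly in between, at a
    sample. *)
Lemma not_next_across_barrier cs S b u v :
  (forall K q, In K cs -> K q -> config false b q) ->
  (forall d, In (J4pt d) S) ->
  barrier u * barrier v < 0 -> ~ next_sample cs S u v.
Proof.
intros HC HS Huv (K & HK & _ & _ & g1 & g2 & CP & s & t & Eu & Ht & Ev & NS).
assert (C1 := proj1 CP); assert (C2 := proj1 (proj2 CP)).
set (h := fun x => barrier (g1 (1 * x + s), g2 (1 * x + s))).
assert (Ch : continuity h).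
{ apply continuous_continuity; intros x.
  apply (continuous_barrier (fun x => g1 (1 * x + s)) (fun x => g2 (1 * x + s)) x).
  - apply (continuous_comp (fun x => 1 * x + s) g1); [apply continuous_affine|apply C1].
  - apply (continuous_comp (fun x => 1 * x + s) g2); [apply continuous_affine|apply C2]. }
assert (H0 : h 0 = barrier u).
{ unfold h; replace (1 * 0 + s) with s by ring; rewrite Eu; auto. }
assert (H1 : h t = barrier v).
{ unfold h; replace (1 * t + s) with (s + t) by ring; rewrite Ev; auto. }
destruct (IVT_cor h 0 t Ch) as [x [Hx Zx]]; [lra|rewrite H0, H1; lra|].
assert (N0 : x <> 0) by (intros ->; rewrite H0 in Zx; rewrite Zx in Huv; lra).
assert (N1 : x <> t) by (intros ->; rewrite H1 in Zx; rewrite Zx in Huv; lra).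
unfold h in Zx; replace (1 * x + s) with (s + x) in Zx by ring.
apply (NS x); [lra|].
destruct (barrier_zero b (g1 (s + x), g2 (s + x))) as [d ->]; auto.
apply (HC K); auto; apply curve_param_in; auto.
Qed.

Lemma Npt_coordinates :
  Npt ff = (114 * c8, 114 * s8) /\ Npt (partner true ff) = (114 * s8, 114 * c8).
Proof.
unfold Npt, N2, ff; rewrite !frame_axis; unfold act, sg; simpl; split; f_equal; ring.
Qed.

Lemma barrier_Npt : barrier (Npt ff) < 0 < barrier (Npt (partner true ff)).
Proof.
destruct Npt_coordinates as [-> ->]; cs_facts; unfold barrier; cbn [fst snd]; split.
- rewrite Rabs_right by lra; apply Rmax_lub_lt; [|lra].
  replace (c8 * (114 * c8) + s8 * (114 * s8) - 219) with (114 * (c8 * c8 + s8 * s8) - 219) by ring.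
  rewrite Huni; lra.
- rewrite Rabs_right by lra; eapply Rlt_le_trans; [|apply Rmax_r]; lra.
Qed.

Lemma not_consecutive_left cs S b :
  (forall K q, In K cs -> K q -> config false b q) -> (forall d, In (J4pt d) S) ->
  ~ consecutive cs S (Npt ff) (Npt (partner true ff)).
Proof.
intros HC HS; destruct barrier_Npt as [A B].
intros [H|H]; revert H; apply (not_next_across_barrier cs S b); auto; nra.
Qed.

Lemma legcore_in_not_out s d d' q : legcore_in s d q -> legout s d' q -> q = Npt d /\ d = d'.
Proof.
intros H H'; destruct (legcore_in_X s d q H) as [X E].
destruct (leg_disjoint s d d' q) as [<-|[Ed Eq]].
- left; left; auto.
- apply legout_leg; auto.
- destruct (legout_X s d q H') as [X' _]; split; auto; apply E; lra.
- exfalso; destruct (legout_X s d' q H') as [X' _].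
  rewrite Eq, <- (Ppt_partner s d), <- Ed in X'.
  rewrite <- (Xd_state s) in X'; unfold Ppt in X'; rewrite unframe_frame in X'.
  assert (F := P0_J1_fst); lra.
Qed.

Lemma legcore_in_left s d q : legcore_in s d q -> fst q < 1000.
Proof.
intros H; destruct (sigma_J5 s d q) as [N _]; [left; left; auto|].
apply Rnot_le_lt; intros h.
assert (1000 * 1000 <= fst q * fst q) by (apply Rmult_le_compat; lra).
assert (0 <= snd q * snd q) by apply Rle_0_sqr; lra.
Qed.

(** The component is cut at the two points [Npt] into [mid], which passes through [Ppt], and [rest].
    Samples lie on the outer parts of legs, so [mid] contains none besides its ends. *)
Lemma next_in_strand cs SA K R s d :
  left_samples SA -> In K cs -> (forall q, K q <-> tarc s d q \/ R q) ->
  is_arc R (Qpt (partner s d)) (Qpt d) ->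
  (forall q, tarc s d q -> R q -> q = Qpt d \/ q = Qpt (partner s d)) ->
  next_sample cs (both_sides SA) (Npt d) (Npt (partner s d)).
Proof.
intros HS HK E AR M; set (d' := partner s d) in *.
set (mid := fun q => legcore_in s d q \/ legcore_in s d' q).
set (rest := fun q => (legout s d' q \/ R q) \/ legout s d q).
assert (Nd : d' <> d) by apply partner_neq.
assert (NQ : forall e, fst (Qpt e) = 1000) by apply Qpt_fst.
apply (arcs_next_sample cs (both_sides SA) K mid rest).
- auto.
- intros q; rewrite E; unfold mid, rest, tarc, leg, legout, legcore, core; fold d'.
  unfold legcore_in, legcore_out; tauto.
- apply (arc_concat (legcore_in s d) (legcore_in s d') _ (Ppt s d)).
  + apply arc_rev, legcore_in_arc.
  + rewrite <- Ppt_partner; apply legcore_in_arc.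
  + intros q H H'; destruct (leg_disjoint s d d' q) as [h|[_ h]]; auto; [left; left; auto|left; left; auto|].
    exfalso; auto.
- apply (arc_concat (fun q => legout s d' q \/ R q) (legout s d) _ (Qpt d)).
  + apply (arc_concat (legout s d') R _ (Qpt d')); auto using legout_arc.
    intros q H H'; destruct (M q) as [h|h]; auto; [right; apply legout_leg; auto|].
    exfalso; apply Nd; rewrite h in H; apply legout_leg, leg_Qpt in H; auto.
  + apply arc_rev, legout_arc.
  + intros q [H|H] H'.
    * exfalso; destruct (leg_disjoint s d d' q) as [h|[_ h]]; auto using legout_leg.
      destruct (legcore_in_not_out s d d' q) as [_ e]; auto.
      rewrite h; apply arc_start with (Npt d), legcore_in_arc.
    * destruct (M q) as [h|h]; auto; [left; apply legout_leg; auto|].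
      exfalso; apply Nd; rewrite h in H'; apply legout_leg, leg_Qpt in H'; auto.
- intros q H [[H'|H']|H'].
  + destruct H as [H|H]; destruct (legcore_in_not_out s _ _ q H H'); auto.
  + exfalso; assert (L : fst q < 1000) by (destruct H as [H|H]; apply legcore_in_left in H; auto).
    assert (T : tarc s d q) by (destruct H as [H|H]; [left|right]; left; left; auto).
    destruct (M q T H') as [h|h]; rewrite h, NQ in L; lra.
  + destruct H as [H|H]; destruct (legcore_in_not_out s _ _ q H H'); auto.
- intros q H Hq; apply in_both_sides in Hq; destruct HS as [H1 _].
  destruct Hq as [Hq|Hq]; destruct (H1 _ Hq) as [e He]; specialize (He s).
  + destruct H as [H|H]; destruct (legcore_in_not_out s _ _ q H He); auto.
  + exfalso; apply legout_leg, leg_mir_right in He.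
    assert (L : fst q < 1000) by (destruct H as [H|H]; apply legcore_in_left in H; auto). lra.
Qed.

(** The mirror transports parametrizations, so whatever is shown at the left switch carries over to
    the right one. *)
Lemma next_sample_mir cs cs' S u v :
  (forall K, In K cs -> exists K', In K' cs' /\ forall q, K' q <-> K (mir q)) ->
  (forall q, In (mir q) S -> In q S) ->
  next_sample cs S u v -> next_sample cs' S (mir u) (mir v).
Proof.
intros HC HS (K & HK & Ku & Kv & g1 & g2 & (C1 & C2 & P & I & Im) & s & t & Eu & Ht & Ev & NS).
destruct (HC K HK) as [K' [HK' E]].
exists K'; split; auto; split; [apply E; rewrite mir_mir; auto|].
split; [apply E; rewrite mir_mir; auto|].
set (f1 := fun x => -1 * g1 x + 0 * g2 x + 2000).
assert (F : forall x, (f1 x, g2 x) = mir (g1 x, g2 x)) by (intros x; unfold f1, mir; simpl; f_equal; ring).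
exists f1, g2; split.
- split; [|split; [|split; [|split]]].
  + intros x; apply continuous_lin2; auto.
  + auto.
  + intros x; destruct (P x) as [E1 E2]; unfold f1; rewrite E1, E2; auto.
  + intros x y Hx Hy; rewrite !F; intros Exy; apply I; auto.
    rewrite <- (mir_mir (g1 x, g2 x)), Exy, mir_mir; auto.
  + intros p; rewrite E, Im; split; intros [x [Hx Ex]]; exists x; split; auto.
    * rewrite F, <- Ex, mir_mir; auto.
    * rewrite Ex, F, mir_mir; auto.
- exists s, t; rewrite !F, Eu, Ev; repeat split; auto; try lra.
  intros x Hx; rewrite F; intros Hi; apply (NS x Hx), HS; auto.
Qed.

Lemma consecutive_mir cs cs' S u v :
  (forall K, In K cs -> exists K', In K' cs' /\ forall q, K' q <-> K (mir q)) ->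
  (forall q, In (mir q) S -> In q S) ->
  consecutive cs S u v -> consecutive cs' S (mir u) (mir v).
Proof. intros H1 H2 [H|H]; [left|right]; apply (next_sample_mir cs); auto. Qed.

Lemma sample_graph_neq cs cs' S u v :
  In u S -> In v S -> consecutive cs S u v -> ~ consecutive cs' S u v ->
  sample_graph cs S <> sample_graph cs' S /\ sample_graph cs' S <> sample_graph cs S.
Proof.
intros Hu Hv H N.
assert (A : sample_graph cs S u v) by (repeat split; auto).
split; intros E; apply N.
- rewrite E in A; apply A.
- rewrite <- E in A; apply A.
Qed.

Lemma union_singleton K q : union_of [K] q <-> K q.
Proof.
unfold union_of; split; [intros (K' & [<-|[]] & H); auto|intros H; exists K; simpl; auto].
Qed.

(** In these configurations the pair [u], [v] is an edge exactly when the left state is [true], and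
    its mirror image exactly when the right state is. All four values of these two bits occur, so
    any two graphs differ at one of the two pairs. *)
Theorem theorem4p1 :
  exists (S : list point) (cs1 cs2 cs3 cs4 : list (point -> Prop)),
    (exists K1, cs1 = [K1] /\ closed_curve K1) /\
    (exists K2, cs2 = [K2] /\ closed_curve K2) /\
    disjoint_curves cs3 /\ disconnected (union_of cs3) /\
    disjoint_curves cs4 /\ disconnected (union_of cs4) /\
    eps_sample (72 / 100) (union_of cs1) S /\
    eps_sample (72 / 100) (union_of cs2) S /\
    eps_sample (72 / 100) (union_of cs3) S /\
    eps_sample (72 / 100) (union_of cs4) S /\
    sample_graph cs1 S <> sample_graph cs2 S /\
    sample_graph cs1 S <> sample_graph cs3 S /\
    sample_graph cs1 S <> sample_graph cs4 S /\
    sample_graph cs2 S <> sample_graph cs3 S /\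
    sample_graph cs2 S <> sample_graph cs4 S /\
    sample_graph cs3 S <> sample_graph cs4 S.
Proof.
destruct left_samples_exist as [SA HS].
set (S := both_sides SA); set (u := Npt ff); set (v := Npt (partner true ff)).
set (cs1 := [config false true]); set (cs2 := [config true false]).
exists S, cs1, cs2, (rings false), (rings true).
assert (SJ : forall d, In (J4pt d) S).
{ intros d; apply in_both_sides; left; apply (proj1 (proj2 HS) d). }
assert (Smir : forall q, In (mir q) S -> In q S).
{ intros q; unfold S; rewrite !in_both_sides, mir_mir; tauto. }
assert (SN : forall d, In (Npt d) S).
{ intros d; apply in_both_sides; left; apply (proj1 (proj2 HS) d). }
assert (SM : forall q, In q S -> In (mir q) S) by (intros q H; apply Smir; rewrite mir_mir; auto).
(* The two connected curves are mirror images of each other and every ring is its own mirror image,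
   so the facts about [u], [v] yield those about the mirrored pair. *)
assert (m12 : forall K, In K cs1 -> exists K', In K' cs2 /\ forall q, K' q <-> K (mir q)).
{ intros K [<-|[]]; exists (config true false); split; [simpl; auto|]; intros q; apply config_mir. }
assert (m21 : forall K, In K cs2 -> exists K', In K' cs1 /\ forall q, K' q <-> K (mir q)).
{ intros K [<-|[]]; exists (config false true); split; [simpl; auto|]; intros q; apply config_mir. }
assert (mrings : forall s K, In K (rings s) -> exists K', In K' (rings s) /\ forall q, K' q <-> K (mir q)).
{ intros s K HK; exists K; split; auto; intros q.
  assert (R : forall d, ring s d q <-> ring s d (mir q)).
  { intros d; unfold ring, tarc'; rewrite mir_mir; tauto. }
  destruct s; simpl in HK; repeat (destruct HK as [<-|HK]; [apply R|]); contradiction. }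
assert (Y2 : consecutive cs2 S u v).
{ left; apply (next_in_strand cs2 SA (config true false) (chain_rest true)); auto.
  - simpl; auto.
  - apply (config_chain true).
  - apply (chain_rest_arc true).
  - apply (chain_rest_meet true). }
assert (Y4 : consecutive (rings true) S u v).
{ left; apply (next_in_strand (rings true) SA (ring true ff) (tarc' true ff)); auto.
  - simpl; auto.
  - intros q; reflexivity.
  - apply arc_rev, tarc'_arc.
  - apply ring_meet. }
assert (N1 : ~ consecutive cs1 S u v).
{ apply (not_consecutive_left cs1 S true); auto; intros K q [<-|[]]; auto. }
assert (N3 : ~ consecutive (rings false) S u v).
{ apply (not_consecutive_left _ S false); auto; intros K q HK Kq.
  apply union_rings; exists K; auto. }
assert (Y1' : consecutive cs1 S (mir u) (mir v)) by (apply (consecutive_mir cs2); auto).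
assert (Y4' : consecutive (rings true) S (mir u) (mir v)) by (apply (consecutive_mir (rings true)); auto).
assert (N2' : ~ consecutive cs2 S (mir u) (mir v)).
{ intros H; apply N1; rewrite <- (mir_mir u), <- (mir_mir v); apply (consecutive_mir cs2); auto. }
assert (N3' : ~ consecutive (rings false) S (mir u) (mir v)).
{ intros H; apply N3; rewrite <- (mir_mir u), <- (mir_mir v).
  apply (consecutive_mir (rings false)); auto. }
split; [exists (config false true); split; auto; apply (config_connected false)|].
split; [exists (config true false); split; auto; apply (config_connected true)|].
split; [apply rings_disjoint|]; split; [apply rings_disconnected|].
split; [apply rings_disjoint|]; split; [apply rings_disconnected|].
split; [apply (config_eps_sample SA false true); auto; apply union_singleton|].
split; [apply (config_eps_sample SA true false); auto; apply union_singleton|].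
split; [apply (config_eps_sample SA false false); auto; apply union_rings|].
split; [apply (config_eps_sample SA true true); auto; apply union_rings|].
split; [apply (sample_graph_neq cs2 cs1 S u v); auto; apply SN|].
split; [apply (sample_graph_neq cs1 (rings false) S (mir u) (mir v)); auto; apply SM, SN|].
split; [apply (sample_graph_neq (rings true) cs1 S u v); auto; apply SN|].
split; [apply (sample_graph_neq cs2 (rings false) S u v); auto; apply SN|].
split; [apply (sample_graph_neq (rings true) cs2 S (mir u) (mir v)); auto; apply SM, SN|].
apply (sample_graph_neq (rings true) (rings false) S u v); auto; apply SN.
Qed.
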